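(* Consider a sequence (indexed by the number of states $n$) of Block Markov Chains with fixed parameters $(\alpha,p)$, as defined in the context. Assume $\min_{k\in[K]}\alpha_k>0$, that $p$ is irreducible (with stationary distribution $\pi$), that $I(\alpha,p)>0$, and that $\ell_n=\omega(n)$. Let $\gamma_n,h_n,\rho_n>0$ be deterministic sequences satisfying $$\omega\big(\sqrt{\ell_n/n}\big)=\gamma_n=o(\ell_n/n),\qquad \omega(\ell_n/n)=nh_n^2=o\big((\ell_n/n)^2\big),\qquad \omega\big((\ell_n/n)/h_n^2\big)=\rho_n=o(n).$$ Run the density-based clustering algorithm of the context on $\hat N_\Gamma$ with $r=\hat K^{\mathrm{spec}}:=|\{i\in[n]:\sigma_i(\hat N_\Gamma)\ge\gamma_n\}|$ and thresholds $h_n,\rho_n$, followed by the completion step of the context, and let $\mathcal E$ be the set of misclassified states of the resulting clustering. Then $$\frac{|\mathcal E|}{n}=O_{\mathbb P}\Big(\frac n{\ell_n}\Big)=o_{\mathbb P}(1).$$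
   Context: Notation: $[m]=\{1,\dots,m\}$; for deterministic positive sequences, $a_n=\omega(b_n)$ means $a_n/b_n\to\infty$ and $a_n=o(b_n)$ means $a_n/b_n\to0$; ''$\omega(b_n)=a_n=o(c_n)$'' means $a_n=\omega(b_n)$ and $a_n=o(c_n)$. For random variables $Y_n$: $Y_n=O_{\mathbb P}(a_n)$ iff for every $\varepsilon>0$ there are $\delta_\varepsilon,N_\varepsilon$ with $\mathbb P[|Y_n/a_n|\ge\delta_\varepsilon]\le\varepsilon$ for all $n>N_\varepsilon$; $Y_n=o_{\mathbb P}(a_n)$ iff $\mathbb P[|Y_n/a_n|\ge\delta]\to0$ for all $\delta>0$. $\sigma_1(A)\ge\sigma_2(A)\ge\dots$ denote the singular values of a matrix $A$. Block Markov Chain (BMC): fix $K\in\mathbb N_{\ge1}$, a stochastic matrix $p=(p_{i,j})_{i,j\in[K]}$ and $\alpha=(\alpha_k)_{k\in[K]}$ with $\sum_k\alpha_k=1$. For each (sufficiently large) $n$ there is a surjective map $\sigma:[n]\to[K]$ (depending on $n$) with clusters $\mathcal V_k=\sigma^{-1}(k)$ satisfying $|\mathcal V_k|/n\to\alpha_k$ as $n\to\infty$. The BMC is the Markov chain $(X_t)_{t\ge0}$ on $[n]$ with transition matrix $P_{x,y}=p_{\sigma(x),\sigma(y)}/|\mathcal V_{\sigma(y)}|$. If $p$ is irreducible with stationary distribution $\pi$, then $\Pi_x=\pi_{\sigma(x)}/|\mathcal V_{\sigma(x)}|$ is the unique stationary distribution of $P$. One observes a trajectory $X_0,\dots,X_{\ell_n}$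 with $X_0\sim\Pi$, where $(\ell_n)$ is a deterministic sequence of positive integers. Information quantity: $$I(\alpha,p)=\min_{i,j\in[K],\,i\ne j}\Big\{\sum_{k=1}^K\frac1{\alpha_i}\Big(\pi_ip_{i,k}\ln\frac{p_{i,k}}{p_{j,k}}+\pi_kp_{k,i}\ln\frac{p_{k,i}\alpha_j}{p_{k,j}\alpha_i}\Big)+\Big(\frac{\pi_j}{\alpha_j}-\frac{\pi_i}{\alpha_i}\Big)\Big\},$$ with the conventions $0\ln(\cdot)=0$ (including $0\ln\frac00=0$) and $a\ln\frac a0=+\infty$ for $a>0$ (and $I=+\infty$ if $K=1$). Trimmed count matrix: $\hat N_{x,y}=\sum_{t=0}^{\ell_n-1}\mathbf 1\{X_t=x,X_{t+1}=y\}$ for $x,y\in[n]$. $\Gamma\subseteq[n]$ is the set of the $\lfloor n\exp(-\ell_n/n)\rfloor$ most visited states, i.e. those $y$ with the largest column sums $\sum_x\hat N_{x,y}$ (ties broken arbitrarily), and $(\hat N_\Gamma)_{x,y}=\hat N_{x,y}\mathbf 1\{x\notin\Gamma,\,y\notin\Gamma\}$. Density-based clustering algorithm (input $\hat N_\Gamma$, $r$, $h_n$, $\rho_n$): let $\hat N_\Gamma=U\Sigma V^{\top}$ be a singular value decomposition with $\Sigma=\mathrm{diag}(\sigma_1,\dots,\sigma_n)$, $\sigma_1\ge\dots\ge\sigma_n$, and form the $n\times2r$ matrix $\hat X=[\sigma_1U_{\cdot,1},\dots,\sigma_rU_{\cdot,r},\sigma_1V_{\cdot,1},\dots,\sigma_rV_{\cdot,r}]$.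 For $x\in[n]$ let $\mathcal N_x=\{y\in[n]:\|\hat X_{x,\cdot}-\hat X_{y,\cdot}\|_2\le h_n\}$. Initialize $\hat{\mathcal V}_0=[n]$, $k=0$. While $|\hat{\mathcal V}_k|\ge\rho_n$: increase $k$ by 1, choose $z_k^*\in\arg\max_{x\in[n]}|\mathcal N_x\setminus\bigcup_{l=1}^{k-1}\hat{\mathcal V}_l|$ (ties broken arbitrarily), and set $\hat{\mathcal V}_k=\mathcal N_{z_k^*}\setminus\bigcup_{l=1}^{k-1}\hat{\mathcal V}_l$. When the loop stops, output $\hat K=k-1$, the centers $z_1^*,\dots,z_{\hat K}^*$ and the sets $\hat{\mathcal V}_1,\dots,\hat{\mathcal V}_{\hat K}$. Completion step: each $x\in[n]\setminus\bigcup_{l=1}^{\hat K}\hat{\mathcal V}_l$ is added to $\hat{\mathcal V}_{k_*}$, where $k_*\in\arg\min_{k\in[\hat K]}\|\hat X_{x,\cdot}-\hat X_{z_k^*,\cdot}\|_2$. Misclassified states: on the event $\hat K=K$, $\mathcal E=\bigcup_{k=1}^K\hat{\mathcal V}_{\gamma^{\mathrm{opt}}(k)}\setminus\mathcal V_k$, where $\gamma^{\mathrm{opt}}$ minimizes $|\bigcup_{k=1}^K\hat{\mathcal V}_{\gamma(k)}\setminus\mathcal V_k|$ over permutations $\gamma$ of $[K]$ and $\hat{\mathcal V}_k$ are the clusters after the completion step; on the event $\hat K\ne K$ (whose probability tends to $0$ under the hypotheses), $\mathcal E\subseteq[n]$ may be defined arbitrarily, e.g. $\mathcal E=[n]$.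 *)

(* Defs.v *)
From HB Require Import structures.
From mathcomp Require Import all_boot all_order all_algebra all_fingroup.
From mathcomp Require Import all_classical all_reals all_analysis.

Set Implicit Arguments.
Unset Strict Implicit.
Unset Printing Implicit Defensive.

Import Order.TTheory GRing.Theory Num.Theory.
Import numFieldNormedType.Exports.

Local Open Scope classical_set_scope.
Local Open Scope ring_scope.

Definition omega_of (R : realType) (a b : nat -> R) : Prop :=
  (a n / b n) @[n --> \oo] --> +oo.

Definition o_of (R : realType) (a b : nat -> R) : Prop :=
  (a n / b n) @[n --> \oo] --> (0 : R).

Definition OP (R : realType) (d : nat -> measure_display)
    (T : forall n, measurableType (d n)) (P : forall n, probability (T n) R)
    (Y : forall n, T n -> R) (a : nat -> R) : Prop :=
  forall eps : R, 0 < eps -> exists (delta : R) (N : nat), 0 < delta /\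
    forall n, (N < n)%N ->
      (P n [set w | (delta <= `|Y n w / a n|)%R] <= eps%:E)%E.

Definition oP (R : realType) (d : nat -> measure_display)
    (T : forall n, measurableType (d n)) (P : forall n, probability (T n) R)
    (Y : forall n, T n -> R) (a : nat -> R) : Prop :=
  forall delta : R, 0 < delta ->
    P n [set w | (delta <= `|Y n w / a n|)%R] @[n --> \oo] --> 0%E.

Definition stochastic_mx (R : realType) (K : nat) (p : 'M[R]_K) : Prop :=
  (forall i j, 0 <= p i j) /\ (forall i, \sum_j p i j = 1).

Definition irreducible_mx (R : realType) (K : nat) (p : 'M[R]_K) : Prop :=
  forall i j, exists t : nat, 0 < (p ^+ t) i j.

Definition stationary_distribution (R : realType) (K : nat) (p : 'M[R]_K)
    (pi : 'I_K -> R) : Prop :=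
  [/\ forall k, 0 <= pi k, \sum_k pi k = 1
    & forall j, \sum_i pi i * p i j = pi j].

Definition discrete_rv d (T : measurableType d) (S : Type) (X : T -> S) : Prop :=
  forall x : S, measurable [set w | X w = x].

(* The last clause is the Markov property with transition probabilities Q,
   multiplied out so that conditioning on null events is harmless. *)
Definition markov_chain (R : realType) d (T : measurableType d)
    (P : probability T R) (S : finType) (mu : S -> R) (Q : S -> S -> R)
    (X : nat -> T -> S) : Prop :=
  [/\ forall t, discrete_rv (X t),
      forall x, P [set w | X 0%N w = x] = (mu x)%:E
    & forall (t : nat) (x : nat -> S),
        P [set w | forall s, (s <= t.+1)%N -> X s w = x s] =
        (P [set w | forall s, (s <= t)%N -> X s w = x s]
          * (Q (x t) (x t.+1))%:E)%E].

Definition bmc_cluster (K n : nat) (sigma : 'I_n -> 'I_K) (k : 'I_K) : {set 'I_n} :=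
  [set x | sigma x == k]%SET.

Definition bmc_kernel (R : realType) (K n : nat) (p : 'M[R]_K)
    (sigma : 'I_n -> 'I_K) (x y : 'I_n) : R :=
  p (sigma x) (sigma y) / #|bmc_cluster sigma (sigma y)|%:R.

Definition bmc_stationary (R : realType) (K n : nat) (pi : 'I_K -> R)
    (sigma : 'I_n -> 'I_K) (x : 'I_n) : R :=
  pi (sigma x) / #|bmc_cluster sigma (sigma x)|%:R.

(* a * ln (b / c) with 0 ln(.) = 0 and a ln (b / 0) = +oo for a > 0; it is used
   for a >= 0 only. *)
Definition xln (R : realType) (a b c : R) : \bar R :=
  if a == 0 then 0%E
  else if c == 0 then +oo%E
  else (a * ln (b / c))%:E.

Definition information_pair (R : realType) (K : nat) (alpha : 'I_K -> R)
    (p : 'M[R]_K) (pi : 'I_K -> R) (i j : 'I_K) : \bar R :=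
  (\sum_(k < K) ((alpha i)^-1)%:E *
      (xln (pi i * p i k) (p i k) (p j k)
       + xln (pi k * p k i) (p k i * alpha j)%R (p k j * alpha i)%R)
   + (pi j / alpha j - pi i / alpha i)%:E)%E.

Definition information (R : realType) (K : nat) (alpha : 'I_K -> R)
    (p : 'M[R]_K) (pi : 'I_K -> R) : \bar R :=
  \big[Order.min/+oo%E]_(ij : 'I_K * 'I_K | ij.1 != ij.2)
    information_pair alpha p pi ij.1 ij.2.

Definition count_mx (R : realType) (n l : nat) (x : nat -> 'I_n) : 'M[R]_n :=
  \matrix_(i, j) (\sum_(t < l) ((x t == i) && (x t.+1 == j)))%:R.

Definition most_visited (R : realType) (n l : nat) (N : 'M[R]_n)
    (G : {set 'I_n}) : Prop :=
  #|G| = Num.truncn (n%:R * expR (- (l%:R / n%:R)) : R) /\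
  forall y z, y \in G -> z \notin G -> \sum_x N x z <= \sum_x N x y.

Definition trim (R : realType) (n : nat) (N : 'M[R]_n) (G : {set 'I_n})
    : 'M[R]_n :=
  \matrix_(x, y) (if (x \notin G) && (y \notin G) then N x y else 0).

Definition is_svd (R : realType) (n : nat) (A U : 'M[R]_n) (s : 'rV[R]_n)
    (V : 'M[R]_n) : Prop :=
  [/\ U^T *m U = 1%:M, V^T *m V = 1%:M,
      forall i, 0 <= s 0 i,
      forall i j : 'I_n, (i <= j)%N -> s 0 j <= s 0 i
    & A = U *m diag_mx s *m V^T].

Definition spectral_rank (R : realType) (n : nat) (s : 'rV[R]_n) (gam : R)
    : nat := #|[set i | gam <= s 0 i]%SET|.

Lemma spectral_rank_le (R : realType) (n : nat) (s : 'rV[R]_n) (gam : R) :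
  (spectral_rank s gam <= n)%N.
Proof. by rewrite -[leqRHS](card_ord n) max_card. Qed.

(* Column i of U *m diag_mx s is s_i times column i of U. *)
Definition embedding (R : realType) (n r : nat) (r_le_n : (r <= n)%N)
    (U : 'M[R]_n) (s : 'rV[R]_n) (V : 'M[R]_n) : 'M[R]_(n, r + r) :=
  row_mx (colsub (widen_ord r_le_n) (U *m diag_mx s))
         (colsub (widen_ord r_le_n) (V *m diag_mx s)).

(* The library norm on matrices is the sup norm, hence this one. *)
Definition l2norm (R : realType) (m : nat) (v : 'rV[R]_m) : R :=
  Num.sqrt (\sum_i v 0 i ^+ 2).

Definition row_dist (R : realType) (n m : nat) (Xh : 'M[R]_(n, m))
    (x y : 'I_n) : R :=
  l2norm (row x Xh - row y Xh).

Definition neighbourhood (R : realType) (n m : nat) (Xh : 'M[R]_(n, m))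
    (h : R) (x : 'I_n) : {set 'I_n} :=
  [set y | row_dist Xh x y <= h]%SET.

Definition assigned (n : nat) (C : nat -> {set 'I_n}) (k : nat) : {set 'I_n} :=
  (\bigcup_(1 <= l < k) C l)%SET.

(* A possible run of the loop: q is the final value of the counter k, z k and
   C k (1 <= k <= q) are the centers and sets.  The output is made of the first
   q - 1 of them, since the set C q that stops the loop is discarded.  Values of
   z and C at other indices (except C 0) are irrelevant. *)
Definition density_run (R : realType) (n : nat) (N : 'I_n -> {set 'I_n})
    (rho : R) (q : nat) (z : nat -> 'I_n) (C : nat -> {set 'I_n}) : Prop :=
  [/\ C 0%N = [set: 'I_n]%SET,
      forall k, (k < q)%N -> rho <= #|C k|%:R,
      #|C q|%:R < rho
    & forall k, (1 <= k <= q)%N ->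
        (forall x, (#|N x :\: assigned C k| <= #|N (z k) :\: assigned C k|)%N) /\
        C k = (N (z k) :\: assigned C k)%SET].

(* c x is the label k_* chosen for a state x left unassigned by the first K
   sets. *)
Definition completion_choice (R : realType) (n m : nat) (Xh : 'M[R]_(n, m))
    (K : nat) (z : nat -> 'I_n) (C : nat -> {set 'I_n}) (c : 'I_n -> nat)
    : Prop :=
  forall x, x \notin assigned C K.+1 ->
    (1 <= c x <= K)%N /\
    forall k, (1 <= k <= K)%N ->
      row_dist Xh x (z (c x)) <= row_dist Xh x (z k).

(* Clusters after completion; the label i : 'I_K stands for i + 1. *)
Definition completed (n K : nat) (C : nat -> {set 'I_n}) (c : 'I_n -> nat)
    (i : 'I_K) : {set 'I_n} :=
  (C i.+1 :|: [set x | (x \notin assigned C K.+1) && (c x == i.+1)])%SET.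

Definition misclassified (n K : nat) (sigma : 'I_n -> 'I_K)
    (D : 'I_K -> {set 'I_n}) (g : {perm 'I_K}) : {set 'I_n} :=
  (\bigcup_(k < K) (D (g k) :\: bmc_cluster sigma k))%SET.

Definition misclassified_states (n K : nat) (sigma : 'I_n -> 'I_K)
    (D : 'I_K -> {set 'I_n}) (E : {set 'I_n}) : Prop :=
  exists g : {perm 'I_K},
    (forall g' : {perm 'I_K},
       (#|misclassified sigma D g| <= #|misclassified sigma D g'|)%N) /\
    E = misclassified sigma D g.

(* E is a possible set of misclassified states for the trajectory
   x 0, ..., x l, for some resolution of the arbitrary choices (SVD, ties).  The
   estimated number of clusters is q.-1; E is unconstrained when it is not K.
   As 0 < K in use, q = 0 (no pass through the loop) counts as such a case. *)
Definition clustering_outcome (R : realType) (K n l : nat)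
    (sigma : 'I_n -> 'I_K) (gam h rho : R) (x : nat -> 'I_n) (E : {set 'I_n})
    : Prop :=
  exists (G : {set 'I_n}) (U : 'M[R]_n) (s : 'rV[R]_n) (V : 'M[R]_n),
    most_visited l (count_mx R l x) G /\
    is_svd (trim (count_mx R l x) G) U s V /\
    let Xh := embedding (spectral_rank_le s gam) U s V in
    exists (q : nat) (z : nat -> 'I_n) (C : nat -> {set 'I_n}),
      density_run (neighbourhood Xh h) rho q z C /\
      (q.-1 = K ->
       exists c : 'I_n -> nat,
         completion_choice Xh K z C c /\
         misclassified_states sigma (@completed n K C c) E).

(* Main.v *)
(* Feige and Ofek's argument bounds the operator norm of the trimmed count
   matrix minus its expectation by C sqrt(ell/n), with probability tending to 1:
   "light" pairs of coordinates are handled by an exponential moment bound over a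
   finite net, "heavy" pairs by the discrepancy property and by the fact that
   trimming removes every state visited more than C ell/n times. Splitting the
   path into its even and odd transitions gives disjoint pairs of states, whose
   exponential moments are bounded without any mixing assumption: the centring
   is not the expectation but the average of the counts over pairs of clusters.
   These K^2 averages are compared to their limit in second moment, through the
   Poisson equation of p.
   The limit has rank at most K and nonzero singular values of order ell/n, so
   that truncating the SVD at gam leaves a Frobenius error sqrt(O(K ell/n)). As
   I > 0 keeps the rows of different clusters at distance c ell/n^(3/2), much
   more than h, all but o(rho) rows lie within h/4 of their center, and the greedy
   loop finds one set per cluster and stops. By Markov's inequality, O(n^2/ell)
   rows are badly placed on the scale of the separation. *)
Require Import Defs.
From HB Require Import structures.
From mathcomp Require Import all_boot all_order all_algebra all_fingroup.
From mathcomp Require Import all_classical all_reals all_analysis.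
From mathcomp Require Import zify ring lra.

Set Implicit Arguments.
Unset Strict Implicit.
Unset Printing Implicit Defensive.

Import Order.TTheory GRing.Theory Num.Theory.
Import numFieldNormedType.Exports.

Local Open Scope classical_set_scope.
Local Open Scope ring_scope.

(** * Bilinear operator norm bounds *)

(** A transition out of a known state [x] charges a single row of the count matrix, so conditionally
    on the present it is not spread over all pairs. Conditioned on the state [z] just before it, a
    pair of consecutive states has law [Q z x * Q x y]: at most [(kappa / n) ^+ 2] whatever [z] is,
    and depending on [x] and [y] only through their clusters. The first property gives Poisson-like
    exponential moments, the second makes cluster averages the exact centring for every [z].
    Randomness is confined to [good_path], a property of the visited sequence. The estimates that
    follow from it are deterministic and hold for every trimmed set, singular value decomposition
    and tie-breaking, so the arbitrary choices of the algorithm never meet the probability. The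
    limit matrix may have rank below [K]. The threshold [gam] recovers that rank, and the number of
    clusters comes from the greedy loop alone. The non-uniqueness of singular vectors is harmless,
    because the embedding has the same row distances as the truncated matrix put next to its
    transpose. *)

Lemma le_of_eq (R : realType) (x y : R) : x = y -> x <= y.
Proof. by move=> ->. Qed.

(** Cauchy-Schwarz: the squares of [B * a i - S * b i] add up to [B * (A * B - S ^+ 2)]; if [B = 0],
    all [b i] vanish. *)
Lemma sum_mul_sqr_le (R : realType) (I : finType) (a b : I -> R) :
  (\sum_i a i * b i) ^+ 2 <= (\sum_i a i ^+ 2) * (\sum_i b i ^+ 2).
Proof.
set A := \sum_i a i ^+ 2; set B := \sum_i b i ^+ 2; set S := \sum_i a i * b i.
have B0 : 0 <= B by apply: sumr_ge0 => i _; exact: sqr_ge0.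
have key : 0 <= A * B ^+ 2 - S ^+ 2 * B.
  have -> : A * B ^+ 2 - S ^+ 2 * B = \sum_i (B * a i - S * b i) ^+ 2.
    under eq_bigr => i _ do rewrite sqrrB !exprMn.
    rewrite big_split /= sumrB -!mulr_sumr -/A -/B.
    have -> : \sum_i (B * a i * (S * b i)) *+ 2 = B * S * S *+ 2.
      rewrite sumrMnl; congr (_ *+ 2); rewrite /S mulr_sumr.
      by apply: eq_bigr => i _; ring.
    by ring.
  by apply: sumr_ge0 => i _; exact: sqr_ge0.
have [B_gt0|] := ltrP 0 B.
  rewrite -subr_ge0 -(pmulr_lge0 _ B_gt0).
  by move: key; congr (_ <= _); ring.
move=> B_le0; have B_eq0 : B = 0 by apply/eqP; rewrite eq_le B_le0.
have b0 i : b i = 0.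
  have := B_eq0; rewrite /B => /eqP; rewrite psumr_eq0; last first.
    by move=> j _; exact: sqr_ge0.
  by move=> /allP /(_ i (mem_index_enum _)) /=; rewrite sqrf_eq0 => /eqP.
by rewrite B_eq0 mulr0 /S big1 ?expr0n // => i _; rewrite b0 mulr0.
Qed.

Lemma sum_mul_le_sqrt (R : realType) (I : finType) (a b : I -> R) :
  \sum_i a i * b i <=
  Num.sqrt (\sum_i a i ^+ 2) * Num.sqrt (\sum_i b i ^+ 2).
Proof.
have A0 (c : I -> R) : 0 <= \sum_i c i ^+ 2.
  by apply: sumr_ge0 => i _; exact: sqr_ge0.
rewrite -sqrtrM // (le_trans (ler_norm _)) // -sqrtr_sqr ler_sqrt ?mulr_ge0 //.
exact: sum_mul_sqr_le.
Qed.

Definition sqnorm (R : realType) m (v : 'rV[R]_m) : R := \sum_i v 0 i ^+ 2.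

Lemma sqnorm_ge0 (R : realType) m (v : 'rV[R]_m) : 0 <= sqnorm v.
Proof. by apply: sumr_ge0 => i _; exact: sqr_ge0. Qed.

Lemma sqnormE (R : realType) m (v : 'rV[R]_m) : sqnorm v = (v *m v^T) 0 0.
Proof. by rewrite mxE; apply: eq_bigr => i _; rewrite mxE expr2. Qed.

Lemma sqnorm_eq0 (R : realType) m (v : 'rV[R]_m) : (sqnorm v == 0) = (v == 0).
Proof.
apply/eqP/eqP => [/eqP|->]; last first.
  by rewrite /sqnorm big1 // => i _; rewrite mxE expr0n.
rewrite psumr_eq0; last by move=> j _; exact: sqr_ge0.
move=> /allP h; apply/rowP => i; rewrite mxE; apply/eqP.
by rewrite -sqrf_eq0; exact: (h i (mem_index_enum _)).
Qed.

Lemma sqnorm_gt0 (R : realType) m (v : 'rV[R]_m) : (0 < sqnorm v) = (v != 0).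
Proof. by rewrite lt_def sqnorm_ge0 andbT sqnorm_eq0. Qed.

Lemma sqnorm_mul_orth (R : realType) m n (Q : 'M[R]_(m, n)) (v : 'rV[R]_m) :
  Q *m Q^T = 1%:M -> sqnorm (v *m Q) = sqnorm v.
Proof.
by move=> QQ; rewrite !sqnormE trmx_mul mulmxA -(mulmxA v) QQ mulmx1.
Qed.

Lemma l2normE (R : realType) m (v : 'rV[R]_m) : l2norm v = Num.sqrt (sqnorm v).
Proof. by []. Qed.

Lemma l2norm_ge0 (R : realType) m (v : 'rV[R]_m) : 0 <= l2norm v.
Proof. exact: sqrtr_ge0. Qed.

Lemma sqr_l2norm (R : realType) m (v : 'rV[R]_m) : l2norm v ^+ 2 = sqnorm v.
Proof. by rewrite sqr_sqrtr ?sqnorm_ge0. Qed.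

Lemma l2normN (R : realType) m (v : 'rV[R]_m) : l2norm (- v) = l2norm v.
Proof.
by congr Num.sqrt; apply: eq_bigr => i _; rewrite mxE sqrrN.
Qed.

Lemma l2normD (R : realType) m (u v : 'rV[R]_m) :
  l2norm (u + v) <= l2norm u + l2norm v.
Proof.
rewrite -(@ler_pXn2r _ 2) ?nnegrE ?addr_ge0 ?l2norm_ge0 //.
rewrite sqrrD !sqr_l2norm {1}/sqnorm.
under eq_bigr => i _ do rewrite mxE sqrrD.
rewrite big_split big_split /= lerD2r lerD2l sumrMnl lerMn2r /=.
exact: sum_mul_le_sqrt.
Qed.

(** An operator norm bound stated on the bilinear form, which is what a net argument produces and
    which passes at once to sums and transposes. *)
Definition opbound (R : realType) m n (M : 'M[R]_(m, n)) (e : R) : Prop :=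
  forall u v, (u *m M *m v^T) 0 0 <= e * (l2norm u * l2norm v).

(** Test the form against [v = u *m M] and divide by the norm of [v]. *)
Lemma opbound_mul (R : realType) m n (M : 'M[R]_(m, n)) (e : R) u :
  0 <= e -> opbound M e -> sqnorm (u *m M) <= e ^+ 2 * sqnorm u.
Proof.
move=> e0 /(_ u (u *m M)); rewrite -sqnormE -!sqr_l2norm -exprMn mulrA.
set a := l2norm _; set b := _ * _ => h.
have [a0|a0] := eqVneq a 0; first by rewrite a0 expr0n sqr_ge0.
have a_gt0 : 0 < a by rewrite lt_def a0 l2norm_ge0.
have ab : a <= e * l2norm u by rewrite -(ler_pM2r a_gt0) -expr2.
by rewrite ler_pXn2r // nnegrE ?mulr_ge0 ?l2norm_ge0.
Qed.

Lemma opbound_tr (R : realType) m n (M : 'M[R]_(m, n)) (e : R) :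
  opbound M e -> opbound M^T e.
Proof.
move=> h u v; have := h v u; rewrite [l2norm u * _]mulrC.
suff -> : u *m M^T *m v^T = (v *m M *m u^T)^T.
  by rewrite [X in _ -> X <= _]mxE.
by rewrite !trmx_mul !trmxK mulmxA.
Qed.

Lemma opboundD (R : realType) m n (M N : 'M[R]_(m, n)) (e f : R) :
  opbound M e -> opbound N f -> opbound (M + N) (e + f).
Proof.
by move=> hM hN u v; rewrite mulmxDr mulmxDl mxE mulrDl lerD ?hM ?hN.
Qed.

Lemma opboundN (R : realType) m n (M : 'M[R]_(m, n)) (e : R) :
  opbound M e -> opbound (- M) e.
Proof.
by move=> h u v; rewrite mulmxN -!mulNmx -(l2normN u); exact: h.
Qed.

Lemma opbound_frob (R : realType) m n (M : 'M[R]_(m, n)) (e : R) : 0 <= e ->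
  \sum_i \sum_j M i j ^+ 2 <= e ^+ 2 -> opbound M e.
Proof.
move=> e0 hM u v; rewrite !l2normE /sqnorm mxE.
apply: le_trans (sum_mul_le_sqrt _ _) _.
under [X in _ * Num.sqrt X]eq_bigr => j _ do rewrite mxE.
rewrite mulrA ler_wpM2r ?sqrtr_ge0 // -(ger0_norm e0) -sqrtr_sqr.
rewrite -sqrtrM ?sqr_ge0 // ler_sqrt; last first.
  by rewrite mulr_ge0 ?sqr_ge0 // sumr_ge0 // => i _; exact: sqr_ge0.
apply: (@le_trans _ _ (\sum_j (\sum_i u 0 i ^+ 2) * (\sum_i M i j ^+ 2))).
  by apply: ler_sum => j _; rewrite mxE; exact: sum_mul_sqr_le.
rewrite -mulr_sumr mulrC ler_wpM2r //.
  by apply: sumr_ge0 => i _; exact: sqr_ge0.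
by rewrite exchange_big.
Qed.

Lemma opbound_le (R : realType) m n (M : 'M[R]_(m, n)) (e f : R) :
  e <= f -> opbound M e -> opbound M f.
Proof.
move=> ef h u v; apply: le_trans (h u v) _.
by rewrite ler_wpM2r // mulr_ge0 ?l2norm_ge0.
Qed.

(** * Truncated singular value decompositions *)

Lemma rank_cap_nonzero (F : fieldType) m1 m2 n (X : 'M[F]_(m1, n))
    (Y : 'M[F]_(m2, n)) : (n < \rank X + \rank Y)%N ->
  exists v : 'rV[F]_n, [/\ v != 0, (v <= X)%MS & (v <= Y)%MS].
Proof.
rewrite -mxrank_sum_cap => h.
have : (X :&: Y)%MS != 0.
  by rewrite -mxrank_eq0; have := rank_leq_col (X + Y)%MS; lia.
case/rowV0Pn => v; rewrite sub_capmx => /andP[vX vY] v0.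
by exists v; split.
Qed.

Definition svd_trunc (R : realType) n (U : 'M[R]_n) (s : 'rV[R]_n)
    (V : 'M[R]_n) (r : nat) : 'M[R]_n :=
  U *m diag_mx s *m pid_mx r *m V^T.

Lemma mul_rV_pid (R : realType) n (w : 'rV[R]_n) r (j : 'I_n) :
  (w *m pid_mx r) 0 j = if (j < r)%N then w 0 j else 0.
Proof.
rewrite mxE (bigD1 j) //= mxE eqxx /= big1 => [|i /negPf ij].
  by case: ifP => _; rewrite addr0 ?mulr1 ?mulr0.
by rewrite mxE val_eqE ij mulr0.
Qed.

Lemma mul_rV_copid (R : realType) n (w : 'rV[R]_n) r (j : 'I_n) :
  (w *m copid_mx r) 0 j = if (j < r)%N then 0 else w 0 j.
Proof.
rewrite mulmxBr mulmx1 mxE [X in _ + X]mxE mul_rV_pid.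
by case: ifP => _; rewrite ?subrr ?subr0.
Qed.

Lemma orth_tr (R : realType) n (U : 'M[R]_n) :
  U^T *m U = 1%:M -> U *m U^T = 1%:M.
Proof. by move/mulmx1C. Qed.

Lemma orth_unitmx (R : realType) n (U : 'M[R]_n) :
  U^T *m U = 1%:M -> U^T \in unitmx.
Proof. by case/mulmx1_unit. Qed.

Lemma diag_mx_pid_comm (R : realType) n (s : 'rV[R]_n) r :
  diag_mx s *m pid_mx r = pid_mx r *m diag_mx s.
Proof.
apply/matrixP => i j; rewrite mul_diag_mx mul_mx_diag !mxE.
by case: eqVneq => [/val_inj ->|_] /=; rewrite ?mulr0 ?mul0r // [LHS]mulrC.
Qed.

Lemma sqnorm_row_mx (R : realType) m n (u : 'rV[R]_m) (v : 'rV[R]_n) :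
  sqnorm (row_mx u v) = sqnorm u + sqnorm v.
Proof.
rewrite /sqnorm big_split_ord /=.
by congr (_ + _); apply: eq_bigr => i _; rewrite ?row_mxEl ?row_mxEr.
Qed.

Definition frob (R : realType) m n (M : 'M[R]_(m, n)) : R :=
  \sum_i \sum_j M i j ^+ 2.

Lemma frobE (R : realType) m n (M : 'M[R]_(m, n)) : frob M = \tr (M *m M^T).
Proof.
apply: eq_bigr => i _; rewrite mxE.
by apply: eq_bigr => j _; rewrite mxE expr2.
Qed.

Lemma frob_row (R : realType) m n (M : 'M[R]_(m, n)) :
  frob M = \sum_i sqnorm (row i M).
Proof.
by apply: eq_bigr => i _; apply: eq_bigr => j _; rewrite mxE.
Qed.

Lemma frob_ge0 (R : realType) m n (M : 'M[R]_(m, n)) : 0 <= frob M.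
Proof. by rewrite frob_row sumr_ge0 // => i _; exact: sqnorm_ge0. Qed.

Lemma frob_tr (R : realType) m n (M : 'M[R]_(m, n)) : frob M^T = frob M.
Proof. by rewrite !frobE trmxK mxtrace_mulC. Qed.

Lemma frob_mul_orth (R : realType) m n k (M : 'M[R]_(m, n)) (Q : 'M[R]_(n, k)) :
  Q *m Q^T = 1%:M -> frob (M *m Q) = frob M.
Proof.
by move=> QQ; rewrite !frobE trmx_mul mulmxA -(mulmxA M) QQ mulmx1.
Qed.

Lemma frob_proj (R : realType) m n (M : 'M[R]_(m, n)) (P : 'M[R]_n) :
  P^T = P -> P *m P = P -> frob M = frob (M *m P) + frob (M - M *m P).
Proof.
move=> PT PP; rewrite !frobE -raddfD /=; congr (\tr _).
rewrite linearB /= trmx_mul PT !mulmxBl !mulmxBr !mulmxA -(mulmxA M P P) PP.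
by rewrite subrr subr0 addrC subrK.
Qed.

Lemma frob_mul_opbound (R : realType) k m n (Q : 'M[R]_(k, m))
    (M : 'M[R]_(m, n)) (e : R) :
  0 <= e -> opbound M e -> frob (Q *m M) <= e ^+ 2 * frob Q.
Proof.
move=> e0 hM; rewrite !frob_row mulr_sumr; apply: ler_sum => i _.
by rewrite row_mul opbound_mul.
Qed.

Section SVD.
Context (R : realType) (n : nat) (A U : 'M[R]_n) (s : 'rV[R]_n) (V : 'M[R]_n).
Hypothesis svd : is_svd A U s V.

Let UU : U^T *m U = 1%:M. Proof. by case: svd. Qed.
Let VV : V^T *m V = 1%:M. Proof. by case: svd. Qed.
Let s_ge0 i : 0 <= s 0 i. Proof. by case: svd. Qed.
Let s_le (i j : 'I_n) : (i <= j)%N -> s 0 j <= s 0 i.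
Proof. by case: svd => _ _ _ h _; exact: h. Qed.
Let AE : A = U *m diag_mx s *m V^T. Proof. by case: svd. Qed.

Lemma svd_sqnorm_mul (v : 'rV[R]_n) :
  sqnorm (v *m A^T) = \sum_j (v *m V) 0 j ^+ 2 * s 0 j ^+ 2.
Proof.
have -> : v *m A^T = (v *m V *m diag_mx s) *m U^T.
  by rewrite AE !trmx_mul trmxK tr_diag_mx !mulmxA.
rewrite sqnorm_mul_orth ?trmxK //; apply: eq_bigr => j _.
by rewrite mul_mx_diag mxE exprMn.
Qed.

Let sqnormV (v : 'rV[R]_n) : sqnorm v = \sum_j (v *m V) 0 j ^+ 2.
Proof. by rewrite -(@sqnorm_mul_orth _ _ _ V v) // orth_tr. Qed.

(** Weyl's inequality by a dimension count: the span of the first [i.+1] right singular vectors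
    meets the kernel of [N^T]. There [A] acts as [A - N], yet stretches by at least [s 0 i]. *)
Lemma singular_value_le (N : 'M[R]_n) (e : R) (i : 'I_n) :
  0 <= e -> opbound (A - N) e -> (\rank N <= i)%N -> s 0 i <= e.
Proof.
move=> e0 AN ri.
have [|v [v0 /submxP[w vE] /sub_kermxP vN]] :=
    @rank_cap_nonzero _ n n n (pid_mx i.+1 *m V^T) (kermx N^T).
  rewrite mxrankMfree ?row_free_unit ?orth_unitmx // rank_pid_mx //.
  by rewrite mxrank_ker mxrank_tr; have := rank_leq_row N; have := ltn_ord i; lia.
have vV j : (v *m V) 0 j = if (j < i.+1)%N then w 0 j else 0.
  by rewrite vE -!mulmxA VV mulmx1 mul_rV_pid.
have vA : v *m A^T = v *m (A - N)^T by rewrite linearB /= mulmxBr vN subr0.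
have h : s 0 i ^+ 2 * sqnorm v <= e ^+ 2 * sqnorm v.
  apply: le_trans (opbound_mul v e0 (opbound_tr AN)).
  rewrite -vA svd_sqnorm_mul sqnormV mulr_sumr; apply: ler_sum => j _.
  rewrite mulrC vV; case: ifP => [ji|_]; last by rewrite expr0n /= !mul0r.
  by rewrite ler_wpM2l ?sqr_ge0 // ler_pXn2r ?nnegrE // s_le.
by move: h; rewrite ler_pM2r ?sqnorm_gt0 // ler_pXn2r // nnegrE.
Qed.

(** Dual count: the row space of [N], of dimension greater than [i], meets the span of the right
    singular vectors of index at least [i], where [A] stretches by at most [s 0 i]. The lower bound
    [c] is asked on the row space only, so that [N] may be singular. *)
Lemma singular_value_ge (N : 'M[R]_n) (e c : R) (i : 'I_n) :
  0 <= e -> opbound (A - N) e ->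
  (forall v : 'rV[R]_n, (v <= N)%MS -> c * l2norm v <= l2norm (v *m N^T)) ->
  (i < \rank N)%N -> c <= s 0 i + e.
Proof.
move=> e0 AN cN ri.
have [|v [v0 vN /submxP[w vE]]] :=
    @rank_cap_nonzero _ n n n N (copid_mx i *m V^T).
  rewrite mxrankMfree ?row_free_unit ?orth_unitmx // rank_copid_mx //; last first.
    by rewrite ltnW.
  by have := rank_leq_row N; have := ltn_ord i; lia.
have vV j : (v *m V) 0 j = if (j < i)%N then 0 else w 0 j.
  by rewrite vE -!mulmxA VV mulmx1 mul_rV_copid.
have vl : 0 < l2norm v by rewrite l2normE sqrtr_gt0 sqnorm_gt0.
rewrite -(ler_pM2r vl); apply: le_trans (cN v vN) _.
have -> : v *m N^T = v *m A^T + v *m (- (A - N)^T).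
  by rewrite -mulmxDr [(A - N)^T]linearB /= opprB addrC subrK.
apply: le_trans (l2normD _ _) _; rewrite mulrDl lerD //.
  rewrite -(@ler_pXn2r _ 2) ?nnegrE ?mulr_ge0 ?l2norm_ge0 //.
  rewrite exprMn !sqr_l2norm svd_sqnorm_mul sqnormV mulr_sumr.
  apply: ler_sum => j _.
  rewrite mulrC vV; case: ltnP => [_|ij]; first by rewrite expr0n /= !mulr0.
  by rewrite ler_wpM2r ?sqr_ge0 // ler_pXn2r ?nnegrE // s_le.
rewrite -(@ler_pXn2r _ 2) ?nnegrE ?mulr_ge0 ?l2norm_ge0 //.
rewrite exprMn !sqr_l2norm; apply: opbound_mul => //.
by apply: opboundN; apply: opbound_tr.
Qed.

(** [g] falls in the gap: the first [\rank N] singular values are at least [c - e], the others at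
    most [e]. *)
Lemma spectral_rankE (N : 'M[R]_n) (e c g : R) :
  0 <= e -> opbound (A - N) e ->
  (forall v : 'rV[R]_n, (v <= N)%MS -> c * l2norm v <= l2norm (v *m N^T)) ->
  e < g -> g + e < c -> spectral_rank s g = \rank N.
Proof.
move=> e0 AN cN eg gc; rewrite /spectral_rank.
have -> : [set i | g <= s 0 i]%SET = [set i : 'I_n | (i < \rank N)%N]%SET.
  apply/setP => i; rewrite !inE; case: ltnP => ri.
    by have := singular_value_ge e0 AN cN ri; lra.
  by apply/negbTE; rewrite -ltNge; have := singular_value_le e0 AN ri; lra.
rewrite cardsE -sum1_card.
rewrite (eq_bigl (fun i : 'I_n => (i < \rank N)%N)) //.
by rewrite (big_ord_narrow (rank_leq_row N)) sum1_card card_ord.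
Qed.

Lemma svd_trunc_opbound (r : nat) (e : R) : 0 <= e ->
  (forall i : 'I_n, (r <= i)%N -> s 0 i <= e) ->
  opbound (A - svd_trunc U s V r) e.
Proof.
move=> e0 se u v.
have -> : u *m (A - svd_trunc U s V r) *m v^T =
    (u *m U *m diag_mx s *m copid_mx r) *m (v *m V)^T.
  by rewrite AE /svd_trunc trmx_mul !mulmxBr !mulmxBl !mulmxA mulmx1.
rewrite mxE; under eq_bigr => j _ do rewrite [X in _ * X]mxE.
apply: le_trans (sum_mul_le_sqrt _ _) _.
rewrite mulrA !l2normE (sqnormV v) ler_wpM2r ?sqrtr_ge0 //.
rewrite -(ger0_norm e0) -sqrtr_sqr -sqrtrM ?sqr_ge0 //.
rewrite ler_sqrt ?mulr_ge0 ?sqr_ge0 ?sqnorm_ge0 // //.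
  rewrite -(@sqnorm_mul_orth _ _ _ U u) ?orth_tr // /sqnorm mulr_sumr; apply: ler_sum => j _.
  rewrite mul_rV_copid mul_mx_diag mxE; case: ltnP => [_|rj].
    by rewrite expr0n mulr_ge0 ?sqr_ge0.
  by rewrite exprMn mulrC ler_wpM2r ?sqr_ge0 // ler_pXn2r ?nnegrE ?se.
Qed.

Lemma svd_trunc_proj (r : nat) : (r <= n)%N ->
  svd_trunc U s V r = (U *m pid_mx r *m U^T) *m svd_trunc U s V r.
Proof.
move=> rn; rewrite /svd_trunc -[U *m diag_mx s *m _]mulmxA diag_mx_pid_comm !mulmxA.
rewrite -(mulmxA (U *m pid_mx r) U^T U) UU mulmx1.
by rewrite -(mulmxA U (pid_mx r) (pid_mx r)) pid_mx_id.
Qed.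

(** A squared Frobenius norm is at most the rank times the squared operator norm. The error is split
    by the projection [W *m W^T], of rank [K]; in the complementary part [N] disappears, so that
    part lies in the range of the truncation, of rank at most [r]. *)
Lemma svd_trunc_frob (N : 'M[R]_n) K (W : 'M[R]_(n, K)) (r : nat) (e : R) :
  0 <= e -> (r <= n)%N -> W^T *m W = 1%:M -> N *m W *m W^T = N ->
  opbound (svd_trunc U s V r - N) e ->
  frob (svd_trunc U s V r - N) <= (K + r)%:R * e ^+ 2.
Proof.
move=> e0 rn WW NW Ee; set E := _ - N.
have PT : (W *m W^T)^T = W *m W^T by rewrite trmx_mul trmxK.
have PP : W *m W^T *m (W *m W^T) = W *m W^T.
  by rewrite !mulmxA -(mulmxA W W^T W) WW mulmx1.
rewrite (frob_proj E PT PP) natrD mulrDl lerD //.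
  rewrite mulmxA frob_mul_orth ?trmxK // -frob_tr trmx_mul mulrC.
  have -> : K%:R = frob W^T by rewrite frobE trmxK WW mxtrace1.
  by apply: frob_mul_opbound => //; exact: opbound_tr.
set P := U *m pid_mx r *m U^T.
have PrT : P^T = P by rewrite /P !trmx_mul trmxK tr_pid_mx mulmxA.
have PrP : P *m P = P.
  by rewrite /P !mulmxA -(mulmxA _ U^T) UU mulmx1 -(mulmxA U (pid_mx r) (pid_mx r)) pid_mx_id.
have -> : E - E *m (W *m W^T) = P *m E - P *m E *m (W *m W^T).
  rewrite /E !mulmxBr !mulmxBl -svd_trunc_proj // -(mulmxA P N) (mulmxA N) NW.
  by rewrite !opprB !addrA !subrK.
apply: (@le_trans _ _ (frob (P *m E))).
  by rewrite [leRHS](frob_proj _ PT PP) lerDr frob_ge0.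
have -> : r%:R = frob P.
  rewrite frobE PrT PrP /P mxtrace_mulC mulmxA UU mul1mx /mxtrace.
  transitivity (\sum_(i < r) (1 : R)); first by rewrite sumr_const card_ord.
  rewrite -(big_ord_narrow rn (F := fun=> 1)).
  rewrite big_mkcond; apply: eq_bigr => i _.
  by rewrite mxE eqxx /=; case: ifP.
by rewrite mulrC; exact: frob_mul_opbound.
Qed.

(** Multiplying rows by [V^T] or [U^T] is an isometry. The geometry seen by the algorithm is thus
    that of the rows and columns of the truncated matrix, which can be compared with a block
    matrix. *)
Lemma row_dist_embedding (r : nat) (rn : (r <= n)%N) x y :
  row_dist (embedding rn U s V) x y =
  row_dist (row_mx (svd_trunc U s V r) (svd_trunc U s V r)^T) x y.
Proof.
have h (X : 'M[R]_n) (Y : 'M[R]_n) : Y^T *m Y = 1%:M ->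
    \sum_i (row x (colsub (widen_ord rn) X) - row y (colsub (widen_ord rn) X)) 0 i ^+ 2 =
    sqnorm (row x (X *m pid_mx r *m Y^T) - row y (X *m pid_mx r *m Y^T)).
  move=> YY; rewrite !row_mul -!mulmxBl sqnorm_mul_orth ?trmxK //.
  rewrite /sqnorm; under [RHS]eq_bigr => j _.
    rewrite mul_rV_pid (fun_if (fun a : R => a ^+ 2)) expr0n /=.
  over.
  rewrite -big_mkcond /= (big_ord_narrow rn).
  by apply: eq_bigr => j _; rewrite !mxE.
rewrite /row_dist !l2normE; congr Num.sqrt.
rewrite /embedding !row_row_mx !opp_row_mx !add_row_mx !sqnorm_row_mx.
have -> : (svd_trunc U s V r)^T = V *m diag_mx s *m pid_mx r *m U^T.
  rewrite /svd_trunc !trmx_mul trmxK tr_diag_mx tr_pid_mx.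
  by rewrite -(mulmxA V) diag_mx_pid_comm !mulmxA.
by rewrite -(h _ V) // -(h _ U).
Qed.

End SVD.

(** * Block matrices *)

(** [Q] may be singular: [pinvmx Q] inverts it on its row space, which gives [t] with [t *m B = z]
    and a controlled norm, and [sqnorm z] is the inner product of [t] with [z *m B^T]. The [+ 1]
    keeps the constant positive, to be divided by later. *)
Lemma row_space_lower_bound (R : realType) K (Q : 'M[R]_K) (f g : 'rV[R]_K)
    (b : R) (z : 'rV[R]_K) : 0 < b ->
  (forall k, b <= f 0 k) -> (forall k, b <= g 0 k) ->
  (z <= diag_mx f *m Q *m diag_mx g)%MS ->
  b ^+ 2 * l2norm z <= (Num.sqrt (frob (pinvmx Q)) + 1) *
                        l2norm (z *m (diag_mx f *m Q *m diag_mx g)^T).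
Proof.
move=> b0 bf bg; set B := diag_mx f *m Q *m diag_mx g => zB.
pose inv (h : 'rV[R]_K) : 'rV[R]_K := \row_k (h 0 k)^-1.
have invK (h : 'rV[R]_K) : (forall k, b <= h 0 k) ->
    diag_mx h *m diag_mx (inv h) = 1%:M.
  move=> bh; rewrite mulmx_diag -diag_const_mx; congr diag_mx.
  apply/rowP => k; rewrite !mxE mulfV // gt_eqF //; exact: lt_le_trans (bh k).
have inv_norm m (h : 'rV[R]_K) (y : 'M[R]_(m, K)) : (forall k, b <= h 0 k) ->
    b ^+ 2 * frob (y *m diag_mx (inv h)) <= frob y.
  move=> bh; rewrite mul_mx_diag mulr_sumr; apply: ler_sum => i _.
  rewrite mulr_sumr; apply: ler_sum => k _; rewrite !mxE exprMn mulrCA.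
  have h0 : 0 < h 0 k by exact: lt_le_trans (bh k).
  have bh1 : b / h 0 k <= 1 by rewrite ler_pdivrMr // mul1r.
  by rewrite ler_piMr ?sqr_ge0 // -exprMn exprn_ile1 ?divr_ge0 ?(ltW b0) ?(ltW h0).
pose t := z *m diag_mx (inv g) *m pinvmx Q *m diag_mx (inv f).
have frob_rV (y : 'rV[R]_K) : frob y = sqnorm y by rewrite /frob big_ord1.
have tB : t *m B = z.
  have zg : (z *m diag_mx (inv g) <= Q)%MS.
    case/submxP: zB => w ->.
    by rewrite /B !mulmxA -(mulmxA _ (diag_mx g)) invK // mulmx1 submxMl.
  have := mulmxKpV zg; rewrite /t /B; move: (pinvmx Q) => P zP.
  rewrite !mulmxA -(mulmxA _ (diag_mx (inv f)) (diag_mx f)) diag_mxC invK //.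
  by rewrite mulmx1 zP -mulmxA diag_mxC invK // mulmx1.
have tz : b ^+ 4 * sqnorm t <= (Num.sqrt (frob (pinvmx Q)) + 1) ^+ 2 * sqnorm z.
  have -> : b ^+ 4 * sqnorm t = b ^+ 2 * (b ^+ 2 * frob t).
    by rewrite mulrA -exprD frob_rV.
  apply: (@le_trans _ _ (b ^+ 2 * frob (z *m diag_mx (inv g) *m pinvmx Q))).
    by rewrite ler_wpM2l ?sqr_ge0 // inv_norm.
  have hP : opbound (pinvmx Q) (Num.sqrt (frob (pinvmx Q)) + 1).
    apply: (@opbound_le _ _ _ _ (Num.sqrt (frob (pinvmx Q)))).
      by rewrite lerDl.
    by apply: opbound_frob; rewrite ?sqrtr_ge0 // sqr_sqrtr ?frob_ge0.
  have q0 : 0 <= Num.sqrt (frob (pinvmx Q)) + 1 by rewrite addr_ge0 ?sqrtr_ge0.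
  rewrite frob_rV.
  apply: le_trans (ler_wpM2l (sqr_ge0 _) (opbound_mul _ q0 hP)) _.
  rewrite mulrCA ler_wpM2l ?sqr_ge0 // -!frob_rV; exact: inv_norm.
set C := _ + 1 in tz *.
have C0 : 0 <= C by rewrite addr_ge0 ?sqrtr_ge0.
have bt : b ^+ 2 * l2norm t <= C * l2norm z.
  rewrite -(@ler_pXn2r _ 2) ?nnegrE ?mulr_ge0 ?(ltW b0) ?l2norm_ge0 //.
  by rewrite [leLHS]exprMn [leRHS]exprMn !sqr_l2norm -exprM.
have zt : sqnorm z <= l2norm t * l2norm (z *m B^T).
  rewrite sqnormE -{1}tB -mulmxA.
  have -> : B *m z^T = (z *m B^T)^T by rewrite trmx_mul trmxK.
  rewrite mxE; under eq_bigr => j _ do rewrite [X in _ * X]mxE.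
  exact: sum_mul_le_sqrt.
have [->|z0] := eqVneq (l2norm z) 0.
  by rewrite mulr0 mulr_ge0 ?l2norm_ge0.
have z_gt0 : 0 < l2norm z by rewrite lt_def z0 l2norm_ge0.
rewrite -(ler_pM2r z_gt0) -mulrA -expr2 sqr_l2norm.
apply: le_trans (ler_wpM2l (sqr_ge0 _) zt) _.
by rewrite mulrA [leRHS]mulrAC ler_wpM2r ?l2norm_ge0.
Qed.

Definition block_matrix (R : realType) (K n : nat) (sigma : 'I_n -> 'I_K)
    (nu : 'I_K -> 'I_K -> R) : 'M[R]_n :=
  \matrix_(x, y) nu (sigma x) (sigma y).

Section BlockMatrix.
Context (R : realType) (K n : nat) (sigma : 'I_n -> 'I_K).
Hypothesis sigma_surj : forall k, exists x, sigma x = k.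

Let c k : R := #|bmc_cluster sigma k|%:R.

Lemma cluster_gt0 k : 0 < c k.
Proof.
rewrite ltr0n; apply/card_gt0P; case: (sigma_surj k) => x xk.
by exists x; rewrite inE xk.
Qed.

Lemma sum_cluster (F : 'I_K -> R) : \sum_x F (sigma x) = \sum_k c k * F k.
Proof.
rewrite (partition_big sigma predT) //=; apply: eq_bigr => k _.
rewrite (eq_bigr (fun=> F k)) => [|x /eqP-> //].
rewrite sumr_const -mulr_natl; congr (_%:R * _).
by apply: eq_card => x; rewrite !inE.
Qed.

(** Normalised cluster indicators: an orthonormal family in which block matrices reduce to [K] by
    [K] ones. *)
Definition cluster_basis : 'M[R]_(n, K) :=
  \matrix_(x, k) ((sigma x == k)%:R / Num.sqrt (c k)).

Lemma cluster_basis_orth : cluster_basis^T *m cluster_basis = 1%:M.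
Proof.
apply/matrixP => i j; rewrite !mxE.
under eq_bigr => x _ do rewrite !mxE.
rewrite (sum_cluster (fun k => (k == i)%:R / Num.sqrt (c i) *
                               ((k == j)%:R / Num.sqrt (c j)))).
rewrite (bigD1 i) //= eqxx big1 => [|k /negPf->]; last by rewrite !mul0r mulr0.
rewrite addr0; case: eqVneq => [<-|_]; last by rewrite !mul0r !mulr0.
by rewrite !mul1r -invfM -expr2 sqr_sqrtr ?mulfV ?gt_eqF ?ltW ?cluster_gt0.
Qed.

Lemma block_matrixE (nu : 'I_K -> 'I_K -> R) :
  block_matrix sigma nu = cluster_basis *m
    (\matrix_(a, b) (Num.sqrt (c a) * nu a b * Num.sqrt (c b))) *m
    cluster_basis^T.
Proof.
have s0 k : Num.sqrt (c k) != 0 by rewrite sqrtr_eq0 -ltNge cluster_gt0.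
apply/matrixP => x y; rewrite !mxE (bigD1 (sigma y)) //= big1 ?addr0.
  rewrite !mxE (bigD1 (sigma x)) //= big1 ?addr0; last first.
    by move=> a /negPf; rewrite eq_sym => sa; rewrite !mxE sa !mul0r.
  by rewrite !mxE !eqxx !mul1r; field; rewrite !s0.
by move=> a /negPf; rewrite eq_sym => sa; rewrite !mxE sa !mul0r mulr0.
Qed.

Lemma block_matrix_proj (nu : 'I_K -> 'I_K -> R) :
  block_matrix sigma nu *m cluster_basis *m cluster_basis^T =
  block_matrix sigma nu.
Proof.
by rewrite block_matrixE -(mulmxA _ _ cluster_basis) cluster_basis_orth mulmx1.
Qed.

Lemma block_matrix_rank (nu : 'I_K -> 'I_K -> R) :
  (\rank (block_matrix sigma nu) <= K)%N.
Proof.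
rewrite block_matrixE (leq_trans (mxrankM_maxr _ _)) // mxrank_tr.
exact: rank_leq_col.
Qed.

(** In the basis [cluster_basis] the matrix becomes [diag_mx f *m Q *m diag_mx f], with entries of
    [f] at least [sqrt (l / n)] because a cluster has at most [n] states. The remaining constant
    depends on the fixed matrix [Q] alone. *)
Lemma block_matrix_lower_bound (Q : 'M[R]_K) (l : R) (v : 'rV[R]_n) : 0 < l ->
  let N := block_matrix sigma (fun a b => l * Q a b / (c a * c b)) in
  (v <= N)%MS ->
  l / n%:R / (Num.sqrt (frob (pinvmx Q)) + 1) * l2norm v <= l2norm (v *m N^T).
Proof.
move=> l0; rewrite block_matrixE; set W := cluster_basis; set B := \matrix_(a, b) _.
move=> N vN.
pose f : 'rV[R]_K := \row_k (Num.sqrt l / Num.sqrt (c k)).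
have BE : B = diag_mx f *m Q *m diag_mx f.
  have l1 : l = Num.sqrt l * Num.sqrt l by rewrite -expr2 sqr_sqrtr ?ltW.
  have c1 k : c k = Num.sqrt (c k) * Num.sqrt (c k).
    by rewrite -expr2 sqr_sqrtr // ltW ?cluster_gt0.
  have s0 k : Num.sqrt (c k) != 0 by rewrite sqrtr_eq0 -ltNge cluster_gt0.
  apply/matrixP => a b; rewrite mul_mx_diag mul_diag_mx !mxE {1}l1 (c1 a) (c1 b).
  rewrite -!(c1 a) -!(c1 b); set ca := Num.sqrt (c a); set cb := Num.sqrt (c b).
  by rewrite (c1 a) (c1 b) -/ca -/cb; field; rewrite !s0.
have [z zB vE] : exists2 z, (z <= B)%MS & v = z *m W^T.
  case/submxP: vN => y ->; exists (y *m W *m B); first exact: submxMl.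
  by rewrite /N !mulmxA.
have [n0|n0] := posnP n.
  by rewrite [in n%:R]n0 invr0 mulr0 !mul0r l2norm_ge0.
have nR : 0 < n%:R :> R by rewrite ltr0n.
have WW : W^T *m (W^T)^T = 1%:M by rewrite trmxK cluster_basis_orth.
have nv : l2norm v = l2norm z by rewrite !l2normE vE sqnorm_mul_orth.
have nvN : l2norm (v *m N^T) = l2norm (z *m B^T).
  rewrite /N !trmx_mul trmxK vE !mulmxA -(mulmxA z) cluster_basis_orth mulmx1.
  by rewrite !l2normE sqnorm_mul_orth.
have C0 : 0 < Num.sqrt (frob (pinvmx Q)) + 1.
  by rewrite ltr_wpDl ?sqrtr_ge0.
rewrite nv nvN mulrAC ler_pdivrMr // [leRHS]mulrC.
have b0 : 0 < Num.sqrt (l / n%:R) by rewrite sqrtr_gt0 divr_gt0.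
have fb k : Num.sqrt (l / n%:R) <= f 0 k.
  rewrite mxE sqrtrM ?(ltW l0) // ler_wpM2l ?sqrtr_ge0 // sqrtrV ?(ltW nR) // lef_pV2.
  - by rewrite ler_sqrt // ler_nat -[leqRHS]card_ord max_card.
  - by rewrite posrE sqrtr_gt0.
  - by rewrite posrE sqrtr_gt0 cluster_gt0.
move: zB; rewrite BE => zB.
have := row_space_lower_bound b0 fb fb zB.
by rewrite sqr_sqrtr // divr_ge0 ?ltW.
Qed.
End BlockMatrix.

(** [16 = 2 * 2 * 2 ^ 2]: the matrix and its transpose, [K + r <= 2 * K], and an operator error
    [e + e] coming from the truncation and from [A - N]. *)
Lemma embedding_close (R : realType) n K (A U : 'M[R]_n) (s : 'rV[R]_n)
    (V : 'M[R]_n) (sigma : 'I_n -> 'I_K) (Q : 'M[R]_K) (l e g : R) :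
  is_svd A U s V -> (forall k, exists x, sigma x = k) -> 0 < l -> 0 <= e ->
  let N := block_matrix sigma (fun a b => l * Q a b /
    (#|bmc_cluster sigma a|%:R * #|bmc_cluster sigma b|%:R)) in
  opbound (A - N) e -> e < g ->
  g + e < l / n%:R / (Num.sqrt (frob (pinvmx Q)) + 1) ->
  \sum_x sqnorm (row x (row_mx (svd_trunc U s V (spectral_rank s g))
                              (svd_trunc U s V (spectral_rank s g))^T) -
                 row x (row_mx N N^T)) <= 16 * K%:R * e ^+ 2.
Proof.
move=> svd surj l0 e0 N AN eg gc.
have Nl v := @block_matrix_lower_bound _ _ _ _ surj Q l v l0.
have rE := spectral_rankE svd e0 AN Nl eg gc.
set B := svd_trunc _ _ _ _.
have se (i : 'I_n) : (spectral_rank s g <= i)%N -> s 0 i <= e.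
  by rewrite rE; exact: (singular_value_le svd e0 AN).
have BN : opbound (B - N) (e + e).
  have -> : B - N = - (A - B) + (A - N) by rewrite opprB addrA subrK.
  by apply: opboundD => //; apply: opboundN; exact: (svd_trunc_opbound svd).
have ee : 0 <= e + e by rewrite addr_ge0.
have := svd_trunc_frob svd ee (spectral_rank_le s g) (cluster_basis_orth R surj)
  (block_matrix_proj surj _) BN.
rewrite -/N -/B => h.
have rK : (spectral_rank s g <= K)%N by rewrite rE block_matrix_rank.
have -> : \sum_x sqnorm (row x (row_mx B B^T) - row x (row_mx N N^T)) =
    frob (B - N) *+ 2.
  rewrite mulr2n -{2}frob_tr !frob_row -big_split /=; apply: eq_bigr => x _.
  rewrite !row_row_mx opp_row_mx add_row_mx sqnorm_row_mx.
  by rewrite !raddfB.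
rewrite mulr2n; apply: le_trans (lerD h h) _.
have : (K + spectral_rank s g)%:R <= 2 * K%:R :> R.
  by rewrite -natrM ler_nat; lia.
have := sqr_ge0 e; nra.
Qed.

(** * Density-based clustering *)

Lemma card_bigcup_le (I T : finType) (F : I -> {set T}) :
  (#|(\bigcup_i F i)%SET| <= \sum_i #|F i|)%N.
Proof.
elim/big_ind2: _ => [|A a B b Aa Bb|//]; first by rewrite finset.cards0.
by apply: leq_trans (leq_card_setU _ _) _; rewrite leq_add.
Qed.

Section DensityClustering.
Import mathcomp.boot.fintype mathcomp.boot.finset.

Context (R : realType) (n m K : nat) (X : 'M[R]_(n, m)) (sigma : 'I_n -> 'I_K).
Context (nu : 'I_K -> 'rV[R]_m) (h sep rho : R).

Definition center_error (x : 'I_n) : R := l2norm (row x X - nu (sigma x)).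

Let bad := [set x | h / 4 < center_error x]%SET.

Hypothesis K_gt0 : (0 < K)%N.
Hypothesis h_gt0 : 0 < h.
Hypothesis sep_centers : forall i j, i != j -> sep <= l2norm (nu i - nu j).
Hypothesis sep_h : 8 * h <= sep.
(** The set drawn after [K] clusters lies in [bad] and in [K] leftovers of at most [#|bad|] states,
    whence [K.+1]. The margin [3 * #|bad|] in the next hypothesis leaves [rho + 2 * #|bad|] good
    states per cluster, more than a second draw from an already used cluster can contain. *)
Hypothesis bad_rho : (K.+1 * #|bad|)%:R < rho.
Hypothesis cluster_rho :
  forall k, rho + (3 * #|bad|)%:R <= #|bmc_cluster sigma k|%:R.

Let good i := (bmc_cluster sigma i :\: bad)%SET.

Let in_good x i : (x \in good i) = (sigma x == i) && (x \notin bad).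
Proof. by rewrite !inE andbC. Qed.

Let card_good i : rho + (2 * #|bad|)%:R <= #|good i|%:R.
Proof.
have := cluster_rho i; rewrite -(cardsID bad (bmc_cluster sigma i)) natrD.
have : #|(bmc_cluster sigma i :&: bad)%SET|%:R <= #|bad|%:R :> R.
  by rewrite ler_nat subset_leq_card // subsetIr.
rewrite !natrM /good; lra.
Qed.

Let distC (k : nat) (u v : 'rV[R]_k) : l2norm (u - v) = l2norm (v - u).
Proof. by rewrite -l2normN opprB. Qed.

Let dist_triangle (k : nat) (u v w : 'rV[R]_k) :
  l2norm (u - w) <= l2norm (u - v) + l2norm (v - w).
Proof. by apply: le_trans (l2normD _ _); rewrite addrA subrK. Qed.

Let notbad x : x \notin bad -> center_error x <= h / 4.
Proof. by rewrite inE -leNgt. Qed.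

Let good_neighbours x i : x \in good i -> good i \subset neighbourhood X h x.
Proof.
rewrite in_good => /andP[/eqP xi /notbad ex]; apply/subsetP => y.
rewrite in_good => /andP[/eqP yi /notbad ey]; rewrite inE.
apply: le_trans (dist_triangle _ (nu i) _) _.
rewrite (distC (nu i)); move: ex ey; rewrite /center_error xi yi => ex ey.
by move: h_gt0 ex ey; set a := l2norm _; set b := l2norm _; lra.
Qed.

(** The two centers are within [2 * h + 2 * (h / 4)] of each other, which is below
    [8 * h <= sep]. *)
Let neighbours_good z x y : x \in neighbourhood X h z -> y \in neighbourhood X h z ->
  x \notin bad -> y \notin bad -> sigma x = sigma y.
Proof.
rewrite !inE /row_dist -!leNgt => zx zy ex ey.
apply/eqP; case: eqVneq => // /sep_centers.
have := dist_triangle (nu (sigma x)) (row x X) (nu (sigma y)).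
have := dist_triangle (row x X) (row y X) (nu (sigma y)).
have := dist_triangle (row x X) (row z X) (row y X).
rewrite (distC (nu (sigma x)) (row x X)) (distC (row x X) (row z X)).
rewrite -/(center_error x) -/(center_error y).
by move: h_gt0 sep_h zx zy ex ey; lra.
Qed.

Section Run.
Context (q : nat) (z : nat -> 'I_n) (C : nat -> {set 'I_n}).
Hypothesis run : density_run (neighbourhood X h) rho q z C.

Let C_sub k : (1 <= k <= q)%N -> C k \subset neighbourhood X h (z k).
Proof. by case: run => _ _ _ r /r [_ ->]; exact: subsetDl. Qed.

Let C_max k x : (1 <= k <= q)%N ->
  (#|neighbourhood X h x :\: assigned C k| <= #|C k|)%N.
Proof. by case: run => _ _ _ r /r [le ->]. Qed.

Let C_assigned k x : (1 <= k <= q)%N -> x \in C k -> x \notin assigned C k.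
Proof. by case: run => _ _ _ r /r [le ->]; rewrite inE => /andP[]. Qed.

Let assignedP k x : reflect (exists2 l, (1 <= l < k)%N & x \in C l)
  (x \in assigned C k).
Proof.
rewrite /assigned big_geq_mkord /=; apply: (iffP bigcupP).
  by case=> l l1 xl; exists (nat_of_ord l) => //; rewrite l1 ltn_ord.
case=> l /andP[l1 lk] xl; exists (Ordinal lk) => //.
Qed.

Let meets l i := [exists x, (x \in C l) && (x \in good i)].

Let meets_fun l i j : (1 <= l <= q)%N -> meets l i -> meets l j -> i = j.
Proof.
move=> lq /existsP[x /andP[xC]]; rewrite in_good => /andP[/eqP<- xb].
move=> /existsP[y /andP[yC]]; rewrite in_good => /andP[/eqP<- yb].
have /subsetP s := C_sub lq.
exact: neighbours_good (s _ xC) (s _ yC) xb yb.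
Qed.

Let C_meets l i x : (1 <= l <= q)%N -> meets l i -> x \in C l ->
  x \notin bad -> x \in good i.
Proof.
move=> lq mi xC xb; have : meets l (sigma x).
  by apply/existsP; exists x; rewrite xC in_good eqxx.
by move/(meets_fun lq mi) => ->; rewrite in_good eqxx.
Qed.

(** Greediness: a good state [x] of cluster [i] found in [C l] was itself a candidate center, and
    its neighbourhood contains all of [good i]. So [C l] has at least as many states as what was
    left of [good i], while at most [#|bad|] of its states lie outside [good i]. *)
Let leftover l k i : (1 <= l <= q)%N -> meets l i -> (l < k)%N ->
  (#|good i :\: assigned C k| <= #|bad|)%N.
Proof.
move=> lq mi lk.
have /existsP[x /andP[xC xi]] := mi.
have h1 : (#|good i :\: assigned C l| <= #|C l|)%N.
  apply: leq_trans (C_max x lq); apply: subset_leq_card.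
  exact: setSD (good_neighbours xi).
have h2 : (#|C l| <= #|C l :&: good i| + #|bad|)%N.
  apply: leq_trans (leq_card_setU _ _); apply: subset_leq_card.
  apply/subsetP => y yC; rewrite in_setU in_setI yC /=.
  by case: (boolP (y \in bad)) => yb; rewrite ?orbT // (C_meets lq mi yC).
have h3 : (#|good i :\: assigned C l| =
    #|C l :&: good i| + #|(good i :\: assigned C l) :\: C l|)%N.
  rewrite -(cardsID (C l) (good i :\: assigned C l)); congr (_ + _)%N.
  apply: eq_card => y; rewrite !in_setI in_setD.
  case: (boolP (y \in C l)) => yC; last by rewrite andbF.
  by rewrite (C_assigned lq yC) andbT.
have h4 : (#|good i :\: assigned C k| <=
    #|(good i :\: assigned C l) :\: C l|)%N.
  apply: subset_leq_card; apply/subsetP => y; rewrite !in_setD => /andP[yk ->].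
  rewrite andbT; apply/andP; split.
    apply: contra yk => yl; apply/assignedP; exists l => //.
    by case/andP: lq => ->.
  apply: contra yk => /assignedP[j /andP[j1 jl] yj].
  by apply/assignedP; exists j => //; rewrite j1 (ltn_trans jl).
lia.
Qed.

Let seen k := [set i | [exists l : 'I_k.+1, (0 < l)%N && meets l i]]%SET.

Let seenP k i : reflect (exists2 l, (1 <= l <= k)%N & meets l i) (i \in seen k).
Proof.
rewrite inE; apply: (iffP existsP) => [[l /andP[l0 mi]]|[l /andP[l0 lk] mi]].
  by exists (nat_of_ord l) => //; rewrite l0 -ltnS ltn_ord.
by exists (Ordinal (lk : (l < k.+1)%N)); rewrite /= l0.
Qed.

Let unseen_card k b : (k < q)%N -> b \notin seen k ->
  rho + (2 * #|bad|)%:R <= #|C k.+1|%:R.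
Proof.
move=> kq bk; apply: le_trans (card_good b) _; rewrite ler_nat.
have [gb|[x xb]] := set_0Vmem (good b); first by rewrite gb cards0.
have kq' : (1 <= k.+1 <= q)%N by [].
apply: leq_trans (C_max x kq'); apply: subset_leq_card.
apply/subsetP => y yb; rewrite in_setD (subsetP (good_neighbours xb)) // andbT.
apply/negP => /assignedP[l /andP[l1 lk] yl].
move/negP: bk; apply; apply/seenP; exists l; first by rewrite l1.
by apply/existsP; exists y; rewrite yl.
Qed.

(** Each draw discovers exactly one cluster. As some cluster is unseen, the set drawn has more than
    [2 * #|bad|] states; it therefore contains a good state, and its cluster is new, since an old
    one has at most [#|bad|] good states left. *)
Let card_seen k : (k <= K)%N -> (k <= q)%N -> #|seen k| = k.
Proof.
elim: k => [|k IH] kK kq.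
  by apply: eq_card0 => i; apply/negP => /seenP[l]; lia.
have {}IH := IH (ltnW kK) (ltnW kq).
have [b bk] : exists b, b \notin seen k.
  apply/existsP; rewrite -negb_forall; apply/negP => /forallP all_seen.
  suff : #|seen k| = K by lia.
  by rewrite -[RHS](card_ord K); apply: eq_card => i; rewrite all_seen.
have big := unseen_card kq bk.
have kq' : (1 <= k.+1 <= q)%N by [].
have bigN : (2 * #|bad| < #|C k.+1|)%N.
  rewrite -(ltr_nat R); apply: lt_le_trans big; rewrite ltrDr.
  by apply: le_lt_trans bad_rho.
have [i mi] : exists i, meets k.+1 i.
  have : ~~ (C k.+1 \subset bad).
    apply/negP => /subset_leq_card; rewrite leqNgt => /negP; apply.
    by apply: leq_ltn_trans bigN; rewrite leq_pmull.
  case/subsetPn => x xC xb; exists (sigma x); apply/existsP; exists x.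
  by rewrite xC in_good eqxx.
have ik : i \notin seen k.
  apply/negP => /seenP[l /andP[l1 lk] ml].
  have lq : (1 <= l <= q)%N by rewrite l1 (leq_trans lk) // ltnW.
  have lk1 : (l < k.+1)%N by [].
  have h1 := leftover lq ml lk1.
  suff : (#|C k.+1| <= #|good i :\: assigned C k.+1| + #|bad|)%N by lia.
  apply: leq_trans (leq_card_setU _ _); apply: subset_leq_card.
  apply/subsetP => y yC; rewrite in_setU in_setD (C_assigned kq' yC) /=.
  by case: (boolP (y \in bad)) => yb; rewrite ?orbT // (C_meets kq' mi yC).
have -> : seen k.+1 = (i |: seen k)%SET.
  apply/setP => j; rewrite in_setU1; apply/seenP/orP.
    case=> l /andP[l1]; rewrite leq_eqVlt => /orP[/eqP-> mj|lk mj].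
      by left; rewrite (meets_fun kq' mj mi).
    by right; apply/seenP; exists l => //; rewrite l1.
  case=> [/eqP->|/seenP[l /andP[l1 lk] mj]]; first by exists k.+1; rewrite ?leqnn.
  by exists l => //; rewrite l1 leqW.
by rewrite cardsU1 ik IH.
Qed.

Lemma density_run_count : q = K.+1.
Proof.
have rho_gt0 : 0 < rho by apply: le_lt_trans bad_rho.
case: (run) => C0 Clt Cq _.
have Kq : (K < q)%N.
  rewrite ltnNge; apply/negP => qK.
  (* [q = 0] is excluded because [C 0] is the whole state space, which contains a cluster of at
     least [rho] states. *)
  case: q run Clt Cq qK card_seen unseen_card => [|k] _ _ Cq qK cs uc.
    move: Cq; rewrite C0 ltNge => /negP; apply.
    apply: le_trans (_ : #|bmc_cluster sigma (Ordinal K_gt0)|%:R <= _).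
      by have := cluster_rho (Ordinal K_gt0); have := ler0n R (3 * #|bad|); lra.
    by rewrite ler_nat subset_leq_card.
  have ck : #|seen k| = k by apply: cs => //; lia.
  have [b bk] : exists b, b \notin seen k.
    apply/existsP; rewrite -negb_forall; apply/negP => /forallP all_seen.
    suff : #|seen k| = K by lia.
    by rewrite -[RHS](card_ord K); apply: eq_card => i; rewrite all_seen.
  by have := uc k b (ltnSn _) bk; have := ler0n R (2 * #|bad|); lra.
apply/eqP; rewrite eqn_leq Kq andbT leqNgt; apply/negP => Kq1.
have all_seen i : i \in seen K.
  have : seen K = [set: 'I_K]%SET.
    by apply/eqP; rewrite eqEcard subsetT cardsT card_ord (card_seen (leqnn K) (ltnW Kq)) leqnn.
  by move->; rewrite inE.
have := Clt _ Kq1; rewrite leNgt => /negP; apply.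
apply: le_lt_trans bad_rho; rewrite ler_nat.
have Kq' : (1 <= K.+1 <= q)%N by [].
apply: (@leq_trans #|bad :|: \bigcup_i (good i :\: assigned C K.+1)|).
  apply: subset_leq_card; apply/subsetP => y yC; rewrite in_setU.
  case: (boolP (y \in bad)) => //= yb; apply/bigcupP; exists (sigma y) => //.
  by rewrite in_setD (C_assigned Kq' yC) in_good eqxx.
apply: leq_trans (leq_card_setU _ _) _; rewrite mulSn leq_add2l.
have Km : (K * #|bad|)%N = (\sum_(i : 'I_K) #|bad|)%N.
  by rewrite sum_nat_const card_ord.
rewrite Km; apply: leq_trans (card_bigcup_le _) _.
apply: leq_sum => i _; have /seenP[l /andP[l1 lK] ml] := all_seen i.
by apply: (leftover _ ml); rewrite ?l1 // (leq_trans lK) // ltnW.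
Qed.

(** The optimal permutation does at least as well as [g], which sends a cluster to the label of the
    set that meets its good states. *)
Lemma misclassified_card (c : 'I_n -> nat) (E : {set 'I_n}) :
  completion_choice X K z C c ->
  misclassified_states sigma (@completed n K C c) E ->
  (#|E| <= #|[set x : 'I_n | (sep / 4 <= center_error x)%R]%SET|)%N.
Proof.
move=> cc [g0 [g0_min ->]].
have qK := density_run_count.
have Kq : (K < q)%N by rewrite qK.
have all_meet i : exists l : 'I_K, meets l.+1 i.
  have : i \in seen K.
    have -> : seen K = [set: 'I_K].
      by apply/eqP; rewrite eqEcard subsetT cardsT card_ord (card_seen (leqnn K) (ltnW Kq)) leqnn.
    by rewrite inE.
  case/seenP => -[//|l] /andP[_ lK] ml.
  by exists (Ordinal lK).
have [g gP] := fin_all_exists all_meet.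
have gq i : (1 <= (g i).+1 <= q)%N by rewrite /= (leq_trans (ltn_ord _)) // ltnW.
have g_inj : injective g.
  by move=> i j gij; apply: (meets_fun (gq i) (gP i)); rewrite gij.
have gK (l : 'I_K) : exists i, g i = l.
  by have [h' _ h'K] := injF_bij g_inj; exists (h' l).
apply: leq_trans (g0_min (perm g_inj)) _; apply: subset_leq_card.
apply/subsetP => x xm; rewrite inE; case/bigcupP: xm => i _.
rewrite in_setD => /andP[].
rewrite inE => xi; rewrite permE inE.
(* Go through a good state of cluster [j] in the set: [h] to the center row, then [h / 4] to
   [nu j]. *)
have zc j : l2norm (row (z (g j).+1) X - nu j) <= 5 / 4 * h.
  have /existsP[y /andP[yC]] := gP j.
  rewrite in_good => /andP[/eqP yj /notbad ey].
  have := subsetP (C_sub (gq j)) _ yC; rewrite inE /row_dist => zy.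
  have := dist_triangle (row (z (g j).+1) X) (row y X) (nu j).
  by move: ey zy; rewrite /center_error yj; lra.
have sx := sep_centers xi.
have ex := dist_triangle (nu (sigma x)) (row x X) (nu i).
rewrite (distC (nu (sigma x)) (row x X)) -/(center_error x) in ex.
rewrite inE => /orP[xC|].
  have := subsetP (C_sub (gq i)) _ xC; rewrite inE /row_dist => zx.
  have := dist_triangle (row x X) (row (z (g i).+1) X) (nu i).
  rewrite (distC (row x X) (row (z (g i).+1) X)).
  by have := zc i; move: h_gt0 sep_h zx sx ex; lra.
(* The critical case: preferring a wrong center to the right one gives
   [sep <= 2 * center_error + 5 / 2 * h], and [8 * h <= sep] then leaves an error of at least
   [11 / 32 * sep]. *)
move=> /andP[xC /eqP cx].
have [_ cmin] := cc x xC.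
have xk : (1 <= (g (sigma x)).+1 <= K)%N by rewrite /= ltn_ord.
have := cmin _ xk; rewrite cx /row_dist => xz.
have := dist_triangle (row x X) (row (z (g i).+1) X) (nu i).
have := dist_triangle (row x X) (nu (sigma x)) (row (z (g (sigma x)).+1) X).
rewrite (distC (nu (sigma x)) (row (z _) X)) -/(center_error x).
by have := zc i; have := zc (sigma x); move: h_gt0 sep_h xz sx ex; lra.
Qed.

End Run.
End DensityClustering.

(** * The Feige-Ofek spectral bound *)

Lemma sum_pow2_le (R : realType) (J : nat) (a : R) : 0 <= a ->
  \sum_(i < J | 2 ^+ i <= a) 2 ^+ i <= 2 * a.
Proof.
move=> a0; elim: J => [|J IH]; first by rewrite big_ord0 mulr_ge0.
rewrite big_mkcond big_ord_recr -big_mkcond /=; case: ifP => [Ja|_].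
  have : \sum_(i < J | 2 ^+ i <= a) 2 ^+ i <= 2 ^+ J :> R.
    apply: (@le_trans _ _ (\sum_(i < J) 2 ^+ i)).
      rewrite [leRHS](bigID (fun i : 'I_J => 2 ^+ i <= a)) /= lerDl.
      by apply: sumr_ge0 => i _; exact: exprn_ge0.
    elim: {IH Ja} J => [|J IH]; first by rewrite big_ord0.
    by rewrite big_ord_recr /= exprS; lra.
  by lra.
by rewrite addr0.
Qed.

Lemma sum_geometric34_le (R : realType) (J : nat) :
  \sum_(j < J) (3 / 4) ^+ j <= 4 :> R.
Proof.
suff : \sum_(j < J) (3 / 4) ^+ j = 4 - 4 * (3 / 4) ^+ J :> R.
  have : 0 <= (3 / 4) ^+ J :> R by rewrite exprn_ge0 // divr_ge0.
  by lra.
elim: J => [|J IH]; first by rewrite big_ord0 expr0; lra.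
by rewrite big_ord_recr /= IH exprS; lra.
Qed.

(** The four summands are the ways in which [level_pair_le] pays for a pair of levels. Their sums
    are at most 1, 8, 4 and 4: truncated powers of 2 are dominated by their last term, and
    [(3 / 4) ^+ j] is summable. *)
Lemma sum_levels_le (R : realType) (J : nat) (r c : R) (a b : nat -> R)
    (P : nat -> nat -> bool) (T : nat -> nat -> R) :
  1 <= r -> 0 <= c -> (forall i, 0 <= a i) -> (forall j, 0 <= b j) ->
  \sum_(i < J) a i <= 1 -> \sum_(j < J) b j <= 1 ->
  (forall i j, P i j -> T i j <= c * (a i * b j
     + (if 2 ^+ i <= r then 2 ^+ i else 0) * (3 / 4) ^+ j / r
     + (if 2 ^+ i <= 2 * r * 2 ^+ j then 2 ^+ i else 0) * (b j / (2 ^+ j * r))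
     + a i * (3 / 4) ^+ j)) ->
  \sum_(i < J) \sum_(j < J | P i j) T i j <= 17 * c.
Proof.
move=> r1 c0 a0 b0 sa sb hT.
have r0 : 0 < r by apply: lt_le_trans r1.
pose U i j := a i * b j
     + (if 2 ^+ i <= r then 2 ^+ i else 0) * (3 / 4) ^+ j / r
     + (if 2 ^+ i <= 2 * r * 2 ^+ j then 2 ^+ i else 0) * (b j / (2 ^+ j * r))
     + a i * (3 / 4) ^+ j.
have p34 j : 0 <= (3 / 4) ^+ j :> R by rewrite exprn_ge0 // divr_ge0.
have if0 (x : R) (i : nat) : 0 <= (if 2 ^+ i <= x then 2 ^+ i else 0) :> R.
  by case: ifP => // _; exact: exprn_ge0.
have U0 i j : 0 <= U i j.
  have p2 : 0 <= 2 ^+ j * r by rewrite mulr_ge0 ?exprn_ge0 ?(ltW r0).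
  rewrite /U !addr_ge0 //.
  - exact: mulr_ge0.
  - by rewrite divr_ge0 ?(ltW r0) // mulr_ge0.
  - by rewrite mulr_ge0 // divr_ge0.
  - exact: mulr_ge0.
apply: (@le_trans _ _ (\sum_(i < J) \sum_(j < J) c * U i j)).
  apply: ler_sum => i _; rewrite [leRHS](bigID (fun j : 'I_J => P i j)) /=.
  rewrite -[leLHS]addr0 lerD //; first by apply: ler_sum => j; exact: hT.
  by apply: sumr_ge0 => j _; rewrite mulr_ge0.
under eq_bigr => i _ do rewrite -mulr_sumr.
rewrite -mulr_sumr mulrC ler_wpM2r //.
rewrite /U; under eq_bigr => i _ do rewrite !big_split /=.
rewrite !big_split /=.
have g4 := sum_geometric34_le R J.
have h1 : \sum_(i < J) \sum_(j < J) a i * b j <= 1.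
  under eq_bigr => i _ do rewrite -mulr_sumr.
  rewrite -mulr_suml mulr_ile1 ?sumr_ge0 //.
have h2 : \sum_(i < J) \sum_(j < J)
    (if 2 ^+ i <= r then 2 ^+ i else 0) * (3 / 4) ^+ j / r <= 8.
  under eq_bigr => i _ do rewrite -mulr_suml -mulr_sumr.
  rewrite -mulr_suml -mulr_suml -big_mkcond /= ler_pdivrMr //.
  have := sum_pow2_le J (ltW r0); set x := \sum_(i < J | _) _ => xr.
  have x0 : 0 <= x by apply: sumr_ge0 => i _; exact: exprn_ge0.
  have y0 : 0 <= \sum_(j < J) (3 / 4) ^+ j :> R by exact: sumr_ge0.
  apply: (@le_trans _ _ ((2 * r) * 4)); last by lra.
  exact: ler_pM.
have h3 : \sum_(i < J) \sum_(j < J)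
    (if 2 ^+ i <= 2 * r * 2 ^+ j then 2 ^+ i else 0) * (b j / (2 ^+ j * r)) <= 4.
  rewrite exchange_big /=.
  apply: (@le_trans _ _ (\sum_(j < J) 4 * b j)); last first.
    by rewrite -mulr_sumr; lra.
  apply: ler_sum => j _; rewrite -mulr_suml -big_mkcond /=.
  have p2 : 0 < 2 ^+ j :> R by exact: exprn_gt0.
  rewrite mulrA ler_pdivrMr ?mulr_gt0 // [leRHS]mulrAC ler_wpM2r //.
  apply: le_trans (sum_pow2_le J _) _; first by rewrite !mulr_ge0 // ltW.
  by rewrite [2 ^+ j * r]mulrC; lra.
have h4 : \sum_(i < J) \sum_(j < J) a i * (3 / 4) ^+ j <= 4.
  under eq_bigr => i _ do rewrite -mulr_sumr.
  rewrite -mulr_suml; apply: (@le_trans _ _ (1 * 4)); last by lra.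
  by apply: ler_pM => //; apply: sumr_ge0.
lra.
Qed.

(* The ratio used in the discrepancy bounds is (n / m) to the power 1/4. *)
Definition root4 (R : realType) (x : R) : R := Num.sqrt (Num.sqrt x).

Definition edges (R : realType) n (N : 'I_n -> 'I_n -> R) (S T : {set 'I_n}) : R :=
  \sum_(x in S) \sum_(y in T) N x y.

(** A form without logarithms of the usual alternative: [e <= c * mu], or
    [e * ln (e / mu) <= c * m * ln (n / m)]. A power 1/4 of [n / m] is small enough to leave
    convergent geometric series over the dyadic levels. *)
Definition discrepancy (R : realType) n (c D : R) (N : 'I_n -> 'I_n -> R) : Prop :=
  forall S T : {set 'I_n}, (0 < #|S|)%N -> (0 < #|T|)%N ->
  let m : R := (maxn #|S| #|T|)%:R in
  let mu := D * #|S|%:R * #|T|%:R / n%:R in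
  let w := root4 (n%:R / m) in
  edges N S T <= c * mu \/
  (edges N S T <= c * m * w /\ (edges N S T <= c * m \/ edges N S T <= c * mu * w)).

Lemma edges_tr (R : realType) n (N : 'I_n -> 'I_n -> R) (S T : {set 'I_n}) :
  edges (fun x y => N y x) T S = edges N S T.
Proof. by rewrite /edges exchange_big. Qed.

Lemma discrepancy_tr (R : realType) n (c D : R) (N : 'I_n -> 'I_n -> R) :
  discrepancy c D N -> discrepancy c D (fun x y => N y x).
Proof.
move=> h S T S0 T0; have := h T S T0 S0; rewrite -edges_tr maxnC.
by rewrite [D * _ * #|T|%:R]mulrAC.
Qed.

(** The rational [4 / 3] stands for the square root of 2, which is larger. *)
Lemma root4_ge (R : realType) (x : R) (j : nat) : 4 ^+ j <= x ->
  [/\ root4 x ^+ 4 = x, 2 ^+ j <= root4 x ^+ 2 & (4 / 3) ^+ j <= root4 x].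
Proof.
move=> jx; have x0 : 0 <= x by apply: le_trans jx; exact: exprn_ge0.
have w2 : root4 x ^+ 2 = Num.sqrt x by rewrite sqr_sqrtr // sqrtr_ge0.
have w4 : root4 x ^+ 4 = x by rewrite (exprM _ 2 2) w2 sqr_sqrtr.
have j2 : 2 ^+ j <= root4 x ^+ 2.
  rewrite w2 -(ger0_norm (exprn_ge0 j (ler0n R 2))) -sqrtr_sqr ler_sqrt //.
  by rewrite -exprM mulnC exprM; move: jx; congr (_ <= _); congr (_ ^+ _); lra.
split=> //.
rewrite -(@ler_pXn2r _ 2) ?nnegrE ?exprn_ge0 ?divr_ge0 ?sqrtr_ge0 //.
apply: le_trans j2; rewrite -exprM mulnC exprM; apply: lerXn2r.
- by rewrite nnegrE exprn_ge0 // divr_ge0.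
- by rewrite nnegrE.
- by rewrite expr2; lra.
Qed.

(* The bound on one pair of dyadic levels; [s] and [t] are the sizes of the
   levels, of heights 2^i and 2^j in units of 1/sqrt n, and [k] is the number of
   edges between them. *)
Lemma level_pair_le (R : realType) (n s t i j : nat) (r c k : R) :
  1 <= r -> 0 <= c -> (0 < n)%N -> (s <= t)%N -> t%:R * 4 ^+ j <= n%:R :> R ->
  r < 4 * (2 ^+ i * 2 ^+ j) -> 2 ^+ i <= 2 * r * 2 ^+ j ->
  ((t = 0)%N -> k = 0) ->
  ((0 < t)%N -> let w := root4 (n%:R / t%:R) in
    let mu := r ^+ 2 * s%:R * t%:R / n%:R in
    k <= c * mu \/ (k <= c * t%:R * w /\ (k <= c * t%:R \/ k <= c * mu * w))) ->
  2 ^+ i * 2 ^+ j * k / (n%:R * r) <= 4 * c *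
   ((s%:R * 4 ^+ i / n%:R) * (t%:R * 4 ^+ j / n%:R)
     + (if 2 ^+ i <= r then 2 ^+ i else 0) * (3 / 4) ^+ j / r
     + (if 2 ^+ i <= 2 * r * 2 ^+ j then 2 ^+ i else 0)
        * ((t%:R * 4 ^+ j / n%:R) / (2 ^+ j * r))
     + (s%:R * 4 ^+ i / n%:R) * (3 / 4) ^+ j).
Proof.
move=> r1 c0 n0 st tn heavy ij k0 kD; rewrite ij.
have r0 : 0 < r by apply: lt_le_trans r1.
have nR : 0 < n%:R :> R by rewrite ltr0n.
have pow4 l : 4 ^+ l = 2 ^+ l * 2 ^+ l :> R by rewrite -exprMn; congr (_ ^+ _); lra.
set x := 2 ^+ i in heavy ij *; set y := 2 ^+ j in heavy ij *.
have x0 : 0 < x by exact: exprn_gt0.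
have y0 : 0 < y by exact: exprn_gt0.
rewrite !pow4 -/x -/y in tn *; set g := (3 / 4) ^+ j.
have g0 : 0 <= g by rewrite exprn_ge0 // divr_ge0.
set sR : R := s%:R; set tR : R := t%:R in tn kD *; set nn : R := n%:R in tn nR kD *.
have s0 : 0 <= sR by exact: ler0n.
have t0 : 0 <= tR by exact: ler0n.
have if0 : 0 <= (if x <= r then x else 0) by case: ifP => // _; exact: ltW.
set A := sR * (x * x) / nn * _; set B := _ * g / r; set C := x * (_ / _); set E := _ * g.
have A0 : 0 <= A by rewrite !mulr_ge0 ?invr_ge0 // ltW.
have B0 : 0 <= B by rewrite !mulr_ge0 ?invr_ge0 // ltW.
have C0 : 0 <= C by rewrite !mulr_ge0 ?invr_ge0 ?mulr_ge0 // ltW.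
have E0 : 0 <= E by rewrite !mulr_ge0 ?invr_ge0 // ltW.
suff [|[|[|]]] : x * y * k / (nn * r) <= 4 * c * A \/
    x * y * k / (nn * r) <= 4 * c * B \/ x * y * k / (nn * r) <= 4 * c * C \/
    x * y * k / (nn * r) <= 4 * c * E.
- by move/le_trans; apply; rewrite ler_wpM2l ?mulr_ge0 //; lra.
- by move/le_trans; apply; rewrite ler_wpM2l ?mulr_ge0 //; lra.
- by move/le_trans; apply; rewrite ler_wpM2l ?mulr_ge0 //; lra.
- by move/le_trans; apply; rewrite ler_wpM2l ?mulr_ge0 //; lra.
have nr0 : 0 < nn * r by rewrite mulr_gt0.
have [tz|tpos] := posnP t; first by left; rewrite k0 // mulr0 mul0r mulr_ge0 // mulr_ge0.
have tR0 : 0 < tR by rewrite ltr0n.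
have mono b : k <= b -> x * y * k / (nn * r) <= x * y * b / (nn * r).
  by move=> kb; rewrite ler_pM2r ?invr_gt0 // ler_pM2l // mulr_gt0.
have [|w4 w2 w1] := @root4_ge _ (nn / tR) j.
  by rewrite pow4 ler_pdivlMr // mulrC.
set w := root4 _ in w4 w2 w1 kD.
have w0 : 0 < w by apply: lt_le_trans w1; rewrite exprn_gt0 // divr_gt0.
(* As [w ^+ 4 = n / t], the product [t * w] is [n / w ^+ 3], where [w ^+ 2 >= 2 ^+ j] and
   [w >= (4 / 3) ^+ j]. *)
have tw : tR * w <= nn / y * g.
  have -> : nn = tR * w ^+ 4 by rewrite w4; field; rewrite gt_eqF.
  have g1 : 1 <= g * w.
    have : g * (4 / 3) ^+ j = 1.
      by rewrite /g -exprMn (_ : 3 / 4 * (4 / 3) = 1) ?expr1n //; lra.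
    by move=> <-; rewrite ler_wpM2l.
  rewrite -mulrA -mulrA ler_pM2l // [y^-1 * g]mulrC mulrA ler_pdivlMr //.
  have -> : w ^+ 4 * g = w * (w ^+ 2 * (g * w)) by ring.
  rewrite ler_pM2l //; apply: le_trans w2 _.
  by rewrite ler_peMr // exprn_ge0 // ltW.
case: (kD tpos) => [kmu|[ktw kk]].
  left; apply: le_trans (mono _ kmu) _.
  rewrite ler_pdivrMr //.
  have -> : x * y * (c * (r ^+ 2 * sR * tR / nn)) =
            c * sR * tR * x * y / nn * r * r by ring.
  have -> : 4 * c * A * (nn * r) = c * sR * tR * x * y / nn * r * (4 * (x * y)).
    by rewrite /A; field; rewrite gt_eqF.
  rewrite ler_wpM2l ?(ltW heavy) //.
  by rewrite !mulr_ge0 ?invr_ge0 // ltW.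
(* For [x <= r] the bound [c * t * w] is enough, since such levels have a geometric sum. For [x > r]
   the finer alternative is used: [c * t] goes to the third summand and [c * mu * w] to the fourth,
   where [r < x] replaces one factor [r]. *)
have [xr|xr] := leP x r.
  right; left; apply: le_trans (mono _ ktw) _.
  rewrite /B xr ler_pdivrMr //.
  have -> : 4 * c * (x * g / r) * (nn * r) = 4 * c * x * y * (nn / y * g).
    by field; rewrite !gt_eqF.
  have -> : x * y * (c * tR * w) = c * x * y * (tR * w) by ring.
  apply: le_trans (ler_wpM2l _ tw) _; first by rewrite !mulr_ge0 // ltW.
  rewrite ler_wpM2r //; first by rewrite !mulr_ge0 ?invr_ge0 // ltW.
  by rewrite -!mulrA ler_peMl ?mulr_ge0 // ?ltW //; lra.
case: kk => [kt|kmw].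
  right; right; left; apply: le_trans (mono _ kt) _.
  rewrite ler_pdivrMr //.
  have -> : 4 * c * C * (nn * r) = 4 * (x * y * (c * tR)).
    by rewrite /C; field; rewrite !gt_eqF.
  by rewrite ler_peMl ?mulr_ge0 // ?ltW //; lra.
right; right; right; apply: le_trans (mono _ kmw) _.
rewrite ler_pdivrMr //.
have -> : x * y * (c * (r ^+ 2 * sR * tR / nn) * w) =
    c * x * y * r ^+ 2 * sR / nn * (tR * w) by ring.
apply: (@le_trans _ _ (c * x * y * r ^+ 2 * sR / nn * (nn / y * g))).
  by apply: ler_wpM2l tw; rewrite !mulr_ge0 ?invr_ge0 // ltW.
have -> : c * x * y * r ^+ 2 * sR / nn * (nn / y * g) = c * sR * x * g * r * r.
  by field; rewrite !gt_eqF.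
have -> : 4 * c * E * (nn * r) = c * sR * x * g * r * (4 * x).
  by rewrite /E; field; rewrite gt_eqF.
rewrite ler_wpM2l //; first by rewrite !mulr_ge0 // ltW.
by lra.
Qed.

(* Dyadic level of a coordinate [a] of a vector with [n] entries, in units of
   1/sqrt n; meaningful for [a >= 1/sqrt n]. *)
Definition level (R : realType) (n : nat) (a : R) : nat :=
  trunc_log 2 (Num.truncn (Num.sqrt n%:R * a)).

Definition level_set (R : realType) (n : nat) (u : 'I_n -> R) (i : nat) :
    {set 'I_n} :=
  [set x | (1 <= Num.sqrt n%:R * u x)%R && (level n (u x) == i)]%SET.

Lemma level_bounds (R : realType) (n : nat) (a : R) : 1 <= Num.sqrt n%:R * a ->
  2 ^+ level n a <= Num.sqrt n%:R * a < 2 * 2 ^+ level n a.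
Proof.
set b := _ * a => b1; have b0 : 0 <= b by apply: le_trans b1.
have /andP[tb bt] := truncn_itv b0.
have t0 : (0 < Num.truncn b)%N.
  by rewrite -(ltr_nat R) -(ltrD2r 1) -natr1 in bt *; lra.
have /andP[l1 l2] := @trunc_log_bounds 2 _ isT t0.
rewrite /level -/b; apply/andP; split.
  by apply: le_trans tb; rewrite -natrX ler_nat.
apply: lt_le_trans bt _; rewrite -exprS -natrX ler_nat.
exact: l2.
Qed.

Lemma level_le (R : realType) (n : nat) (a : R) : 0 <= a -> a <= 1 ->
  1 <= Num.sqrt n%:R * a -> (level n a < n.+1)%N.
Proof.
move=> a0 a1 b1; have /andP[h _] := level_bounds b1.
rewrite ltnS; apply: leq_trans (ltnW (ltn_expl _ (isT : (1 < 2)%N))) _.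
rewrite -(ler_nat R) natrX; apply: le_trans h _.
case: (posnP n) b1 => [->|n0 _]; first by rewrite sqrtr0 !mul0r.
apply: (@le_trans _ _ (Num.sqrt n%:R)); first by rewrite ler_piMr ?sqrtr_ge0.
rewrite -[leRHS]ger0_norm // -sqrtr_sqr ler_sqrt ?sqr_ge0 // expr2.
by rewrite ler_peMr // ler1n.
Qed.

Lemma sum_level_set (R : realType) (n : nat) (u : 'I_n -> R) (F : 'I_n -> R) :
  (forall x, 0 <= u x <= 1) ->
  \sum_(x | 1 <= Num.sqrt n%:R * u x) F x =
  \sum_(i < n.+1) \sum_(x in level_set u i) F x.
Proof.
move=> u01.
rewrite (partition_big (fun x => inord (level n (u x)) : 'I_n.+1) predT) //=.
apply: eq_bigr => i _; apply: eq_bigl => x; rewrite inE.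
case: (boolP (1 <= _)) => //= h.
have /andP[u0 u1] := u01 x.
by rewrite -val_eqE /= inordK // level_le.
Qed.

Lemma card_level_set_le (R : realType) (n : nat) (u : 'I_n -> R) (i : nat) :
  #|level_set u i|%:R * 4 ^+ i <= n%:R * \sum_(x in level_set u i) u x ^+ 2.
Proof.
rewrite mulr_natl -sumr_const mulr_sumr; apply: ler_sum => x; rewrite inE.
move=> /andP[h /eqP <-]; have /andP[h1 _] := level_bounds h.
have -> : n%:R * u x ^+ 2 = (Num.sqrt n%:R * u x) ^+ 2.
  by rewrite exprMn sqr_sqrtr.
apply: le_trans (lerXn2r 2 _ _ h1); rewrite ?nnegrE ?exprn_ge0 //.
  by rewrite -exprM mulnC exprM (_ : 2 ^+ 2 = 4) // expr2; lra.
by apply: le_trans h.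
Qed.

Lemma sum_weight_level_le (R : realType) (n : nat) (u : 'I_n -> R) :
  (0 < n)%N -> (forall x, 0 <= u x <= 1) -> \sum_x u x ^+ 2 <= 1 ->
  \sum_(i < n.+1) #|level_set u i|%:R * 4 ^+ i / n%:R <= 1 :> R.
Proof.
move=> n0 u01 su; rewrite -mulr_suml ler_pdivrMr ?ltr0n // mul1r.
apply: (@le_trans _ _ (\sum_(i < n.+1) n%:R * \sum_(x in level_set u i) u x ^+ 2)).
  by apply: ler_sum => i _; exact: card_level_set_le.
rewrite -mulr_sumr -(sum_level_set (fun x => u x ^+ 2) u01) ler_piMr //.
apply: le_trans su; rewrite [leRHS](bigID (fun x => 1 <= Num.sqrt n%:R * u x)) /=.
by rewrite lerDl sumr_ge0 // => x _; exact: sqr_ge0.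
Qed.

(** [544 = 4 * 2 * (17 * 4)]: rounding both coordinates to dyadic levels costs 4, the two possible
    orders of the level sizes cost 2, and [sum_levels_le] is applied with constant [4 * c]. *)
Lemma sum_heavy_balanced_le (R : realType) (n : nat) (r c : R)
    (N : 'I_n -> 'I_n -> R) (u v : 'I_n -> R) :
  (0 < n)%N -> 1 <= r -> 0 <= c -> (forall x y, 0 <= N x y) ->
  discrepancy c (r ^+ 2) N ->
  (forall x, 0 <= u x) -> (forall x, 0 <= v x) ->
  \sum_x u x ^+ 2 <= 1 -> \sum_x v x ^+ 2 <= 1 ->
  \sum_x \sum_(y | [&& r < n%:R * (u x * v y), u x <= r * v y & v y <= r * u x])
     u x * v y * N x y <= 544 * c * r.
Proof.
move=> n0 r1 c0 N0 disc u0 v0 su sv.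
have r0 : 0 < r by apply: lt_le_trans r1.
have nR : 0 < n%:R :> R by rewrite ltr0n.
have le1 (f : 'I_n -> R) : (forall x, 0 <= f x) -> \sum_x f x ^+ 2 <= 1 ->
    forall x, 0 <= f x <= 1.
  move=> f0 sf x; rewrite f0 /= -(@expr_le1 _ 2) //; apply: le_trans sf.
  by rewrite (bigD1 x) //= lerDl sumr_ge0 // => y _; exact: sqr_ge0.
have u01 := le1 _ u0 su; have v01 := le1 _ v0 sv.
pose reg x y := [&& r < n%:R * (u x * v y), u x <= r * v y & v y <= r * u x].
rewrite -[leLHS]/(\sum_x \sum_(y | reg x y) u x * v y * N x y).
pose S := level_set u; pose T := level_set v.
have sq0 : 0 <= Num.sqrt n%:R :> R by exact: sqrtr_ge0.
have sqn : Num.sqrt n%:R * Num.sqrt n%:R = n%:R :> R by rewrite -expr2 sqr_sqrtr.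
(* Heaviness and balance together force both coordinates above [1 / sqrt n], so that both have a
   level. *)
have reg1 x y : reg x y -> (1 <= Num.sqrt n%:R * u x) /\ (1 <= Num.sqrt n%:R * v y).
  case/and3P => h1 h2 h3; split.
    rewrite -(@ler_pXn2r _ 2) ?nnegrE ?mulr_ge0 // expr1n exprMn sqr_sqrtr //.
    rewrite -(ler_pM2l r0) mulr1; apply: le_trans (ltW h1) _.
    by rewrite [leRHS]mulrCA ler_pM2l // expr2 [leRHS]mulrCA ler_wpM2l.
  rewrite -(@ler_pXn2r _ 2) ?nnegrE ?mulr_ge0 // expr1n exprMn sqr_sqrtr //.
  rewrite -(ler_pM2l r0) mulr1; apply: le_trans (ltW h1) _.
  by rewrite [leRHS]mulrCA ler_pM2l // expr2 mulrA ler_wpM2r.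
pose F x y := if reg x y then u x * v y * N x y else 0.
have F0 x y : 0 <= F x y by rewrite /F; case: ifP => // _; rewrite !mulr_ge0.
have -> : \sum_x \sum_(y | reg x y) u x * v y * N x y =
    \sum_(i < n.+1) \sum_(j < n.+1) \sum_(x in S i) \sum_(y in T j) F x y.
  transitivity (\sum_(x | 1 <= Num.sqrt n%:R * u x)
                 \sum_(y | 1 <= Num.sqrt n%:R * v y) F x y).
    rewrite [RHS]big_mkcond; apply: eq_bigr => x _.
    case: ifP => [_|hx].
      rewrite big_mkcond [RHS]big_mkcond; apply: eq_bigr => y _; rewrite /F.
      by case: ifP => [/reg1[_ ->] //|_]; case: ifP.
    by rewrite big1 // => y /reg1[]; rewrite hx.
  rewrite (sum_level_set _ u01); apply: eq_bigr => i _.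
  rewrite exchange_big /= [LHS](sum_level_set _ v01).
  by apply: eq_bigr => j _; rewrite exchange_big.
pose cond (i j : nat) := [&& r < 4 * (2 ^+ i * 2 ^+ j),
  2 ^+ i <= 2 * r * 2 ^+ j & 2 ^+ j <= 2 * r * 2 ^+ i :> R].
pose e i j := edges N (S i) (T j).
have e0 i j : 0 <= e i j by apply: sumr_ge0 => x _; exact: sumr_ge0.
pose t i j := 2 ^+ i * 2 ^+ j * e i j / (n%:R * r).
have regc x y i j : x \in S i -> y \in T j -> reg x y ->
    cond i j /\ u x * v y <= 4 * (2 ^+ i * 2 ^+ j) / n%:R.
  rewrite !inE => /andP[xb /eqP <-] /andP[yb /eqP <-] /and3P[h1 h2 h3].
  have /andP[x1 x2] := level_bounds xb; have /andP[y1 y2] := level_bounds yb.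
  have nuv : n%:R * (u x * v y) = (Num.sqrt n%:R * u x) * (Num.sqrt n%:R * v y).
    by rewrite -[in LHS]sqn; ring.
  have xy : (Num.sqrt n%:R * u x) * (Num.sqrt n%:R * v y) <=
      4 * (2 ^+ level n (u x) * 2 ^+ level n (v y)).
    have -> : 4 * (2 ^+ level n (u x) * 2 ^+ level n (v y)) =
      (2 * 2 ^+ level n (u x)) * (2 * 2 ^+ level n (v y)) :> R by ring.
    by apply: ler_pM (ltW x2) (ltW y2); exact: mulr_ge0.
  split; last by rewrite ler_pdivlMr // mulrC nuv.
  apply/and3P; split.
  - by apply: lt_le_trans h1 _; rewrite nuv.
  - apply: le_trans x1 _; apply: le_trans (ler_wpM2l sq0 h2) _.
    rewrite mulrCA [2 * r]mulrC -mulrA ler_pM2l //; exact: ltW.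
  - apply: le_trans y1 _; apply: le_trans (ler_wpM2l sq0 h3) _.
    rewrite mulrCA [2 * r]mulrC -mulrA ler_pM2l //; exact: ltW.
have main : \sum_(i < n.+1) \sum_(j < n.+1) \sum_(x in S i) \sum_(y in T j) F x y
    <= 4 * r * \sum_(i < n.+1) \sum_(j < n.+1 | cond i j) t i j.
  rewrite mulr_sumr; apply: ler_sum => i _; rewrite mulr_sumr [leRHS]big_mkcond.
  apply: ler_sum => j _; case: ifP => [_|cij].
    rewrite /t; apply: (@le_trans _ _
        (\sum_(x in S i) \sum_(y in T j) 4 * (2 ^+ i * 2 ^+ j) / n%:R * N x y)).
      apply: ler_sum => x xS; apply: ler_sum => y yT; rewrite /F.
      case: ifP => [/(regc _ _ _ _ xS yT)[_ h]|_]; first by rewrite ler_wpM2r.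
      by rewrite !mulr_ge0 // ?invr_ge0 ?exprn_ge0 //; exact: ltW.
    under eq_bigr => x _ do rewrite -mulr_sumr.
    rewrite -mulr_sumr -/(edges N (S i) (T j)) -/(e i j) le_eqVlt; apply/orP; left.
    by apply/eqP; field; rewrite !gt_eqF.
  rewrite big1 // => x xS; rewrite big1 // => y yT; rewrite /F.
  by case: ifP => // /(regc _ _ _ _ xS yT)[]; rewrite cij.
apply: le_trans main _.
(* Only pairs whose first level set is the smaller one are treated; the others are the same
   statement for the transposed counts, as [cond] is symmetric. *)
have half (f g : 'I_n -> R) (M : 'I_n -> 'I_n -> R) :
    (forall x y, 0 <= M x y) -> discrepancy c (r ^+ 2) M ->
    (forall x, 0 <= f x <= 1) -> (forall x, 0 <= g x <= 1) ->
    \sum_x f x ^+ 2 <= 1 -> \sum_x g x ^+ 2 <= 1 ->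
    \sum_(i < n.+1) \sum_(j < n.+1 |
        cond i j && (#|level_set f i| <= #|level_set g j|)%N)
      2 ^+ i * 2 ^+ j * edges M (level_set f i) (level_set g j) / (n%:R * r) <=
      17 * (4 * c) :> R.
  move=> M0 dM f01 g01 sf sg.
  have sa := sum_weight_level_le n0 f01 sf; have sb := sum_weight_level_le n0 g01 sg.
  apply: (@sum_levels_le R n.+1 r (4 * c)
    (fun i => #|level_set f i|%:R * 4 ^+ i / n%:R)
    (fun j => #|level_set g j|%:R * 4 ^+ j / n%:R)
    (fun i j => cond i j && (#|level_set f i| <= #|level_set g j|)%N)
    (fun i j => 2 ^+ i * 2 ^+ j * edges M (level_set f i) (level_set g j)
                / (n%:R * r))) => //.
  - exact: mulr_ge0.
  move=> i j /andP[/and3P[c1 c2 c3] st].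
  apply: level_pair_le => //.
  - apply: le_trans (card_level_set_le _ _) _; rewrite ler_piMr //.
    apply: le_trans sg; rewrite [leRHS](bigID (mem (level_set g j))) /=.
    by rewrite lerDl sumr_ge0 // => x _; exact: sqr_ge0.
  - move=> t0; rewrite /edges big1 // => x _; rewrite big1 // => y.
    by rewrite (cards0_eq t0) inE.
  move=> t0; case: (posnP #|level_set f i|) => [s0|s0].
    have -> : edges M (level_set f i) (level_set g j) = 0.
      by rewrite /edges big1 // => x; rewrite (cards0_eq s0) inE.
    by left; rewrite !mulr_ge0 ?invr_ge0 ?exprn_ge0 //; exact: ltW.
  by have := dM _ _ s0 t0; rewrite /= (maxn_idPr st).
have h1 := half u v N N0 disc u01 v01 su sv.
have h2 := half v u _ (fun x y => N0 y x) (discrepancy_tr disc) v01 u01 sv su.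
have split_t : \sum_(i < n.+1) \sum_(j < n.+1 | cond i j) t i j <=
    17 * (4 * c) + 17 * (4 * c).
  apply: le_trans (lerD h1 h2).
  under [X in _ <= _ + X]eq_bigr => i _ do rewrite big_mkcond /=.
  rewrite [X in _ <= _ + X]exchange_big /= -big_split /=; apply: ler_sum => i _.
  rewrite (bigID (fun j : 'I_n.+1 => (#|S i| <= #|T j|)%N)) /=.
  rewrite lerD // big_mkcond; apply: ler_sum => j _ /=.
  case: ifP => [/andP[/and3P[c1 c2 c3] st]|_].
    rewrite /cond [2 ^+ j * 2 ^+ i]mulrC c1 c2 c3 /= ltnW ?ltnNge //.
    by rewrite edges_tr.
  case: ifP => // _; rewrite edges_tr divr_ge0 //; last exact: mulr_ge0 (ltW _).
  by apply: mulr_ge0; [rewrite mulr_ge0 ?exprn_ge0 | exact: e0].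
apply: le_trans (ler_wpM2l _ split_t) _; first by rewrite mulr_ge0 // ltW.
lra.
Qed.

(* Lattice points of mesh 1/(2 sqrt n): the coordinate [z x] encodes the
   integer [z x - n.+1]. *)
Definition lattice (R : realType) n (z : {ffun 'I_n -> 'I_(n.+1).*2.+1})
    (x : 'I_n) : R :=
  ((z x)%:R - n.+1%:R) / (2 * Num.sqrt n%:R).

Definition in_net (R : realType) n (z : {ffun 'I_n -> 'I_(n.+1).*2.+1}) : bool :=
  \sum_x lattice R z x ^+ 2 <= 1.

(* A linear form is maximised over the cell of [u] at a vertex of the cell. *)
Lemma net_rounding (R : realType) n (b u : 'I_n -> R) : (0 < n)%N ->
  \sum_x u x ^+ 2 <= 1 / 4 ->
  exists2 z, in_net R z & \sum_x u x * b x <= \sum_x lattice R z x * b x.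
Proof.
move=> n0 su; set q : R := 2 * Num.sqrt n%:R.
have nR : 0 < n%:R :> R by rewrite ltr0n.
have q0 : 0 < q by rewrite mulr_gt0 // sqrtr_gt0.
have q2 : q ^+ 2 = 4 * n%:R.
  by rewrite exprMn sqr_sqrtr //; ring.
have u_le x : `|q * u x| <= n%:R.
  rewrite -(@ler_pXn2r _ 2) ?nnegrE // -normrX ger0_norm ?sqr_ge0 //.
  rewrite exprMn q2.
  have : u x ^+ 2 <= 1 / 4.
    apply: le_trans su; rewrite (bigD1 x) //= lerDl sumr_ge0 // => y _.
    exact: sqr_ge0.
  have : 1 <= n%:R :> R by rewrite ler1n.
  by move: (n%:R : R) => a a1 h; rewrite expr2; nra.
have [z zP] : exists z : {ffun 'I_n -> 'I_(n.+1).*2.+1}, forall x,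
    `|lattice R z x - u x| <= q^-1 /\ u x * b x <= lattice R z x * b x.
  suff h x : exists k : 'I_(n.+1).*2.+1,
      `|(k%:R - n.+1%:R) / q - u x| <= q^-1 /\
      u x * b x <= (k%:R - n.+1%:R) / q * b x.
    have [f fP] := fin_all_exists h.
    by exists (finfun f) => x; rewrite /lattice ffunE; exact: fP.
  have := u_le x; rewrite ler_norml => /andP[ul ur].
  have t0 : 0 <= q * u x + n.+1%:R by rewrite -natr1; lra.
  have /andP[k1 k2] := truncn_itv t0; set k := Num.truncn _ in k1 k2.
  have kn : (k.+1 <= (n.+1).*2)%N.
    rewrite -(ler_nat R) -addnn natrD -natr1 -[n.+1%:R]natr1.
    by move: k1; rewrite -natr1; lra.
  have xq : u x = q * u x / q by field; rewrite gt_eqF.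
  have [b0|b0] := ltP (b x) 0.
    have k3 : (k < (n.+1).*2.+1)%N by apply: leq_trans kn _.
    exists (Ordinal k3) => /=; split.
      rewrite [u x]xq -mulrBl normrM [`|q^-1|]gtr0_norm ?invr_gt0 //.
      rewrite ler_piMl ?invr_ge0 ?(ltW q0) // ler_norml.
      by move: k2; rewrite -natr1; lra.
    rewrite [u x]xq ler_nM2r // ler_pM2r ?invr_gt0 //; lra.
  exists (Ordinal (kn : (k.+1 < (n.+1).*2.+1)%N)) => /=; split.
    rewrite [u x]xq -mulrBl normrM [`|q^-1|]gtr0_norm ?invr_gt0 //.
    rewrite ler_piMl ?invr_ge0 ?(ltW q0) // ler_norml.
    by move: k1 k2; rewrite -!natr1; lra.
  rewrite [u x]xq ler_wpM2r // ler_pM2r ?invr_gt0 //.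
  by move: k2; rewrite -!natr1; lra.
exists z; last by apply: ler_sum => x _; case: (zP x).
rewrite /in_net.
(* The squared radius [1 / 4] becomes [1 / 2] in [(u + e) ^+ 2 <= 2 * u ^+ 2 + 2 * e ^+ 2], and the
   [n] rounding errors add the other [1 / 2]. *)
apply: (@le_trans _ _ (\sum_x (2 * u x ^+ 2 + 2 / (4 * n%:R)))).
  apply: ler_sum => x _; have [h _] := zP x.
  have : (lattice R z x - u x) ^+ 2 <= (4 * n%:R)^-1.
    rewrite -q2 -exprVn -(ger0_norm (sqr_ge0 (_ - _))) normrX.
    by apply: lerXn2r; rewrite ?nnegrE ?invr_ge0 ?(ltW q0).
  have := sqr_ge0 (lattice R z x - u x - u x).
  by rewrite !expr2; lra.
rewrite big_split /= -mulr_sumr sumr_const card_ord -[X in _ + X]mulr_natr.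
have -> : 2 / (4 * n%:R) * n%:R = 1 / 2 :> R by field; rewrite gt_eqF.
lra.
Qed.

Lemma l2norm0 (R : realType) m : l2norm (0 : 'rV[R]_m) = 0.
Proof. by apply/eqP; rewrite l2normE sqrtr_eq0 le_eqVlt sqnorm_eq0 eqxx. Qed.

(** Rounding [u] with [v] fixed, and then [v], never decreases the form, so passing to the net loses
    nothing; the factor 4 comes from scaling both vectors to norm [1 / 2]. *)
Lemma opbound_of_net (R : realType) n (B : 'M[R]_n) (t : R) : (0 < n)%N ->
  (forall z z', in_net R z -> in_net R z' ->
     \sum_x \sum_y lattice R z x * lattice R z' y * B x y <= t) ->
  opbound B (4 * t).
Proof.
move=> n0 netB.
have small (u v : 'I_n -> R) : \sum_x u x ^+ 2 <= 1 / 4 ->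
    \sum_x v x ^+ 2 <= 1 / 4 -> \sum_x \sum_y u x * v y * B x y <= t.
  move=> su sv.
  have [z zn zle] := net_rounding (fun x => \sum_y v y * B x y) n0 su.
  have [z' zn' zle'] := net_rounding (fun y => \sum_x lattice R z x * B x y) n0 sv.
  apply: le_trans (netB z z' zn zn').
  have -> : \sum_x \sum_y u x * v y * B x y = \sum_x u x * (\sum_y v y * B x y).
    apply: eq_bigr => x _; rewrite mulr_sumr.
    by apply: eq_bigr => y _; rewrite mulrA.
  apply: le_trans zle _.
  have -> : \sum_x \sum_y lattice R z x * lattice R z' y * B x y =
      \sum_y lattice R z' y * (\sum_x lattice R z x * B x y).
    rewrite exchange_big; apply: eq_bigr => y _; rewrite mulr_sumr.
    by apply: eq_bigr => x _; ring.
  apply: le_trans _ zle'; apply: le_of_eq.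
  under [RHS]eq_bigr => y _ do rewrite mulr_sumr.
  rewrite exchange_big; apply: eq_bigr => x _; rewrite mulr_sumr.
  by apply: eq_bigr => y _; ring.
move=> u v.
have [u0|u0] := eqVneq (l2norm u) 0.
  have -> : u = 0 by apply/eqP; rewrite -sqnorm_eq0 -sqr_l2norm u0 expr0n.
  by rewrite !mul0mx mxE l2norm0 mul0r mulr0.
have [v0|v0] := eqVneq (l2norm v) 0.
  have -> : v = 0 by apply/eqP; rewrite -sqnorm_eq0 -sqr_l2norm v0 expr0n.
  by rewrite trmx0 mulmx0 mxE l2norm0 !mulr0.
have up : 0 < l2norm u by rewrite lt_def u0 l2norm_ge0.
have vp : 0 < l2norm v by rewrite lt_def v0 l2norm_ge0.
have scale m (w : 'rV[R]_m) : 0 < l2norm w ->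
    \sum_x (w 0 x / (2 * l2norm w)) ^+ 2 <= 1 / 4.
  move=> w0; under eq_bigr => x _ do rewrite exprMn.
  rewrite -mulr_suml -/(sqnorm w) -sqr_l2norm exprVn exprMn le_eqVlt.
  by apply/orP; left; apply/eqP; field; rewrite gt_eqF.
have := small _ _ (scale _ u up) (scale _ v vp).
have -> : \sum_x \sum_y u 0 x / (2 * l2norm u) * (v 0 y / (2 * l2norm v)) * B x y
    = (u *m B *m v^T) 0 0 / (4 * (l2norm u * l2norm v)).
  rewrite mxE mulr_suml exchange_big; apply: eq_bigr => y _.
  rewrite !mxE !mulr_suml; apply: eq_bigr => x _.
  by field; rewrite !gt_eqF.
rewrite ler_pdivrMr ?mulr_gt0 //.
by move/le_trans; apply; rewrite mulrCA mulrA.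
Qed.

Definition trimmed (R : realType) n (G : {set 'I_n}) (N : 'I_n -> 'I_n -> R)
    (x y : 'I_n) : R := if (x \notin G) && (y \notin G) then N x y else 0.

(** An unbalanced pair, say [|u x| > r * |v y|], has product at most [u x ^+ 2 / r], and the degree
    bound turns the sum of these into [c * r]. This and its mirror image raise 544 to 546. *)
Lemma sum_heavy_le (R : realType) (n : nat) (r c : R)
    (N : 'I_n -> 'I_n -> R) (u v : 'I_n -> R) :
  (0 < n)%N -> 1 <= r -> 0 <= c -> (forall x y, 0 <= N x y) ->
  discrepancy c (r ^+ 2) N ->
  (forall x, \sum_y N x y <= c * r ^+ 2) ->
  (forall y, \sum_x N x y <= c * r ^+ 2) ->
  \sum_x u x ^+ 2 <= 1 -> \sum_x v x ^+ 2 <= 1 ->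
  \sum_x \sum_(y | r < n%:R * `|u x * v y|) `|u x * v y| * N x y <= 546 * c * r.
Proof.
move=> n0 r1 c0 N0 disc rowN colN su sv.
have r0 : 0 < r by apply: lt_le_trans r1.
pose a x := `|u x|; pose b x := `|v x|.
have a0 x : 0 <= a x by exact: normr_ge0.
have b0 x : 0 <= b x by exact: normr_ge0.
have sa : \sum_x a x ^+ 2 <= 1.
  by under eq_bigr => x _ do rewrite /a -normrX ger0_norm ?sqr_ge0 //.
have sb : \sum_x b x ^+ 2 <= 1.
  by under eq_bigr => x _ do rewrite /b -normrX ger0_norm ?sqr_ge0 //.
have h := sum_heavy_balanced_le n0 r1 c0 N0 disc a0 b0 sa sb.
have hr : \sum_x \sum_y a x ^+ 2 / r * N x y <= c * r.
  under eq_bigr => x _ do rewrite -mulr_sumr.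
  apply: (@le_trans _ _ (\sum_x a x ^+ 2 * (c * r))).
    apply: ler_sum => x _; rewrite -mulrA ler_wpM2l ?sqr_ge0 //.
    by rewrite mulrC ler_pdivrMr // -mulrA -expr2.
  by rewrite -mulr_suml ler_piMl // mulr_ge0 // ltW.
have hc : \sum_x \sum_y b y ^+ 2 / r * N x y <= c * r.
  rewrite exchange_big /=; under eq_bigr => x _ do rewrite -mulr_sumr.
  apply: (@le_trans _ _ (\sum_x b x ^+ 2 * (c * r))).
    apply: ler_sum => x _; rewrite -mulrA ler_wpM2l ?sqr_ge0 //.
    by rewrite mulrC ler_pdivrMr // -mulrA -expr2.
  by rewrite -mulr_suml ler_piMl // mulr_ge0 // ltW.
have -> : 546 * c * r = 544 * c * r + c * r + c * r by ring.
apply: le_trans (lerD (lerD h hr) hc).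
rewrite -!big_split /=; apply: ler_sum => x _.
rewrite big_mkcond [X in _ <= X + _ + _]big_mkcond -!big_split /=.
apply: ler_sum => y _; rewrite normrM -/(a x) -/(b y).
have p1 : 0 <= a x ^+ 2 / r * N x y by rewrite !mulr_ge0 ?invr_ge0 // ltW.
have p2 : 0 <= b y ^+ 2 / r * N x y by rewrite !mulr_ge0 ?invr_ge0 // ltW.
case: (boolP (r < n%:R * (a x * b y))) => /= _; last first.
  by rewrite !addr_ge0 //; case: ifP => // _; rewrite !mulr_ge0.
case: ifP => [_|/negbT]; first by rewrite -addrA lerDl addr_ge0.
rewrite add0r negb_and -!ltNge => /orP[ab|ba].
  apply: (@le_trans _ _ (a x ^+ 2 / r * N x y)); last by rewrite lerDl.
  rewrite ler_wpM2r // expr2 -mulrA ler_wpM2l // ler_pdivlMr // mulrC.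
  exact: ltW.
apply: (@le_trans _ _ (b y ^+ 2 / r * N x y)); last by rewrite lerDr.
rewrite ler_wpM2r // expr2 mulrC -mulrA ler_wpM2l // ler_pdivlMr // mulrC.
exact: ltW.
Qed.

(** On a heavy pair the product is at most [n / r] times its own square, and the squares sum to at
    most 1. *)
Lemma sum_heavy_const_le (R : realType) (n : nat) (r c : R)
    (M : 'I_n -> 'I_n -> R) (u v : 'I_n -> R) :
  (0 < n)%N -> 0 < r -> 0 <= c -> (forall x y, M x y <= c * r ^+ 2 / n%:R) ->
  \sum_x u x ^+ 2 <= 1 -> \sum_x v x ^+ 2 <= 1 ->
  \sum_x \sum_(y | r < n%:R * `|u x * v y|) `|u x * v y| * M x y <= c * r.
Proof.
move=> n0 r0 c0 Mc su sv.
have nR : 0 < n%:R :> R by rewrite ltr0n.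
apply: (@le_trans _ _ (\sum_x \sum_y c * r * (u x ^+ 2 * v y ^+ 2))).
  apply: ler_sum => x _; rewrite big_mkcond; apply: ler_sum => y _.
  have crp : 0 <= c * r by rewrite mulr_ge0 // ltW.
  case: ifP => [h|_]; last first.
    by rewrite mulr_ge0 // mulr_ge0 ?sqr_ge0.
  apply: le_trans (ler_wpM2l (normr_ge0 _) (Mc x y)) _.
  have -> : u x ^+ 2 * v y ^+ 2 = `|u x * v y| * `|u x * v y|.
    by rewrite -expr2 -normrX ger0_norm ?sqr_ge0 // exprMn.
  set w := `|_|; rewrite -/w in h.
  have -> : w * (c * r ^+ 2 / n%:R) = c * r * w / n%:R * r by ring.
  have -> : c * r * (w * w) = c * r * w / n%:R * (n%:R * w).
    by field; rewrite gt_eqF.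
  have w0 : 0 <= w by exact: normr_ge0.
  by rewrite ler_wpM2l ?(ltW h) // divr_ge0 // mulr_ge0.
under eq_bigr => x _ do rewrite -mulr_sumr -mulr_sumr.
rewrite -mulr_sumr -mulr_suml ler_piMr //; first by rewrite mulr_ge0 // ltW.
by rewrite mulr_ile1 // sumr_ge0 // => x _; exact: sqr_ge0.
Qed.

Definition light_bound (R : realType) n (t r : R) (B : 'I_n -> 'I_n -> R) : Prop :=
  forall z z', in_net R z -> in_net R z' ->
  \sum_x \sum_(y | n%:R * `|lattice R z x * lattice R z' y| <= r)
     lattice R z x * lattice R z' y * B x y <= t * r.

Lemma opbound_trimmed (R : realType) (n : nat) (G : {set 'I_n}) (r c t : R)
    (N M : 'I_n -> 'I_n -> R) :
  (0 < n)%N -> 1 <= r -> 0 <= c -> (forall x y, 0 <= N x y) ->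
  (forall x y, 0 <= M x y <= c * r ^+ 2 / n%:R) ->
  discrepancy c (r ^+ 2) N ->
  (forall x, x \notin G -> \sum_y N x y <= c * r ^+ 2) ->
  (forall y, y \notin G -> \sum_x N x y <= c * r ^+ 2) ->
  light_bound t r (fun x y => N x y - M x y) ->
  opbound (\matrix_(x, y) trimmed G (fun x y => N x y - M x y) x y)
    (4 * ((t + 547 * c) * r)).
Proof.
move=> n0 r1 c0 N0 M0 disc rowN colN light.
have r0 : 0 < r by apply: lt_le_trans r1.
apply: opbound_of_net => // z z' zn zn'.
(* Zeroing the coordinates in [G] (the code of 0 is [n.+1]) keeps a point in the net. A light bound
   for the untrimmed counts thus serves every [G], although [G] depends on the path. *)
pose mask (w : {ffun 'I_n -> 'I_(n.+1).*2.+1}) : {ffun 'I_n -> 'I_(n.+1).*2.+1} :=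
  [ffun x => if x \in G then inord n.+1 else w x].
have maskE w x : lattice R (mask w) x = if x \in G then 0 else lattice R w x.
  rewrite /lattice ffunE; case: ifP => // _.
  by rewrite inordK ?subrr ?mul0r // ltnS -addnn leq_addr.
have mask_net w : in_net R w -> in_net R (mask w).
  rewrite /in_net => /(le_trans _); apply; apply: ler_sum => x _.
  by rewrite maskE; case: ifP => // _; rewrite expr0n sqr_ge0.
set u := lattice R (mask z); set v := lattice R (mask z').
have su : \sum_x u x ^+ 2 <= 1 by exact: mask_net.
have sv : \sum_x v x ^+ 2 <= 1 by exact: mask_net.
have NG0 x y : 0 <= trimmed G N x y by rewrite /trimmed; case: ifP.
have discG : discrepancy c (r ^+ 2) (trimmed G N).
  move=> S T S0 T0 /=.
  have le : edges (trimmed G N) S T <= edges N S T.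
    apply: ler_sum => x _; apply: ler_sum => y _.
    by rewrite /trimmed; case: ifP.
  case: (disc S T S0 T0) => [h|[h1 [h2|h2]]].
  - by left; exact: le_trans h.
  - by right; split; [exact: le_trans h1 | left; exact: le_trans h2].
  - by right; split; [exact: le_trans h1 | right; exact: le_trans h2].
have cr0 : 0 <= c * r ^+ 2 by rewrite mulr_ge0 ?sqr_ge0.
have rowG x : \sum_y trimmed G N x y <= c * r ^+ 2.
  rewrite /trimmed; case: (boolP (x \in G)) => xG /=; first by rewrite big1.
  apply: le_trans (rowN x xG); apply: ler_sum => y _.
  by case: ifP.
have colG y : \sum_x trimmed G N x y <= c * r ^+ 2.
  rewrite /trimmed; case: (boolP (y \in G)) => yG /=.
    by rewrite big1 // => x _; rewrite andbF.
  apply: le_trans (colN y yG); apply: ler_sum => x _.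
  by case: ifP.
have hN := sum_heavy_le n0 r1 c0 NG0 discG rowG colG su sv.
have hM := sum_heavy_const_le n0 r0 c0 (fun x y => proj2 (andP (M0 x y))) su sv.
have hL := light _ _ (mask_net _ zn) (mask_net _ zn').
rewrite -/u -/v in hL.
have -> : (t + 547 * c) * r = t * r + 546 * c * r + c * r by ring.
apply: le_trans (lerD (lerD hL hN) hM).
rewrite -!big_split /=; apply: ler_sum => x _.
rewrite [X in _ <= X + _ + _]big_mkcond [X in _ <= _ + X + _]big_mkcond.
rewrite [X in _ <= _ + X]big_mkcond.
rewrite -!big_split /=; apply: ler_sum => y _; rewrite mxE.
have -> : lattice R z x * lattice R z' y * trimmed G (fun x y => N x y - M x y) x y
    = u x * v y * (trimmed G N x y - M x y).
  rewrite /u /v !maskE /trimmed; case: (x \in G) => /=.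
    by rewrite !mul0r mulr0.
  by case: (y \in G) => /=; rewrite ?mulr0 ?mul0r.
case: (ltP r _) => _.
  rewrite add0r mulrBr; apply: lerD.
    by rewrite ler_wpM2r // ler_norm.
  rewrite -mulNr ler_wpM2r //; first by case/andP: (M0 x y).
  by rewrite -normrN ler_norm.
rewrite !addr0 /u /v !maskE /trimmed; case: (x \in G) => /=.
  by rewrite !mul0r.
by case: (y \in G) => /=; rewrite ?mulr0 ?mul0r.
Qed.

(** * Expectations over paths *)

(* Expectation of [F (X_1, ..., X_l)] for the chain of kernel [Q] started at
   [X_0 = z]. *)
Fixpoint path_exp (R : realType) (S : finType) (Q : S -> S -> R) (l : nat)
    (z : S) (F : seq S -> R) : R :=
  if l is l'.+1 then \sum_y Q z y * path_exp Q l' y (fun s => F (y :: s))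
  else F [::].

Section PathExpectation.
Context (R : realType) (S : finType) (Q : S -> S -> R).
Hypothesis Q_ge0 : forall z y, 0 <= Q z y.
Hypothesis Q_sum : forall z, \sum_y Q z y = 1.

Lemma path_exp_le l z (F G : seq S -> R) :
  (forall s, size s = l -> F s <= G s) -> path_exp Q l z F <= path_exp Q l z G.
Proof.
elim: l z F G => [|l IH] z F G FG /=; first exact: FG.
apply: ler_sum => y _; rewrite ler_wpM2l //; apply: IH => s sl.
by apply: FG; rewrite /= sl.
Qed.

Lemma eq_path_exp l z (F G : seq S -> R) :
  F =1 G -> path_exp Q l z F = path_exp Q l z G.
Proof.
elim: l z F G => [|l IH] z F G FG /=; first exact: FG.
apply: eq_bigr => y _; congr (_ * _); apply: IH => s; exact: FG.
Qed.

Lemma path_exp_const l z (a : R) : path_exp Q l z (fun=> a) = a.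
Proof.
elim: l z => [//|l IH] z /=.
by under eq_bigr => y _ do rewrite IH; rewrite -mulr_suml Q_sum mul1r.
Qed.

Lemma path_expZ l z (a : R) F :
  path_exp Q l z (fun s => a * F s) = a * path_exp Q l z F.
Proof.
elim: l z F => [//|l IH] z F /=; rewrite mulr_sumr; apply: eq_bigr => y _.
by rewrite IH mulrCA.
Qed.

Lemma path_exp_sum (I : finType) (P : pred I) l z (F : I -> seq S -> R) :
  path_exp Q l z (fun s => \sum_(i | P i) F i s) =
  \sum_(i | P i) path_exp Q l z (F i).
Proof.
elim: l z F => [//|l IH] z F /=; rewrite exchange_big; apply: eq_bigr => y _.
by rewrite IH mulr_sumr.
Qed.

Lemma path_expD l z (F G : seq S -> R) :
  path_exp Q l z (fun s => F s + G s) = path_exp Q l z F + path_exp Q l z G.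
Proof.
elim: l z F G => [//|l IH] z F G /=; rewrite -big_split; apply: eq_bigr => y _.
by rewrite IH mulrDr.
Qed.

Lemma path_exp_expR_sum l z (f : S -> R) (B : R) :
  (forall z, \sum_y Q z y * expR (f y) <= B) -> 0 <= B ->
  path_exp Q l z (fun s => expR (\sum_(x <- s) f x)) <= B ^+ l.
Proof.
move=> fB B0; elim: l z => [|l IH] z /=; first by rewrite big_nil expR0.
apply: (@le_trans _ _ (\sum_y Q z y * (expR (f y) * B ^+ l))).
  apply: ler_sum => y _; rewrite ler_wpM2l //.
  under eq_path_exp => s do rewrite big_cons expRD.
  by rewrite path_expZ ler_wpM2l ?expR_ge0.
by under eq_bigr => y _ do rewrite mulrA;
  rewrite -mulr_suml exprS ler_wpM2r ?exprn_ge0.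
Qed.

Fixpoint disjoint_pairs (s : seq S) : seq (S * S) :=
  if s is x :: s1 then if s1 is y :: s2 then (x, y) :: disjoint_pairs s2 else [::]
  else [::].

(** A pair consumes two steps, hence the joint induction on two consecutive lengths. The exponent
    [l] instead of [l / 2] is a loss permitted by [1 <= B], which also takes care of an unpaired
    last state. *)
Lemma path_exp_expR_pairs l z (g : S -> S -> R) (B : R) :
  (forall z, \sum_x \sum_y Q z x * Q x y * expR (g x y) <= B) -> 1 <= B ->
  path_exp Q l z (fun s => expR (\sum_(p <- disjoint_pairs s) g p.1 p.2)) <= B ^+ l.
Proof.
move=> gB B1; have B0 : 0 <= B by apply: le_trans B1.
suff [] : (forall z, path_exp Q l z
     (fun s => expR (\sum_(p <- disjoint_pairs s) g p.1 p.2)) <= B ^+ l) /\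
  (forall z, path_exp Q l.+1 z
     (fun s => expR (\sum_(p <- disjoint_pairs s) g p.1 p.2)) <= B ^+ l.+1) by [].
elim: l {z} => [|l [IH0 IH1]]; split=> // z.
- by rewrite /= big_nil expR0.
- rewrite /=; under eq_bigr => y _ do rewrite big_nil expR0 mulr1.
  by rewrite Q_sum expr1.
rewrite /=.
apply: (@le_trans _ _ (\sum_x \sum_y Q z x * Q x y * expR (g x y) * B ^+ l)).
  apply: ler_sum => x _; rewrite mulr_sumr; apply: ler_sum => y _.
  rewrite mulrA -!mulrA ler_wpM2l // ler_wpM2l //.
  under eq_path_exp => s do rewrite big_cons expRD.
  by rewrite path_expZ ler_wpM2l ?expR_ge0.
under eq_bigr => x _ do rewrite -mulr_suml.
rewrite -mulr_suml exprS; apply: le_trans (ler_wpM2r _ (gB z)) _.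
  exact: exprn_ge0.
by rewrite ler_wpM2l // exprS ler_peMl // exprn_ge0.
Qed.

Lemma path_exp_expR_pairs_behead l z (g : S -> S -> R) (B : R) :
  (forall z, \sum_x \sum_y Q z x * Q x y * expR (g x y) <= B) -> 1 <= B ->
  path_exp Q l z (fun s => expR (\sum_(p <- disjoint_pairs (behead s)) g p.1 p.2))
    <= B ^+ l.
Proof.
move=> gB B1; case: l => [|l] /=; first by rewrite big_nil expR0.
apply: (@le_trans _ _ (\sum_y Q z y * B ^+ l)).
  by apply: ler_sum => y _; rewrite ler_wpM2l // path_exp_expR_pairs.
by rewrite -mulr_suml Q_sum mul1r ler_weXn2l.
Qed.

Fixpoint transition_sum (phi : S -> S -> R) (z : S) (s : seq S) : R :=
  if s is y :: s' then phi z y + transition_sum phi y s' else 0.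

(* The increments [phi] are martingale differences. *)
Lemma path_exp_sqr_martingale l z (phi : S -> S -> R) (c : R) :
  (forall z, \sum_y Q z y * phi z y = 0) -> (forall z y, phi z y ^+ 2 <= c) ->
  path_exp Q l z (fun s => transition_sum phi z s ^+ 2) <= l%:R * c.
Proof.
move=> phi0 phic.
have mean0 k y : path_exp Q k y (transition_sum phi y) = 0.
  elim: k y => [//|k IH] y /=.
  under eq_bigr => x _ do rewrite path_expD path_exp_const IH addr0.
  exact: phi0.
elim: l z => [|l IH] z /=; first by rewrite expr0n mul0r.
apply: (@le_trans _ _ (\sum_y Q z y * (c + l%:R * c))).
  apply: ler_sum => y _; rewrite ler_wpM2l //.
  have -> : path_exp Q l y (fun s => (phi z y + transition_sum phi y s) ^+ 2) =
     phi z y ^+ 2 + path_exp Q l y (fun s => transition_sum phi y s ^+ 2).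
    transitivity (path_exp Q l y (fun s => phi z y ^+ 2 +
       ((phi z y *+ 2) * transition_sum phi y s + transition_sum phi y s ^+ 2))).
      by apply: eq_path_exp => s; ring.
    by rewrite path_expD path_exp_const path_expD path_expZ mean0 mulr0 add0r.
  by rewrite lerD.
by rewrite -mulr_suml Q_sum mul1r -natr1; lra.
Qed.

(* Law of [(X_0, ..., X_l)] under a stationary [mu], realised by starting the
   chain one step earlier. *)
Definition path_prob (mu : S -> R) (l : nat) (A : seq S -> Prop) : R :=
  \sum_z mu z * path_exp Q l.+1 z (fun s => `[< A s >]%:R).

(** Markov's inequality with test function [G], uniformly in the extra initial state. *)
Lemma path_prob_le_exp (mu : S -> R) l (A : seq S -> Prop) (G : seq S -> R) (b : R) :
  (forall z, 0 <= mu z) -> \sum_z mu z = 1 ->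
  (forall s, size s = l.+1 -> 0 <= G s) ->
  (forall s, size s = l.+1 -> A s -> 1 <= G s) ->
  (forall z, path_exp Q l.+1 z G <= b) -> path_prob mu l A <= b.
Proof.
move=> mu0 mu1 G0 AG Gb.
apply: (@le_trans _ _ (\sum_z mu z * b)); last by rewrite -mulr_suml mu1 mul1r.
apply: ler_sum => z _; rewrite ler_wpM2l //; apply: le_trans (Gb z).
apply: path_exp_le => s sl; case: (asboolP (A s)) => [/(AG s sl) //|_] /=.
exact: G0.
Qed.

Lemma path_prob_union (mu : S -> R) l (A B C : seq S -> Prop) :
  (forall z, 0 <= mu z) ->
  (forall s, size s = l.+1 -> A s -> B s \/ C s) ->
  path_prob mu l A <= path_prob mu l B + path_prob mu l C.
Proof.
move=> mu0 ABC; rewrite -big_split; apply: ler_sum => z _ /=.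
rewrite -mulrDr ler_wpM2l // -big_split; apply: ler_sum => y _ /=.
rewrite -mulrDr ler_wpM2l // -path_expD; apply: path_exp_le => s sl.
case: (asboolP (A _)) => [h|_]; last by rewrite addr_ge0.
have : size (y :: s) = l.+1 by rewrite /= sl.
move=> /ABC /(_ h) [h'|h'].
  by case: (asboolP (B _)) => // _; rewrite lerDl.
by case: (asboolP (C _)) => // _; rewrite lerDr.
Qed.
End PathExpectation.

(** * Law of the observed trajectory *)

Section TrajectoryLaw.
Context (R : realType) (d : measure_display) (T : measurableType d)
  (P : probability T R) (n : nat) (mu : 'I_n -> R) (Q : 'I_n -> 'I_n -> R)
  (X : nat -> T -> 'I_n).
Hypothesis X_mc : markov_chain P mu Q X.

Let X_meas t x : measurable [set w | X t w = x].
Proof. by case: X_mc => h _ _; exact: h. Qed.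

Lemma measurable_trajectory t l (A : seq 'I_n -> Prop) :
  measurable [set w | A (mkseq (fun i => X (t + i) w) l)].
Proof.
elim: l t A => [|l IH] t A.
  have [h|h] := pselect (A [::]).
    by rewrite (_ : [set _ | _] = setT) //; apply/seteqP; split.
  by rewrite (_ : [set _ | _] = set0) //; apply/seteqP; split.
rewrite (_ : [set _ | _] = \big[setU/set0]_(y < n) ([set w | X t w = y] `&`
    [set w | A (y :: mkseq (fun i => X (t.+1 + i) w) l)])).
  apply: bigsetU_measurable => y _; apply: measurableI => //.
  exact: (IH t.+1 (fun s => A (y :: s))).
have E w : mkseq (fun i => X (t + i) w) l.+1 =
    X t w :: mkseq (fun i => X (t.+1 + i) w) l.
  rewrite /mkseq /= addn0 (iotaDl 1 0) -map_comp; congr (_ :: _).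
  by apply: eq_map => i /=; rewrite add1n addnS addSn.
apply/seteqP; split => w /=.
  by rewrite E => Aw; rewrite -bigcup_seq; exists (X t w) => //=; rewrite mem_index_enum.
by rewrite -bigcup_seq => -[y _ [<-]]; rewrite E.
Qed.

Let cyl t (x : nat -> 'I_n) := [set w | forall s, (s <= t)%N -> X s w = x s].

Let cyl_meas t x : measurable (cyl t x).
Proof.
rewrite (_ : cyl t x = [set w | (fun s => s = mkseq x t.+1)
    (mkseq (fun i => X (0 + i) w) t.+1)]); first exact: (measurable_trajectory 0 t.+1 (fun s => s = mkseq x t.+1)).
apply/seteqP; split => w /=.
  move=> h; apply/eq_in_map => s; rewrite mem_iota => /andP[_ st].
  by apply: h; rewrite -ltnS.
move/eq_in_map => h s st; apply: h.
by rewrite mem_iota /= add0n ltnS.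
Qed.

(** The Markov property is given for complete pasts, so the induction extends the past: [x' y]
    records [y] as the state at time [t.+1]. *)
Lemma prob_cylinder_trajectory t l (x : nat -> 'I_n) (A : seq 'I_n -> Prop) :
  P (cyl t x `&` [set w | A (mkseq (fun i => X (t.+1 + i) w) l)]) =
  (P (cyl t x) * (path_exp Q l (x t) (fun s => `[< A s >]%:R))%:E)%E.
Proof.
elim: l t x A => [|l IH] t x A /=.
  case: (asboolP (A [::])) => h /=.
    rewrite (_ : [set _ | _] = setT) ?setIT ?mule1 //.
    by apply/seteqP; split.
  rewrite (_ : [set _ | _] = set0) ?setI0 ?measure0 ?mule0 //.
  by apply/seteqP; split.
pose x' y s := if s == t.+1 then y else x s : 'I_n.
have x't y : x' y t.+1 = y by rewrite /x' eqxx.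
have x'x y s : (s <= t)%N -> x' y s = x s by rewrite /x'; case: eqP => // ->; rewrite ltnn.
pose B y := cyl t.+1 (x' y) `&`
  [set w | A (y :: mkseq (fun i => X (t.+2 + i) w) l)].
have E w : mkseq (fun i => X (t.+1 + i) w) l.+1 =
    X t.+1 w :: mkseq (fun i => X (t.+2 + i) w) l.
  rewrite /mkseq /= addn0 (iotaDl 1 0) -map_comp; congr (_ :: _).
  by apply: eq_map => i /=; rewrite add1n addnS addSn.
have cylx y w : cyl t.+1 (x' y) w <-> cyl t x w /\ X t.+1 w = y.
  split => [h|[h <-] s].
    split => [s st|]; last by rewrite h ?x't.
    by rewrite h ?x'x // ltnW.
  by rewrite leq_eqVlt => /orP[/eqP->|]; rewrite ?x't // ltnS => st; rewrite x'x // h.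
rewrite (_ : _ `&` _ = \big[setU/set0]_(y < n) B y); last first.
  apply/seteqP; split => w.
    case=> cw; rewrite /= E => Aw; rewrite -bigcup_seq.
    exists (X t.+1 w); first by rewrite /= mem_index_enum.
    by split => //; apply/cylx.
  by rewrite -bigcup_seq => -[y _ [/cylx[cw Xw] Aw]]; split; rewrite //= E Xw.
rewrite measure_bigsetU_ord; first last.
- apply/trivIsetP => i j _ _ ij; apply/seteqP; split => // w.
  by case=> [[/cylx[_ h1] _] [/cylx[_ h2] _]]; move: ij; rewrite -h1 -h2 eqxx.
- move=> y; apply: measurableI; first exact: cyl_meas.
  exact: (measurable_trajectory t.+2 l (fun s => A (y :: s))).
have [_ _ mc] := X_mc.
have PB y : P (B y) = (P (cyl t x) * (Q (x t) y *
    path_exp Q l y (fun s => `[< A (y :: s) >]%:R))%:E)%E.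
  rewrite /B (IH t.+1 (x' y) (fun s => A (y :: s))) x't mc x't x'x // EFinM muleA; congr (_ * _ * _)%E.
  congr (P _); apply/seteqP; split => w h s st.
    by rewrite h // x'x.
  by rewrite h // x'x.
rewrite (eq_bigr _ (fun y _ => PB y)).
have Pf : P (cyl t x) = (fine (P (cyl t x)))%:E.
  by rewrite fineK // fin_num_measure.
rewrite Pf; under eq_bigr => y _ do rewrite -EFinM.
by rewrite sumEFin -EFinM mulr_sumr.
Qed.

Hypothesis mu_stationary : forall x, \sum_z mu z * Q z x = mu x.

(** Stationarity writes [mu y] as the sum of [mu z * Q z y]. The fictitious state [z] before [X 0]
    lets the first pair of states be conditioned on a predecessor like every other pair. *)
Lemma prob_trajectory l (A : seq 'I_n -> Prop) :
  P [set w | A (mkseq (X ^~ w) l.+1)] = (path_prob Q mu l A)%:E.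
Proof.
have E w : mkseq (X ^~ w) l.+1 = X 0%N w :: mkseq (fun i => X (1 + i)%N w) l.
  rewrite /mkseq /= (iotaDl 1 0) -map_comp; congr (_ :: _).
pose B y := cyl 0 (fun=> y) `&` [set w | A (y :: mkseq (fun i => X (1 + i)%N w) l)].
have cyl0 y w : cyl 0 (fun=> y) w <-> X 0%N w = y.
  by split => [->//|h s]; rewrite leqn0 => /eqP ->.
rewrite (_ : [set _ | _] = \big[setU/set0]_(y < n) B y); last first.
  apply/seteqP; split => w; rewrite /= E -bigcup_seq.
    by move=> Aw; exists (X 0%N w); rewrite /= ?mem_index_enum //; split => //; apply/cyl0.
  by case=> y _ [/cyl0 h Aw]; rewrite h.
rewrite measure_bigsetU_ord; first last.
- apply/trivIsetP => i j _ _ ij; apply/seteqP; split => // w.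
  by case=> [[/cyl0 h1 _] [/cyl0 h2 _]]; move: ij; rewrite -h1 -h2 eqxx.
- move=> y; apply: measurableI; first exact: cyl_meas.
  exact: (measurable_trajectory 1 l (fun s => A (y :: s))).
have [_ mu0 _] := X_mc.
have PB y : P (B y) = (mu y * path_exp Q l y (fun s => `[< A (y :: s) >]%:R))%:E.
  rewrite [LHS](prob_cylinder_trajectory 0 l (fun=> y) (fun s => A (y :: s))).
  rewrite EFinM -mu0; congr (P _ * _)%E.
  by apply/seteqP; split => w /cyl0.
rewrite (eq_bigr _ (fun y _ => PB y)).
rewrite sumEFin /path_prob /=; congr (_%:E).
under [RHS]eq_bigr => z _ do rewrite mulr_sumr.
rewrite [RHS]exchange_big /=; apply: eq_bigr => y _.
rewrite -mu_stationary mulr_suml; apply: eq_bigr => z _.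
by rewrite mulrA.
Qed.
End TrajectoryLaw.

(** * Block averages and concentration *)

(** Square the bound of [expR (x / 2)] by the inverse of [1 - x / 2]. At [x = 1] this also yields
    [expR 1 <= 4], used below. *)
Lemma expR_le_quadratic (R : realType) (x : R) : x <= 1 ->
  expR x <= 1 + x + 2 * x ^+ 2.
Proof.
move=> x1.
have y0 : 0 < 1 - x / 2 by lra.
have h1 : expR (x / 2) <= (1 - x / 2)^-1.
  rewrite -[expR _]invrK lef_pV2 ?posrE ?invr_gt0 ?expR_gt0 // -expRN.
  exact: expR_ge1Dx.
have -> : expR x = expR (x / 2) ^+ 2.
  by rewrite expr2 -expRD -splitr.
apply: (@le_trans _ _ ((1 - x / 2)^-1 ^+ 2)).
  by apply: lerXn2r => //; rewrite nnegrE ?expR_ge0 // invr_ge0 ltW.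
rewrite exprVn -[leLHS]mul1r ler_pdivrMr ?exprn_gt0 //.
have -> : (1 + x + 2 * x ^+ 2) * (1 - x / 2) ^+ 2 =
    1 + x ^+ 2 * ((1 - x) * (5 / 2 - x) / 2) by field.
by rewrite lerDl mulr_ge0 ?sqr_ge0 // divr_ge0 // mulr_ge0; lra.
Qed.

Section BlockAverage.
Context (R : realType) (K n : nat) (sigma : 'I_n -> 'I_K).
Hypothesis sigma_surj : forall k, exists x, sigma x = k.

Let c k : R := #|bmc_cluster sigma k|%:R.
Let c_gt0 k : 0 < c k. Proof. exact: cluster_gt0. Qed.

Definition block_sum (f : 'I_n -> 'I_n -> R) (a b : 'I_K) : R :=
  \sum_(x | sigma x == a) \sum_(y | sigma y == b) f x y.

(** The orthogonal projection onto functions constant on pairs of clusters; self-adjointness and the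
    contraction property below come from this. *)
Definition block_avg (f : 'I_n -> 'I_n -> R) (x y : 'I_n) : R :=
  block_sum f (sigma x) (sigma y) / (c (sigma x) * c (sigma y)).

Lemma sum_block_weight (W : 'I_K -> 'I_K -> R) f :
  \sum_x \sum_y W (sigma x) (sigma y) * f x y =
  \sum_a \sum_b W a b * block_sum f a b.
Proof.
rewrite (partition_big sigma predT) //=; apply: eq_bigr => a _.
rewrite exchange_big /= (partition_big sigma predT) //=; apply: eq_bigr => b _.
rewrite exchange_big /= mulr_sumr; apply: eq_bigr => x /eqP xa.
by rewrite mulr_sumr; apply: eq_bigr => y /eqP yb; rewrite xa yb.
Qed.

Let sum_const_cluster (a : 'I_K) (C : R) : \sum_(x | sigma x == a) C = c a * C.
Proof.
rewrite (eq_bigl (mem (bmc_cluster sigma a))) => [|x]; last by rewrite /= inE.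
by rewrite sumr_const mulr_natl.
Qed.

Lemma block_sum_avg f a b : block_sum (block_avg f) a b = block_sum f a b.
Proof.
rewrite {1}/block_sum.
transitivity (\sum_(x | sigma x == a) \sum_(y | sigma y == b)
   block_sum f a b / (c a * c b)).
  by apply: eq_bigr => x /eqP xa; apply: eq_bigr => y /eqP yb; rewrite /block_avg xa yb.
under eq_bigr do rewrite sum_const_cluster.
by rewrite sum_const_cluster mulrA mulrC divfK // mulf_neq0 // gt_eqF.
Qed.

Lemma sum_weight_avg (W : 'I_K -> 'I_K -> R) f :
  \sum_x \sum_y W (sigma x) (sigma y) * f x y =
  \sum_x \sum_y W (sigma x) (sigma y) * block_avg f x y.
Proof.
rewrite !sum_block_weight; apply: eq_bigr => a _; apply: eq_bigr => b _.
by rewrite block_sum_avg.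
Qed.

Lemma block_avg_adjoint f g :
  \sum_x \sum_y f x y * block_avg g x y = \sum_x \sum_y block_avg f x y * g x y.
Proof.
rewrite [RHS](sum_weight_avg (fun a b => block_sum f a b / (c a * c b)) g).
under eq_bigr => x _ do under eq_bigr => y _ do rewrite mulrC.
rewrite [LHS](sum_weight_avg (fun a b => block_sum g a b / (c a * c b)) f).
by apply: eq_bigr => x _; apply: eq_bigr => y _; rewrite mulrC.
Qed.

Lemma sum_sqr_centered_le f :
  \sum_x \sum_y (f x y - block_avg f x y) ^+ 2 <= \sum_x \sum_y f x y ^+ 2.
Proof.
have h : \sum_x \sum_y block_avg f x y * f x y =
    \sum_x \sum_y block_avg f x y * block_avg f x y.
  exact: (sum_weight_avg (fun a b => block_sum f a b / (c a * c b)) f).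
have -> : \sum_x \sum_y (f x y - block_avg f x y) ^+ 2 =
    \sum_x \sum_y f x y ^+ 2 - \sum_x \sum_y block_avg f x y * block_avg f x y.
  transitivity (\sum_x \sum_y f x y ^+ 2 - \sum_x \sum_y block_avg f x y * f x y
     - (\sum_x \sum_y block_avg f x y * f x y -
        \sum_x \sum_y block_avg f x y * block_avg f x y)).
    rewrite -!sumrB; apply: eq_bigr => x _; rewrite -!sumrB.
    by apply: eq_bigr => y _; ring.
  by rewrite h subrr subr0.
rewrite lerBlDr lerDl; apply: sumr_ge0 => x _; apply: sumr_ge0 => y _.
by rewrite -expr2 sqr_ge0.
Qed.

Lemma block_avg_norm_le f (b : R) : (forall x y, `|f x y| <= b) ->
  forall x y, `|block_avg f x y| <= b.
Proof.
move=> fb x y.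
have cc0 : 0 < c (sigma x) * c (sigma y) by rewrite mulr_gt0.
rewrite normrM normfV [X in _ / X](gtr0_norm cc0) ler_pdivrMr //.
apply: le_trans (ler_norm_sum _ _ _) _.
apply: (@le_trans _ _ (\sum_(x' | sigma x' == sigma x) \sum_(y' | sigma y' == sigma y) b)).
  apply: ler_sum => x' _; apply: le_trans (ler_norm_sum _ _ _) _.
  by apply: ler_sum => y' _.
under eq_bigr do rewrite sum_const_cluster.
by rewrite sum_const_cluster mulrA mulrC.
Qed.

Lemma block_avg_ge0 f : (forall x y, 0 <= f x y) -> forall x y, 0 <= block_avg f x y.
Proof.
move=> f0 x y.
have cc0 : 0 < c (sigma x) * c (sigma y) by rewrite mulr_gt0.
rewrite divr_ge0 ?(ltW cc0) //.
by apply: sumr_ge0 => x' _; apply: sumr_ge0 => y' _.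
Qed.
End BlockAverage.

(** * One-step exponential moments of the block kernel *)

Section BlockKernel.
Context (R : realType) (K n : nat) (p : 'M[R]_K) (pi : 'I_K -> R)
  (sigma : 'I_n -> 'I_K) (kappa : R).
Hypothesis sigma_surj : forall k, exists x, sigma x = k.
Hypothesis p_stoch : stochastic_mx p.
Hypothesis pi_stat : stationary_distribution p pi.
Hypothesis kappa_ge1 : 1 <= kappa.
Hypothesis cluster_kappa : forall k, n%:R <= kappa * #|bmc_cluster sigma k|%:R.

Let c k : R := #|bmc_cluster sigma k|%:R.
Let c_gt0 k : 0 < c k. Proof. exact: cluster_gt0. Qed.
Let Q := bmc_kernel p sigma.
Let p0 i j : 0 <= p i j. Proof. by case: p_stoch. Qed.
Let p1 i : \sum_j p i j = 1. Proof. by case: p_stoch. Qed.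

Lemma bmc_kernel_ge0 z y : 0 <= Q z y.
Proof. by rewrite divr_ge0 ?(ltW (c_gt0 _)). Qed.

Lemma sum_bmc_kernel_weight z (F : 'I_K -> R) :
  \sum_y Q z y * F (sigma y) = \sum_b p (sigma z) b * F b.
Proof.
rewrite (@sum_cluster R _ _ sigma (fun b => p (sigma z) b / c b * F b)).
apply: eq_bigr => b _; rewrite mulrA; congr (_ * _).
by rewrite -/(c b) mulrCA mulfV ?mulr1 // gt_eqF.
Qed.

Lemma bmc_kernel_sum z : \sum_y Q z y = 1.
Proof.
have := sum_bmc_kernel_weight z (fun=> 1).
under eq_bigr do rewrite mulr1.
by under [in RHS]eq_bigr do rewrite mulr1; rewrite p1.
Qed.

Lemma n_gt0 : (0 < n)%N.
Proof.
have [_ pi1 _] := pi_stat.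
case: (pickP (fun _ : 'I_K => true)) => [k _|none]; last first.
  by move/eqP: pi1; rewrite big_pred0 // eq_sym oner_eq0.
by have [x _] := sigma_surj k; apply: leq_ltn_trans (ltn_ord x).
Qed.

Lemma bmc_kernel_le z y : Q z y <= kappa / n%:R.
Proof.
have nR : 0 < n%:R :> R by rewrite ltr0n n_gt0.
have pz : p (sigma z) (sigma y) <= 1.
  by rewrite -(p1 (sigma z)) (bigD1 (sigma y)) //= lerDl sumr_ge0.
apply: (@le_trans _ _ (1 / c (sigma y))).
  by rewrite ler_wpM2r // invr_ge0 ltW.
by rewrite ler_pdivrMr // mulrAC ler_pdivlMr // mul1r cluster_kappa.
Qed.

Lemma bmc_stationary_ge0 z : 0 <= bmc_stationary pi sigma z.
Proof. by have [pi0 _ _] := pi_stat; rewrite divr_ge0 // ltW. Qed.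

Lemma bmc_stationary_sum : \sum_z bmc_stationary pi sigma z = 1.
Proof.
have [_ pi1 _] := pi_stat.
rewrite (@sum_cluster R _ _ sigma (fun b => pi b / c b)).
transitivity (\sum_k pi k) => //.
by apply: eq_bigr => b _; rewrite mulrCA mulfV ?mulr1 // gt_eqF // c_gt0.
Qed.

Lemma bmc_stationary_kernel x :
  \sum_z bmc_stationary pi sigma z * Q z x = bmc_stationary pi sigma x.
Proof.
have [_ _ pip] := pi_stat.
rewrite (@sum_cluster R _ _ sigma
  (fun b => pi b / c b * (p b (sigma x) / c (sigma x)))).
rewrite /bmc_stationary -pip mulr_suml; apply: eq_bigr => b _.
by rewrite mulrA [c b * _]mulrC divfK ?gt_eqF // mulrA.
Qed.

Let nR : 0 < n%:R :> R. Proof. by rewrite ltr0n n_gt0. Qed.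

(** The weight [Q z x * Q x y] is constant on pairs of clusters, hence orthogonal to [f] minus its
    block average: the first-order term vanishes for every [z]. The bound [1 / 2] keeps the centred
    function below 1, where the quadratic bound applies. *)
Lemma sum_kernel_expR_centered (f : 'I_n -> 'I_n -> R) z :
  (forall x y, `|f x y| <= 1 / 2) ->
  \sum_x \sum_y Q z x * Q x y * expR (f x y - block_avg sigma f x y) <=
  expR (2 * (kappa / n%:R) ^+ 2 * \sum_x \sum_y f x y ^+ 2).
Proof.
move=> f2; set g := fun x y => f x y - block_avg sigma f x y.
have g1 x y : g x y <= 1.
  have := f2 x y; have := block_avg_norm_le sigma_surj f2 x y.
  by rewrite /g !ler_norml; lra.
apply: le_trans (expR_ge1Dx _).
apply: (@le_trans _ _ (\sum_x \sum_y (Q z x * Q x y + (Q z x * Q x y * g x y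
   + 2 * (kappa / n%:R) ^+ 2 * g x y ^+ 2)))).
  apply: ler_sum => x _; apply: ler_sum => y _.
  have q0 : 0 <= Q z x * Q x y by rewrite mulr_ge0 ?bmc_kernel_ge0.
  have q1 : Q z x * Q x y <= (kappa / n%:R) ^+ 2.
    by rewrite expr2 ler_pM ?bmc_kernel_ge0 ?bmc_kernel_le.
  apply: le_trans (ler_wpM2l q0 (expR_le_quadratic (g1 x y))) _.
  have -> : Q z x * Q x y * (1 + g x y + 2 * g x y ^+ 2) = Q z x * Q x y +
      (Q z x * Q x y * g x y + 2 * (Q z x * Q x y) * g x y ^+ 2) by ring.
  by rewrite !lerD2l ler_wpM2r ?sqr_ge0 // ler_pM2l.
under eq_bigr => x _ do rewrite !big_split /=.
rewrite !big_split /=.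
have -> : \sum_x \sum_y Q z x * Q x y = 1.
  under eq_bigr => x _ do rewrite -mulr_sumr bmc_kernel_sum mulr1.
  exact: bmc_kernel_sum.
have -> : \sum_x \sum_y Q z x * Q x y * g x y = 0.
  pose W a b := p (sigma z) a / c a * (p a b / c b).
  rewrite -[LHS]/(\sum_x \sum_y W (sigma x) (sigma y) * g x y) /g.
  under eq_bigr => x _ do under eq_bigr => y _ do rewrite mulrBr.
  under eq_bigr => x _ do rewrite sumrB.
  by rewrite sumrB (sum_weight_avg sigma_surj W f) subrr.
rewrite add0r lerD2l; under eq_bigr => x _ do rewrite -mulr_sumr.
by rewrite -mulr_sumr ler_wpM2l ?sum_sqr_centered_le // mulr_ge0 // sqr_ge0.
Qed.

Lemma sum_kernel_expR_indicator (S T : {set 'I_n}) (t : R) z : 0 <= t ->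
  \sum_x \sum_y Q z x * Q x y * expR (t * ((x \in S) && (y \in T))%:R) <=
  expR (expR t * (kappa / n%:R) ^+ 2 * (#|S|%:R * #|T|%:R)).
Proof.
move=> t0; apply: le_trans (expR_ge1Dx _).
apply: (@le_trans _ _ (\sum_x \sum_y (Q z x * Q x y +
   expR t * (kappa / n%:R) ^+ 2 * ((x \in S)%:R * (y \in T)%:R)))).
  apply: ler_sum => x _; apply: ler_sum => y _.
  have q0 : 0 <= Q z x * Q x y by rewrite mulr_ge0 ?bmc_kernel_ge0.
  have q1 : Q z x * Q x y <= (kappa / n%:R) ^+ 2.
    by rewrite expr2 ler_pM ?bmc_kernel_ge0 ?bmc_kernel_le.
  rewrite -natrM mulnb; case: (_ && _) => /=; last first.
    by rewrite !mulr0 expR0 mulr1 addr0.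
  rewrite !mulr1 mulrC; apply: le_trans (ler_wpM2l (expR_ge0 _) q1) _.
  by rewrite lerDr.
under eq_bigr => x _ do rewrite big_split /=.
rewrite big_split /=.
have -> : \sum_x \sum_y Q z x * Q x y = 1.
  under eq_bigr => x _ do rewrite -mulr_sumr bmc_kernel_sum mulr1.
  exact: bmc_kernel_sum.
rewrite lerD2l; under eq_bigr => x _ do rewrite -mulr_sumr -mulr_sumr.
rewrite -mulr_sumr -mulr_suml.
have card (A : {set 'I_n}) : \sum_x (x \in A)%:R = #|A|%:R :> R.
  by rewrite -sum1_card natr_sum [RHS]big_mkcond; apply: eq_bigr => x _; case: ifP.
by rewrite !card.
Qed.

Lemma sum_kernel_expR_visit (y0 : 'I_n) z :
  \sum_y Q z y * expR (y == y0)%:R <= expR (3 * (kappa / n%:R)).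
Proof.
apply: le_trans (expR_ge1Dx _).
apply: (@le_trans _ _ (\sum_y (Q z y + (y == y0)%:R * (3 * (kappa / n%:R))))).
  apply: ler_sum => y _; case: eqP => _ /=; last by rewrite expR0 mulr1 mul0r addr0.
  have := @expR_le_quadratic R 1 (lexx _); rewrite expr1n => e4.
  rewrite mul1r; apply: (@le_trans _ _ (Q z y * 4)).
    by rewrite ler_wpM2l ?bmc_kernel_ge0 //; lra.
  by have := bmc_kernel_le z y; have := bmc_kernel_ge0 z y; lra.
rewrite big_split /= bmc_kernel_sum lerD2l -mulr_suml (bigD1 y0) //= eqxx.
by rewrite big1 ?addr0 ?mul1r // => y /negPf->.
Qed.
End BlockKernel.

(** * Size of the net *)

Definition lattice_dist (n k : nat) : nat := (k - n) + (n - k).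

Lemma sum_half_dist_le (R : realType) (m : nat) :
  \sum_(k < m.*2.+1) (1 / 2) ^+ lattice_dist m k <= 3 :> R.
Proof.
have geo j : \sum_(i < j) (1 / 2) ^+ i <= 2 :> R.
  suff -> : \sum_(i < j) (1 / 2) ^+ i = 2 - 2 * (1 / 2) ^+ j :> R.
    by rewrite lerBlDr lerDl mulr_ge0 // exprn_ge0 // divr_ge0.
  elim: j => [|j IH]; first by rewrite big_ord0 expr0; lra.
  by rewrite big_ord_recr /= IH exprS; lra.
rewrite -(big_mkord predT (fun k => (1 / 2) ^+ lattice_dist m k)).
rewrite (@big_cat_nat _ _ _ m.+1) //=; last by lia.
apply: (@le_trans _ _ (2 + 1)); last by lra.
apply: lerD.
  rewrite big_nat_rev big_mkord; apply: le_trans (geo m.+1).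
  apply: ler_sum => i _; rewrite /lattice_dist (_ : (_ + _)%N = i) //.
  by have := ltn_ord i; lia.
rewrite -{1}[m.+1]add0n big_addn big_mkord.
have -> : (m.*2.+1 - m.+1)%N = m by lia.
apply: (@le_trans _ _ (1 / 2 * \sum_(i < m) (1 / 2) ^+ i)).
  rewrite mulr_sumr; apply: ler_sum => i _; rewrite -exprS.
  by rewrite /lattice_dist (_ : (_ + _)%N = i.+1) //; lia.
by have := geo m; lra.
Qed.

(** [48 = 16 * 3]: for integer vectors the l1 norm is at most the squared l2 norm, here at most
    [4 * n], so each net point has product weight at least [2 ^- (4 * n)], while the total weight is
    at most [3 ^+ n]. *)
Lemma card_net_le (R : realType) (n : nat) : (0 < n)%N ->
  \sum_(z : {ffun 'I_n -> 'I_(n.+1).*2.+1} | in_net R z) 1 <= 48 ^+ n :> R.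
Proof.
move=> n0; have nR : 0 < n%:R :> R by rewrite ltr0n.
pose w k : R := (1 / 2) ^+ lattice_dist n.+1 k.
have w0 k : 0 <= w k by rewrite exprn_ge0 // divr_ge0.
apply: (@le_trans _ _ (\sum_(z : {ffun 'I_n -> 'I_(n.+1).*2.+1})
   16 ^+ n * \prod_x w (z x))); last first.
  rewrite -mulr_sumr -(bigA_distr_bigA (fun _ k => w (nat_of_ord k))) /=.
  rewrite prodr_const card_ord (_ : 48 = 16 * 3) ?exprMn; last by ring.
  rewrite ler_wpM2l ?exprn_ge0 //; apply: lerXn2r; rewrite ?nnegrE ?sumr_ge0 //.
  exact: sum_half_dist_le.
rewrite big_mkcond; apply: ler_sum => z _; case: ifP => [zn|_]; last first.
  by rewrite mulr_ge0 ?exprn_ge0 // prodr_ge0.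
have dist_sum : (\sum_x lattice_dist n.+1 (z x) <= 4 * n)%N.
  rewrite -(ler_nat R) natr_sum natrM.
  have : 4 * n%:R * (\sum_x lattice R z x ^+ 2) <= 4 * n%:R * 1 :> R.
    by rewrite ler_wpM2l // mulr_ge0 // ltW.
  rewrite mulr1; apply: le_trans; rewrite mulr_sumr; apply: ler_sum => x _.
  rewrite /lattice expr_div_n exprMn (sqr_sqrtr (ltW nR)).
  have -> : 4 * n%:R * (((z x)%:R - n.+1%:R) ^+ 2 / (2 ^+ 2 * n%:R)) =
      ((z x)%:R - n.+1%:R) ^+ 2 :> R by field; rewrite gt_eqF.
  apply: (@le_trans _ _ ((lattice_dist n.+1 (z x))%:R ^+ 2)).
    by rewrite -natrX ler_nat; case: (lattice_dist _ _) => // j; rewrite expnS expn1 leq_pmulr.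
  rewrite /lattice_dist; case: (leqP (z x) n.+1) => h.
    rewrite (_ : (_ - _)%N = 0%N) ?add0n; last by apply/eqP.
    by rewrite natrB // -sqrrN opprB.
  rewrite (_ : (n.+1 - _)%N = 0%N) ?addn0; last by apply/eqP; exact: ltnW.
  by rewrite natrB // ltnW.
rewrite /w prodrXr.
have -> : 16 ^+ n = 2 ^+ (4 * n) :> R.
  by rewrite exprM; congr (_ ^+ n); rewrite -natrX.
apply: (@le_trans _ _ (2 ^+ (4 * n) * (1 / 2) ^+ (4 * n))).
  by rewrite -exprMn (_ : 2 * (1 / 2) = 1) ?expr1n //; lra.
rewrite ler_wpM2l ?exprn_ge0 //; apply: ler_wiXn2l dist_sum; lra.
Qed.

Definition pair_count (R : realType) n (ps : seq ('I_n * 'I_n)) (x y : 'I_n) : R :=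
  \sum_(q <- ps) (q == (x, y))%:R.

Lemma sum_pair_count (R : realType) n (g : 'I_n -> 'I_n -> R) ps :
  \sum_x \sum_y g x y * pair_count R ps x y = \sum_(q <- ps) g q.1 q.2.
Proof.
under eq_bigr => x _ do under eq_bigr => y _ do rewrite mulr_sumr.
under eq_bigr => x _ do rewrite exchange_big /=.
rewrite exchange_big; apply: eq_bigr => -[a b] _ /=.
rewrite (bigD1 a) //= (bigD1 b) //= eqxx mulr1 big1 => [|y /negPf yb]; last first.
  by rewrite xpair_eqE eqxx eq_sym yb mulr0.
rewrite big1 ?addr0 // => x /negPf xa; rewrite big1 // => y _.
by rewrite xpair_eqE eq_sym xa mulr0.
Qed.

Lemma pair_count_ge0 (R : realType) n ps (x y : 'I_n) : 0 <= pair_count R ps x y.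
Proof. by apply: sumr_ge0 => q _. Qed.

(* The property of [ps := disjoint_pairs] and [ps := disjoint_pairs \o behead]
   that the concentration bounds rely on. *)
Definition exp_tame (R : realType) n (Q : 'I_n -> 'I_n -> R) (l : nat)
    (ps : seq 'I_n -> seq ('I_n * 'I_n)) : Prop :=
  forall (g : 'I_n -> 'I_n -> R) (B : R) z,
  (forall z, \sum_x \sum_y Q z x * Q x y * expR (g x y) <= B) -> 1 <= B ->
  path_exp Q l z (fun s => expR (\sum_(q <- ps s) g q.1 q.2)) <= B ^+ l.

(** * Light pairs and discrepancy for disjoint pairs of states *)

Section Concentration.
Context (R : realType) (K n l : nat) (p : 'M[R]_K) (pi : 'I_K -> R)
  (sigma : 'I_n -> 'I_K) (kappa r : R).
Context (ps : seq 'I_n -> seq ('I_n * 'I_n)).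
Hypothesis sigma_surj : forall k, exists x, sigma x = k.
Hypothesis p_stoch : stochastic_mx p.
Hypothesis pi_stat : stationary_distribution p pi.
Hypothesis kappa_ge1 : 1 <= kappa.
Hypothesis cluster_kappa : forall k, n%:R <= kappa * #|bmc_cluster sigma k|%:R.
Hypothesis r_gt0 : 0 < r.
Hypothesis r_sqr : r ^+ 2 = l%:R / n%:R.
Hypothesis ps_tame : exp_tame (bmc_kernel p sigma) l.+1 ps.

Let Q := bmc_kernel p sigma.
Let mu := bmc_stationary pi sigma.
Let n0 : (0 < n)%N. Proof. exact: (n_gt0 sigma_surj pi_stat). Qed.
Let nR : 0 < n%:R :> R. Proof. by rewrite ltr0n. Qed.
Let mu0 : forall z, 0 <= mu z. Proof. exact: (bmc_stationary_ge0 sigma pi_stat). Qed.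
Let mu1 : \sum_z mu z = 1. Proof. exact: (bmc_stationary_sum sigma_surj pi_stat). Qed.
Let Q0 : forall z y, 0 <= Q z y. Proof. exact: bmc_kernel_ge0. Qed.

Let l_gt0 : (0 < l)%N.
Proof.
rewrite lt0n; apply/eqP => l0; move: r_sqr; rewrite l0 mul0r => /eqP.
by rewrite sqrf_eq0 gt_eqF.
Qed.

Let lE : l%:R = r ^+ 2 * n%:R. Proof. by rewrite r_sqr divfK // gt_eqF. Qed.

Let expR_pow_le (a : R) : 0 <= a -> expR a ^+ l.+1 <= expR (2 * (r ^+ 2 * n%:R) * a).
Proof.
move=> a0; rewrite -expRM_natl ler_expR -lE ler_wpM2r // -natr1.
have : 1 <= l%:R :> R by rewrite ler1n.
lra.
Qed.

Lemma prob_not_light : path_prob Q mu l (fun s =>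
    ~ light_bound (26 + 2 * kappa ^+ 2) r (fun x y => pair_count R (ps s) x y
        - block_avg sigma (pair_count R (ps s)) x y)) <= expR (- n%:R).
Proof.
(* [lam] is chosen to keep [f] below [1 / 2] on light pairs. Then [lam * tau * r] is
   [13 * n + kappa ^+ 2 * n]: it absorbs [12 * n] for the pairs of net points and [kappa ^+ 2 * n]
   for the exponential moment, and leaves [n]. *)
set tau := 26 + 2 * kappa ^+ 2.
pose lam := n%:R / (2 * r).
have lam0 : 0 < lam by rewrite divr_gt0 // mulr_gt0.
pose net (z : {ffun 'I_n -> 'I_(n.+1).*2.+1}) := in_net R z.
pose f (z z' : {ffun 'I_n -> 'I_(n.+1).*2.+1}) x y : R :=
  if n%:R * `|lattice R z x * lattice R z' y| <= r
  then lam * (lattice R z x * lattice R z' y) else 0.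
pose L (z z' : {ffun 'I_n -> 'I_(n.+1).*2.+1}) s : R :=
  \sum_(q <- ps s) (f z z' q.1 q.2 - block_avg sigma (f z z') q.1 q.2).
have LE z z' s : L z z' s = lam * \sum_x \sum_(y | n%:R * `|lattice R z x * lattice R z' y| <= r)
   lattice R z x * lattice R z' y * (pair_count R (ps s) x y
        - block_avg sigma (pair_count R (ps s)) x y).
  rewrite /L -(sum_pair_count (fun x y => f z z' x y - block_avg sigma (f z z') x y)).
  rewrite mulr_sumr.
  under eq_bigr => x _ do under eq_bigr => y _ do rewrite mulrBl.
  under eq_bigr => x _ do rewrite sumrB.
  (* Averaging is self-adjoint, so centring the counts amounts to centring the test function. *)
  rewrite sumrB -(block_avg_adjoint sigma_surj) -sumrB; apply: eq_bigr => x _.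
  rewrite -sumrB mulr_sumr [RHS]big_mkcond; apply: eq_bigr => y _.
  rewrite /f; case: ifP => _; last by rewrite !mul0r subrr.
  by ring.
have f_half z z' x y : `|f z z' x y| <= 1 / 2.
  rewrite /f; case: ifP => [h|_]; last by rewrite normr0; lra.
  rewrite normrM (gtr0_norm lam0) /lam mulrAC ler_pdivrMr ?mulr_gt0 //.
  by apply: le_trans h _; lra.
have f_sqr z z' : net z -> net z' -> \sum_x \sum_y f z z' x y ^+ 2 <= lam ^+ 2.
  move=> zn zn'.
  apply: (@le_trans _ _ (\sum_x \sum_y lam ^+ 2 * (lattice R z x ^+ 2 * lattice R z' y ^+ 2))).
    apply: ler_sum => x _; apply: ler_sum => y _; rewrite /f.
    case: ifP => _; first by rewrite !exprMn.
    by rewrite expr0n /= -!exprMn sqr_ge0.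
  under eq_bigr => x _ do rewrite -mulr_sumr -mulr_sumr.
  rewrite -mulr_sumr -mulr_suml ler_piMr ?sqr_ge0 // mulr_ile1 //.
    by apply: sumr_ge0 => x _; exact: sqr_ge0.
  by apply: sumr_ge0 => x _; exact: sqr_ge0.
pose G s : R := \sum_(z | net z) \sum_(z' | net z') expR (- (lam * tau * r)) * expR (L z z' s).
apply: (@path_prob_le_exp _ _ _ Q0 mu l _ G) => //.
- move=> s _; apply: sumr_ge0 => z _; apply: sumr_ge0 => z' _.
  by rewrite mulr_ge0 // expR_ge0.
- move=> s _; apply: contra_notP => /negP; rewrite -ltNge => G1.
  move=> z z' zn zn'; rewrite leNgt; apply/negP => big.
  move: G1; rewrite ltNge => /negP; apply.
  apply: (@le_trans _ _ (expR (- (lam * tau * r)) * expR (L z z' s))).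
    rewrite -expRD -[leLHS]expR0 ler_expR addrC subr_ge0 LE -mulrA ler_pM2l //.
    exact: ltW.
  rewrite /G (bigD1 z) //= (bigD1 z') //= -addrA lerDl addr_ge0 //.
    by apply: sumr_ge0 => w _; rewrite mulr_ge0 // expR_ge0.
  apply: sumr_ge0 => w _; apply: sumr_ge0 => w' _.
  by rewrite mulr_ge0 // expR_ge0.
move=> z0; rewrite path_exp_sum //.
apply: (@le_trans _ _ (\sum_(z | net z) 1 * (\sum_(z' | net z')
   1 * (expR (- (lam * tau * r)) * expR (kappa ^+ 2 * n%:R))))).
  apply: ler_sum => z zn; rewrite mul1r path_exp_sum //.
  apply: ler_sum => z' zn'; rewrite mul1r path_expZ // ler_wpM2l ?expR_ge0 //.
  pose a := 2 * (kappa / n%:R) ^+ 2 * lam ^+ 2.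
  have a0 : 0 <= a by rewrite mulr_ge0 ?sqr_ge0 // mulr_ge0 ?sqr_ge0.
  apply: (@le_trans _ _ (expR a ^+ l.+1)).
    apply: (@ps_tame (fun x y => f z z' x y - block_avg sigma (f z z') x y)); last by rewrite -[leLHS]expR0 ler_expR.
    move=> w; apply: le_trans (sum_kernel_expR_centered sigma_surj p_stoch
      pi_stat cluster_kappa w (f_half z z')) _.
    by rewrite ler_expR ler_wpM2l ?f_sqr // mulr_ge0 ?sqr_ge0.
  apply: le_trans (expR_pow_le a0) _; rewrite ler_expR /a /lam le_eqVlt.
  by apply/orP; left; apply/eqP; field; rewrite !gt_eqF.
rewrite -mulr_suml -mulr_suml.
have cn := card_net_le R n0.
have cn0 : 0 <= \sum_(z : {ffun 'I_n -> 'I_(n.+1).*2.+1} | in_net R z) 1 :> R.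
  by apply: sumr_ge0.
have e6 : 48 <= expR 6 :> R.
  have -> : 6 = 6 * 1 :> R by rewrite mulr1.
  rewrite expRM_natl; apply: (@le_trans _ _ (2 ^+ 6)).
    by rewrite -natrX ler_nat.
  apply: lerXn2r; rewrite ?nnegrE ?expR_ge0 //.
  by have := expR_ge1Dx (1 : R); lra.
have cnE : \sum_(z : {ffun 'I_n -> 'I_(n.+1).*2.+1} | in_net R z) 1 <=
    expR (6 * n%:R) :> R.
  apply: le_trans cn _; rewrite mulrC expRM_natl; apply: lerXn2r => //.
    by rewrite nnegrE.
  by rewrite nnegrE expR_ge0.
apply: (@le_trans _ _ (expR (6 * n%:R) * (expR (6 * n%:R) *
   (expR (- (lam * tau * r)) * expR (kappa ^+ 2 * n%:R))))).
  have E0 : 0 <= expR (- (lam * tau * r)) * expR (kappa ^+ 2 * n%:R).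
    by rewrite mulr_ge0 // expR_ge0.
  apply: ler_pM => //; first by apply: mulr_ge0.
  by rewrite ler_wpM2r.
rewrite -!expRD ler_expR.
have -> : lam * tau * r = n%:R * tau / 2 by rewrite /lam; field; rewrite gt_eqF.
by rewrite /tau; lra.
Qed.

Let edges_pair_count (A : seq ('I_n * 'I_n)) (S T : {set 'I_n}) :
  edges (pair_count R A) S T = \sum_(q <- A) ((q.1 \in S) && (q.2 \in T))%:R.
Proof.
rewrite -(sum_pair_count (fun x y => ((x \in S) && (y \in T))%:R)) /edges big_mkcond.
apply: eq_bigr => x _; case: (x \in S) => /=; last first.
  by rewrite big1 // => y _; rewrite mul0r.
rewrite big_mkcond; apply: eq_bigr => y _.
by case: (y \in T); rewrite ?mul1r ?mul0r.
Qed.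

(* Entropy cost of choosing [m] states out of [n]. *)
Let H (m : nat) : R := m%:R * (1 + ln (n%:R / m%:R)).

Let lnn0 m : (0 < m)%N -> (m <= n)%N -> 0 <= ln (n%:R / m%:R) :> R.
Proof.
move=> m0 mn; apply: ln_ge0; rewrite ler_pdivlMr ?ltr0n // mul1r ler_nat.
exact: mn.
Qed.

Let H_gt0 m : (0 < m)%N -> (m <= n)%N -> 0 < H m.
Proof.
by move=> m0 mn; rewrite mulr_gt0 ?ltr0n // ltr_wpDr ?lnn0.
Qed.

Let H_le m m' : (0 < m)%N -> (m <= m')%N -> (m' <= n)%N -> H m <= H m'.
Proof.
move=> m0 mm mn; have m'0 : (0 < m')%N by apply: leq_trans mm.
have mR : 0 < m%:R :> R by rewrite ltr0n.
have m'R : 0 < m'%:R :> R by rewrite ltr0n.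
rewrite /H; have -> : n%:R / m%:R = (n%:R / m'%:R) * (m'%:R / m%:R) :> R.
  by field; rewrite !gt_eqF.
rewrite lnM ?posrE ?divr_gt0 //.
have l1 : ln (m'%:R / m%:R) <= m'%:R / m%:R - 1 :> R.
  have h : 0 < m'%:R / m%:R :> R by rewrite divr_gt0.
  by have := expR_ge1Dx (ln (m'%:R / m%:R : R)); rewrite lnK ?posrE //; lra.
have l2 := lnn0 m'0 mn.
apply: (@le_trans _ _ (m%:R * (1 + (ln (n%:R / m'%:R) + (m'%:R / m%:R - 1))))).
  by rewrite ler_pM2l // lerD2l lerD2l.
have -> : m%:R * (1 + (ln (n%:R / m'%:R) + (m'%:R / m%:R - 1))) =
    m%:R * ln (n%:R / m'%:R) + m'%:R :> R by field; rewrite gt_eqF.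
rewrite mulrDr mulr1 addrC lerD2l ler_wpM2r // ler_nat.
exact: mm.
Qed.

(** ['C(n, m)] times [(m / n) ^+ m] is one term of the expansion of [(1 + m / n) ^+ n], which is at
    most [expR m]. *)
Let expRN_H m : (0 < m)%N -> (m <= n)%N -> expR (- H m) * 'C(n, m)%:R <= 1.
Proof.
move=> m0 mn.
have mR : 0 < m%:R :> R by rewrite ltr0n.
have q0 : 0 < m%:R / n%:R :> R by rewrite divr_gt0.
have -> : expR (- H m) = expR (- m%:R) * (m%:R / n%:R) ^+ m.
  rewrite /H mulrDr mulr1 opprD expRD; congr (_ * _).
  rewrite -mulrN -lnV ?posrE ?divr_gt0 // invf_div expRM_natl.
  by rewrite lnK // posrE.
rewrite -mulrA expRN mulrC ler_pdivrMr ?expR_gt0 // mul1r.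
apply: (@le_trans _ _ ((1 + m%:R / n%:R) ^+ n)).
  rewrite exprDn; rewrite (bigD1 (Ordinal (mn : (m < n.+1)%N))) //=.
  rewrite expr1n mul1r -[X in _ <= X + _]mulr_natr lerDl sumr_ge0 //.
apply: (@le_trans _ _ (expR (m%:R / n%:R) ^+ n)).
  apply: lerXn2r; rewrite ?nnegrE ?expR_ge0 ?expR_ge1Dx //.
by rewrite -expRM_natl mulrCA mulfV ?mulr1 // gt_eqF.
Qed.

(** One entropy pays for the number of sets of a given size, and each of the other two gives a
    factor [1 / n] because [H 1 <= H i]; the [n] sizes then add up to [1 / n]. *)
Let sum_sets_le : \sum_(S : {set 'I_n} | (0 < #|S|)%N) expR (- (3 * H #|S|)) <= n%:R^-1.
Proof.
have Sn (S : {set 'I_n}) : (#|S| < n.+1)%N by rewrite ltnS -[leqRHS]card_ord max_card.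
rewrite (partition_big (fun S => Ordinal (Sn S)) (fun i => (0 < i)%N)) //=.
apply: (@le_trans _ _ (\sum_(i < n.+1 | (0 < i)%N) (n%:R^-1) ^+ 2)).
  apply: ler_sum => i i0; have im : (i <= n)%N by rewrite -ltnS ltn_ord.
  rewrite (eq_bigr (fun=> expR (- (3 * H i)))) => [|S /andP[_ /eqP <-] //].
  rewrite sumr_const -[leLHS]mulr_natr.
  have -> : #|[pred S : {set 'I_n} | (0 < #|S|)%N & Ordinal (Sn S) == i]| = 'C(n, i).
    transitivity #|[set S : {set 'I_n} | #|S| == i]%SET|.
      2: by rewrite card_draws card_ord.
    apply: eq_card => S; rewrite !inE -val_eqE /=.
    by case: eqP => [->|_]; rewrite ?i0 ?andbF.
  have -> : - (3 * H i) = - H i + (- H i - H i) by ring.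
  rewrite expRD mulrAC -[leRHS]mul1r; apply: ler_pM.
  - by rewrite mulr_ge0 ?expR_ge0.
  - exact: expR_ge0.
  - exact: expRN_H.
  have H1 : expR (- H i) <= n%:R^-1.
    have h := @H_le 1 i isT i0 im.
    apply: (@le_trans _ _ (expR (- H 1))); first by rewrite ler_expR lerN2.
    rewrite /H divr1 mul1r opprD expRD expRN [expR (- ln _)]expRN lnK ?posrE //.
    rewrite ler_piMl ?invr_ge0 // invf_le1 ?expR_gt0 //.
    by have := expR_ge1Dx (1 : R); lra.
  by rewrite expRD expr2 ler_pM ?expR_ge0.
rewrite big_mkcond big_ord_recl /= add0r sumr_const card_ord -[leLHS]mulr_natr.
by rewrite expr2 -mulrA mulVf ?mulr1 // gt_eqF.
Qed.

Let max_le (S T : {set 'I_n}) : (maxn #|S| #|T| <= n)%N.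
Proof. by rewrite geq_max -[X in (_ <= X)%N && _](card_ord n)
  -[X in _ && (_ <= X)%N](card_ord n) !max_card. Qed.

Lemma ln_root4_le (x : R) : 1 <= x -> 1 + ln x <= 4 * root4 x /\
  root4 x = expR (ln x / 4).
Proof.
move=> x1; have x0 : 0 < x by apply: lt_le_trans x1.
have E : root4 x = expR (ln x / 4).
  have h (y : R) : Num.sqrt (expR y) = expR (y / 2).
    by rewrite -[RHS]ger0_norm ?expR_ge0 // -sqrtr_sqr expr2 -expRD -splitr.
  rewrite /root4 -{1}[x]lnK ?posrE // !h; congr expR; lra.
split => //; rewrite E.
by have := expR_ge1Dx (ln x / 4); lra.
Qed.

(** A Chernoff bound of Poisson type for each pair of sets. The exponent [th] makes
    [expR (th S T) * MU S T] comparable to the maximum of [MU] and [H]; [bd] exceeds this by 6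
    entropies, three for each of [S] and [T] in the union bound. The 2 in [MU] comes from
    [l.+1 <= 2 * l]. *)
Lemma prob_not_discrepancy : path_prob Q mu l (fun s =>
    ~ discrepancy (40 * kappa ^+ 2) (r ^+ 2) (pair_count R (ps s))) <= n%:R^-1.
Proof.
pose MU (S T : {set 'I_n}) := 2 * kappa ^+ 2 * (r ^+ 2 * #|S|%:R * #|T|%:R / n%:R).
pose m (S T : {set 'I_n}) := maxn #|S| #|T|.
pose th S T := 1 + ln (Num.max 1 (H (m S T) / MU S T)).
pose bd S T := 6 * H (m S T) + 4 * Num.max (MU S T) (H (m S T)).
pose G s := \sum_(S : {set 'I_n} | (0 < #|S|)%N) \sum_(T : {set 'I_n} | (0 < #|T|)%N)
  expR (- bd S T) * expR (th S T * edges (pair_count R (ps s)) S T).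
have k0 : 0 < kappa by apply: lt_le_trans kappa_ge1.
have MU0 (S T : {set 'I_n}) : (0 < #|S|)%N -> (0 < #|T|)%N -> 0 < MU S T.
  move=> S0 T0; apply: mulr_gt0; first by rewrite mulr_gt0 // exprn_gt0.
  by rewrite divr_gt0 // mulr_gt0 ?ltr0n // mulr_gt0 ?exprn_gt0 ?ltr0n.
have m0 (S T : {set 'I_n}) : (0 < #|S|)%N -> (0 < m S T)%N.
  by move=> S0; rewrite /m leq_max S0.
have th1 S T : 1 <= th S T by rewrite lerDl ln_ge0 // le_max lexx.
have th0 S T : 0 <= th S T by apply: le_trans (th1 S T).
have exp_th (S T : {set 'I_n}) : (0 < #|S|)%N -> (0 < #|T|)%N ->
    expR (th S T) * MU S T <= 4 * Num.max (MU S T) (H (m S T)).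
  move=> S0 T0; rewrite expRD lnK; last by rewrite posrE lt_max ltr01.
  have e4 := @expR_le_quadratic R 1 (lexx _); rewrite expr1n in e4.
  have -> : Num.max (MU S T) (H (m S T)) = Num.max 1 (H (m S T) / MU S T) * MU S T.
    rewrite maxr_pMl ?(ltW (MU0 _ _ S0 T0)) // mul1r divfK // gt_eqF //.
    exact: MU0.
  rewrite -mulrA ler_wpM2r; [by []| |by lra].
  by rewrite mulr_ge0 ?(ltW (MU0 _ _ S0 T0)) // le_max ler01.
have disc s : (forall S T : {set 'I_n}, (0 < #|S|)%N -> (0 < #|T|)%N ->
    th S T * edges (pair_count R (ps s)) S T <= bd S T) ->
    discrepancy (40 * kappa ^+ 2) (r ^+ 2) (pair_count R (ps s)).
  move=> h S T S0 T0 /=; have {h} := h S T S0 T0.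
  rewrite -/(m S T); set k := edges _ _ _; rewrite /bd.
  have k_ge0 : 0 <= k.
    by apply: sumr_ge0 => x _; apply: sumr_ge0 => y _; exact: pair_count_ge0.
  have mS0 := m0 S T S0; have mn := max_le S T.
  have MU0' := MU0 _ _ S0 T0; have H0 := H_gt0 mS0 mn.
  have kth : k <= th S T * k by rewrite ler_peMl.
  have kap1 : 1 <= kappa ^+ 2 by rewrite expr_ge1 // ltW.
  have MUE : MU S T = 2 * kappa ^+ 2 * (r ^+ 2 * #|S|%:R * #|T|%:R / n%:R) by [].
  set mu' := _ / n%:R in MUE *.
  have mu'0 : 0 <= mu'.
    by rewrite divr_ge0 // mulr_ge0 // mulr_ge0 ?sqr_ge0.
  have nm1 : 1 <= n%:R / (m S T)%:R :> R.
    by rewrite ler_pdivlMr ?ltr0n // mul1r ler_nat.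
  have [lnr4 r4E] := ln_root4_le nm1; rewrite -/(m S T).
  set w := root4 _ in lnr4 r4E *; set L := ln _ in lnr4 r4E.
  have mR : 0 < (m S T)%:R :> R by rewrite ltr0n.
  have HE : H (m S T) = (m S T)%:R * (1 + L) by [].
  have w0 : 0 <= w by exact: sqrtr_ge0.
  have [HM|HM] := leP (H (m S T)) (MU S T) => thk.
    left; apply: le_trans kth _; apply: le_trans thk _.
    apply: (@le_trans _ _ (10 * MU S T)); first by lra.
    have : 0 <= kappa ^+ 2 * mu' by rewrite mulr_ge0 // sqr_ge0.
    by rewrite MUE; lra.
  have thk10 : th S T * k <= 10 * H (m S T) by lra.
  have L0 : 0 <= L by exact: ln_ge0.
  right; split.
    apply: le_trans kth _; apply: le_trans thk10 _.
    have : (m S T)%:R * (1 + L) <= (m S T)%:R * (4 * w) by rewrite ler_pM2l.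
    have : 1 * ((m S T)%:R * w) <= kappa ^+ 2 * ((m S T)%:R * w).
      by rewrite ler_wpM2r // mulr_ge0 // ltW.
    by rewrite HE; lra.
  (* Either [th] is at least a quarter of [1 + ln (n / m)], the logarithms cancel and a multiple of
     [m] remains; or [H / MU] is at most the fourth root [w], so that [H <= MU * w]. *)
  have [thL|thL] := leP ((1 + L) / 4) (th S T).
    left.
    have h1 : (1 + L) / 4 * k <= 10 * ((m S T)%:R * (1 + L)).
      by rewrite -HE; apply: le_trans thk10; rewrite ler_wpM2r.
    have h2 : k <= 40 * (m S T)%:R.
      have L1 : 0 < (1 + L) / 4 by lra.
      by rewrite -(ler_pM2l L1); apply: le_trans h1 _; lra.
    apply: le_trans h2 _.
    have : 1 * (m S T)%:R <= kappa ^+ 2 * (m S T)%:R by rewrite ler_wpM2r.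
    by lra.
  right; apply: le_trans kth _; apply: le_trans thk10 _.
  have HMw : H (m S T) <= MU S T * w.
    have q1 : 1 < H (m S T) / MU S T by rewrite ltr_pdivlMr // mul1r.
    have : ln (H (m S T) / MU S T) <= L / 4.
      by move: thL; rewrite /th (max_idPr (ltW q1)); lra.
    rewrite -ler_expR lnK ?posrE ?(lt_trans ltr01) // -r4E.
    by rewrite ler_pdivrMr // mulrC.
  apply: (@le_trans _ _ (10 * (MU S T * w))); first by rewrite ler_pM2l.
  have : 0 <= kappa ^+ 2 * mu' * w by rewrite mulr_ge0 // mulr_ge0 // sqr_ge0.
  by rewrite MUE; lra.
apply: (@path_prob_le_exp _ _ _ Q0 mu l _ G) => //.
- move=> s _; apply: sumr_ge0 => S _; apply: sumr_ge0 => T _.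
  by rewrite mulr_ge0 // expR_ge0.
- move=> s _; apply: contra_notP => /negP; rewrite -ltNge => G1.
  apply: disc => S T S0 T0; rewrite leNgt; apply/negP => big.
  move: G1; rewrite ltNge => /negP; apply.
  apply: (@le_trans _ _ (expR (- bd S T) *
       expR (th S T * edges (pair_count R (ps s)) S T))).
    by rewrite -expRD -[leLHS]expR0 ler_expR addrC subr_ge0 ltW.
  rewrite /G (bigD1 S) //= (bigD1 T) //= -addrA lerDl addr_ge0 //.
    by apply: sumr_ge0 => w _; rewrite mulr_ge0 // expR_ge0.
  apply: sumr_ge0 => w _; apply: sumr_ge0 => w' _.
  by rewrite mulr_ge0 // expR_ge0.
move=> z0; rewrite path_exp_sum //.
apply: (@le_trans _ _ (\sum_(S : {set 'I_n} | (0 < #|S|)%N)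
   expR (- (3 * H #|S|)) * (\sum_(T : {set 'I_n} | (0 < #|T|)%N) expR (- (3 * H #|T|))))).
  apply: ler_sum => S S0; rewrite path_exp_sum // mulr_sumr.
  apply: ler_sum => T T0; rewrite path_expZ //.
  have mS0 := m0 S T S0; have mn := max_le S T.
  apply: (@le_trans _ _ (expR (- bd S T) * expR (expR (th S T) * MU S T))).
    rewrite ler_wpM2l ?expR_ge0 //.
    pose a := expR (th S T) * (kappa / n%:R) ^+ 2 * (#|S|%:R * #|T|%:R).
    have a0 : 0 <= a by rewrite !mulr_ge0 ?expR_ge0 ?invr_ge0 // ltW.
    apply: (@le_trans _ _ (expR a ^+ l.+1)).
      under eq_path_exp => s do rewrite edges_pair_count mulr_sumr.
      apply: (@ps_tame (fun x y => th S T * ((x \in S) && (y \in T))%:R));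
        last by rewrite -[leLHS]expR0 ler_expR.
      by move=> w; exact: (sum_kernel_expR_indicator sigma_surj p_stoch
        pi_stat cluster_kappa S T w (th0 S T)).
    apply: le_trans (expR_pow_le a0) _; rewrite ler_expR /a /MU le_eqVlt.
    by apply/orP; left; apply/eqP; field; rewrite gt_eqF.
  rewrite -!expRD ler_expR.
  have := exp_th S T S0 T0; rewrite /bd.
  have h1 : H #|S| <= H (m S T) by apply: H_le => //; rewrite leq_maxl.
  have h2 : H #|T| <= H (m S T) by apply: H_le => //; rewrite leq_maxr.
  by lra.
rewrite -mulr_suml.
have n1 : n%:R^-1 <= 1 :> R by rewrite invf_le1 // ler1n.
have s0 : 0 <= \sum_(S : {set 'I_n} | (0 < #|S|)%N) expR (- (3 * H #|S|)).
  by apply: sumr_ge0 => S _; exact: expR_ge0.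
apply: le_trans (ler_pM s0 s0 sum_sets_le sum_sets_le) _.
by rewrite ler_piMr // invr_ge0 ltW.
Qed.

End Concentration.

(** * Visits, degrees and the trimmed set *)

Definition visits (R : realType) n (s : seq 'I_n) (y : 'I_n) : R :=
  \sum_(x <- s) (x == y)%:R.

(** The exponential of the visits to one state has mean at most [expR (6 * kappa * d)]. On average
    at most [n * expR (- (2 * d))] states thus exceed the level [(6 * kappa + 2) * d]; one factor
    [expR (- d)] becomes the probability and the other matches the size of the trimmed set. *)
Lemma prob_many_visited (R : realType) (K n l : nat) (p : 'M[R]_K) (pi : 'I_K -> R)
    (sigma : 'I_n -> 'I_K) (kappa d : R) :
  (forall k, exists x, sigma x = k) -> stochastic_mx p ->
  stationary_distribution p pi -> 1 <= kappa ->
  (forall k, n%:R <= kappa * #|bmc_cluster sigma k|%:R) ->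
  (0 < l)%N -> d = l%:R / n%:R ->
  path_prob (bmc_kernel p sigma) (bmc_stationary pi sigma) l (fun s =>
    n%:R * expR (- d) <
    #|[set y | (6 * kappa + 2) * d < visits R s y]%SET|%:R) <= expR (- d).
Proof.
move=> surj p_stoch pi_stat kap1 ckap l0 dE; set c := 6 * kappa + 2.
have n0 : (0 < n)%N by exact: (n_gt0 surj pi_stat).
have nR : 0 < n%:R :> R by rewrite ltr0n.
pose G (s : seq 'I_n) := \sum_y expR (d - c * d) / n%:R * expR (visits R s y).
apply: (@path_prob_le_exp _ _ _ (bmc_kernel_ge0 surj p_stoch) _ _ _ G).
- exact: (bmc_stationary_ge0 sigma pi_stat).
- exact: (bmc_stationary_sum surj pi_stat).
- by move=> s _; apply: sumr_ge0 => y _; rewrite mulr_ge0 ?divr_ge0 ?expR_ge0.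
- move=> s _; set B := [set y | _]%SET => Bn.
  have -> : G s = expR d / n%:R * \sum_y expR (visits R s y - c * d).
    rewrite /G mulr_sumr; apply: eq_bigr => y _.
    rewrite mulrAC -expRD mulrAC -expRD; congr (expR _ / _); ring.
  apply: (@le_trans _ _ (expR d / n%:R * #|B|%:R)); last first.
    rewrite ler_wpM2l ?divr_ge0 ?expR_ge0 // -sum1_card natr_sum.
    rewrite big_mkcond; apply: ler_sum => y _; rewrite inE.
    case: ifP => [h|_]; last exact: expR_ge0.
    by rewrite -[leLHS]expR0 ler_expR subr_ge0 ltW.
  apply: (@le_trans _ _ (expR d / n%:R * (n%:R * expR (- d)))); last first.
    by rewrite ler_wpM2l ?divr_ge0 ?expR_ge0 // ltW.
  by rewrite mulrA divfK ?gt_eqF // -expRD subrr expR0.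
move=> z; rewrite path_exp_sum.
apply: (@le_trans _ _ (\sum_(y : 'I_n) expR (d - c * d) / n%:R *
    expR (3 * (kappa / n%:R)) ^+ l.+1)).
  apply: ler_sum => y _; rewrite path_expZ ?ler_wpM2l ?divr_ge0 ?expR_ge0 //.
  apply: (@path_exp_expR_sum _ _ _ _ _ _ (fun x => (x == y)%:R)).
  - exact: (bmc_kernel_ge0 surj p_stoch).
  - by move=> x; exact: (sum_kernel_expR_visit surj p_stoch pi_stat ckap y x).
  - exact: expR_ge0.
rewrite sumr_const card_ord -[leLHS]mulr_natr mulrAC divfK ?gt_eqF //.
rewrite -expRM_natl -expRD ler_expR.
have h : l.+1%:R * (3 * (kappa / n%:R)) <= 6 * kappa * d.
  rewrite dE; have -> : 6 * kappa * (l%:R / n%:R) = 2 * l%:R * (3 * (kappa / n%:R)).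
    by ring.
  rewrite ler_wpM2r ?mulr_ge0 ?divr_ge0 //; first by apply: le_trans kap1.
  have : 1 <= l%:R :> R by rewrite ler1n.
  by rewrite -natr1; lra.
by move: h; rewrite /c; lra.
Qed.

Lemma sum_adjacent_pairs (R : realType) (S : finType) (s : seq S) (F : S * S -> R) :
  \sum_(q <- zip s (behead s)) F q =
  \sum_(q <- disjoint_pairs s) F q + \sum_(q <- disjoint_pairs (behead s)) F q.
Proof.
case: s => [|x s]; first by rewrite !big_nil addr0.
elim: s x => [|y s IH] x; first by rewrite /= !big_nil addr0.
rewrite [zip _ _]/= big_cons -/(zip (y :: s) (behead (y :: s))) IH.
by rewrite [disjoint_pairs (x :: _)]/= [in RHS]big_cons /=; ring.
Qed.

Lemma count_mxE (R : realType) n l (x : nat -> 'I_n) i j :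
  count_mx R l x i j =
  \sum_(q <- zip (mkseq x l.+1) (behead (mkseq x l.+1))) (q == (i, j))%:R.
Proof.
have -> : zip (mkseq x l.+1) (behead (mkseq x l.+1)) =
    mkseq (fun t => (x t, x t.+1)) l.
  apply: (@eq_from_nth _ (x 0%N, x 0%N)).
    by rewrite size_zip size_behead !size_mkseq /= (minn_idPr _).
  move=> t; rewrite size_zip size_behead !size_mkseq /= (minn_idPr (leqnSn l)) => tl.
  rewrite nth_zip_cond size_zip size_map size_iota size_mkseq.
  rewrite (minn_idPr (leqnSn l)) tl (nth_map 0%N) ?size_iota // nth_iota //.
  by rewrite !nth_mkseq // ltnW.
rewrite big_map mxE natr_sum -(big_mkord predT (fun t => ((x t == i) && (x t.+1 == j))%:R)).
by rewrite /index_iota subn0; apply: eq_bigr => t _; rewrite xpair_eqE.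
Qed.

Lemma count_mx_pairs (R : realType) n l (x : nat -> 'I_n) i j :
  count_mx R l x i j =
  pair_count R (disjoint_pairs (mkseq x l.+1)) i j +
  pair_count R (disjoint_pairs (behead (mkseq x l.+1))) i j.
Proof. by rewrite count_mxE sum_adjacent_pairs. Qed.

Lemma count_mx_col_sum (R : realType) n l (x : nat -> 'I_n) y :
  visits R (mkseq x l.+1) y = (x 0%N == y)%:R + \sum_z count_mx R l x z y.
Proof.
rewrite /visits big_map -[iota 0 l.+1]/(0%N :: iota 1 l) big_cons; congr (_ + _).
rewrite (iotaDl 1 0) big_map.
under [RHS]eq_bigr => z _ do rewrite mxE natr_sum.
rewrite exchange_big /= -(big_mkord predT (fun t => \sum_z ((x t == z) && (x t.+1 == y))%:R)).
rewrite /index_iota subn0; apply: eq_bigr => t _; rewrite add1n.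
rewrite (bigD1 (x t)) //= eqxx big1 ?addr0 // => z /negPf.
by rewrite eq_sym => ->.
Qed.

Lemma count_mx_row_sum (R : realType) n l (x : nat -> 'I_n) y :
  visits R (mkseq x l.+1) y = \sum_z count_mx R l x y z + (x l == y)%:R.
Proof.
rewrite mkseqS /visits -cats1 big_cat big_seq1; congr (_ + _).
rewrite big_map; under [RHS]eq_bigr => z _ do rewrite mxE natr_sum.
rewrite exchange_big /= -(big_mkord predT (fun t => \sum_z ((x t == y) && (x t.+1 == z))%:R)).
rewrite /index_iota subn0; apply: eq_bigr => t _.
rewrite (bigD1 (x t.+1)) //= eqxx andbT big1 ?addr0 // => z /negPf.
by rewrite eq_sym => ->; rewrite andbF.
Qed.

(** If a state outside [G] had a column sum above [b], so would all of [G], and [#|G| + 1] states is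
    more than the integer part allows. The extra 1 for rows comes from the endpoints of the path. *)
Lemma most_visited_degrees (R : realType) n l (x : nat -> 'I_n) (G : {set 'I_n}) (b : R) :
  let d : R := l%:R / n%:R in
  most_visited l (count_mx R l x) G ->
  #|[set y | b < visits R (mkseq x l.+1) y]%SET|%:R <= n%:R * expR (- d) ->
  forall y, y \notin G ->
    \sum_z count_mx R l x z y <= b /\ \sum_z count_mx R l x y z <= b + 1.
Proof.
move=> d [cardG topG] few y yG.
have col : \sum_z count_mx R l x z y <= b.
  rewrite leNgt; apply/negP => big.
  have sub : ((y |: G) \subset [set y | b < visits R (mkseq x l.+1) y])%SET.
    apply/fintype.subsetP => z; rewrite finset.in_setU1 inE => yz.
    rewrite count_mx_col_sum; apply: (@lt_le_trans _ _ (\sum_x0 count_mx R l x x0 z)).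
      apply: lt_le_trans big _; case/orP: yz => [/eqP ->//|zG].
      exact: topG.
    by rewrite lerDr.
  have := subset_leq_card sub; rewrite finset.cardsU1 yG cardG add1n => c1.
  have nd0 : 0 <= n%:R * expR (- d) by rewrite mulr_ge0 ?expR_ge0.
  have /andP[_] := truncn_itv nd0; rewrite ltNge => /negP; apply.
  by apply: le_trans few; rewrite ler_nat.
split => //.
have := count_mx_col_sum R l x y; rewrite count_mx_row_sum => E.
have : (0 : R) <= (x l == y)%:R by [].
have : (x 0%N == y)%:R <= 1 :> R by case: (_ == _).
by move: E col; lra.
Qed.

(** * Fluctuations of the cluster transition counts *)

Lemma harmonic_pow (R : realType) K (p : 'M[R]_K) (v : 'cV[R]_K) t :
  p *m v = v -> (p ^+ t) *m v = v.
Proof.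
move=> pv; elim: t => [|t IH]; first by rewrite expr0 mul1mx.
by rewrite exprSr -[p ^+ t * p]/(p ^+ t *m p) -mulmxA pv IH.
Qed.

Lemma stochastic_mx_pow (R : realType) K (p : 'M[R]_K) t :
  stochastic_mx p -> stochastic_mx (p ^+ t).
Proof.
case=> p0 p1; split.
  elim: t => [|t IH] i j; first by rewrite expr0 mxE ler0n.
  rewrite exprS -[p * _]/(p *m _) mxE sumr_ge0 // => k _.
  by rewrite mulr_ge0.
move=> i; have one : p *m const_mx 1 = const_mx 1 :> 'cV[R]_K.
  apply/colP => j; rewrite !mxE -[RHS](p1 j); apply: eq_bigr => k _.
  by rewrite mxE mulr1.
have /colP/(_ i) := harmonic_pow t one; rewrite !mxE => <-.
by apply: eq_bigr => j _; rewrite mxE mulr1.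
Qed.

(** Maximum principle: averaging from a maximal state shows that all states reachable from it have
    the same value. *)
Lemma harmonic_const (R : realType) K (p : 'M[R]_K) (v : 'cV[R]_K) :
  stochastic_mx p -> irreducible_mx p -> p *m v = v ->
  forall i j, v i 0 = v j 0.
Proof.
move=> ps pirr pv i0.
pose m := [arg max_(i > i0) v i 0]%O.
have m_max j : v j 0 <= v m 0.
  by rewrite /m; case: (@arg_maxP _ _ _ i0 xpredT (fun i => v i 0)) => // i _ /(_ j isT).
suff h j : v j 0 = v m 0 by move=> j; rewrite (h i0) (h j).
have [t ptj] := pirr m j.
have [q0 q1] := stochastic_mx_pow t ps.
have : \sum_k (p ^+ t) m k * (v m 0 - v k 0) = 0.
  under eq_bigr => k _ do rewrite mulrBr.
  rewrite sumrB -mulr_suml q1 mul1r.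
  have /colP/(_ m) := harmonic_pow t pv; rewrite mxE => <-.
  exact: subrr.
move/eqP; rewrite psumr_eq0; last first.
  by move=> k _; rewrite mulr_ge0 // subr_ge0.
move=> /allP /(_ j (mem_index_enum _)) /=.
by rewrite mulf_eq0 gt_eqF //= subr_eq0 => /eqP.
Qed.

(** [A] is the inverse of the fundamental matrix of the chain. If [A *m v = 0] then [P *m v = 0], so
    [v] is harmonic, hence constant, hence zero. For centred [f] the solution has mean zero, which
    removes the rank-one term. *)
Lemma poisson_equation (R : realType) K (p : 'M[R]_K) (pi : 'I_K -> R) :
  stochastic_mx p -> irreducible_mx p -> stationary_distribution p pi ->
  forall f : 'I_K -> R, \sum_i pi i * f i = 0 ->
  exists g : 'I_K -> R, forall i, g i - \sum_j p i j * g j = f i.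
Proof.
move=> ps pirr [pi0 pi1 pip] f pif.
pose P : 'rV[R]_K := \row_i pi i.
pose one : 'cV[R]_K := const_mx 1.
pose A : 'M[R]_K := 1%:M - p + one *m P.
have Pp : P *m p = P.
  by apply/rowP => j; rewrite !mxE -[RHS]pip; apply: eq_bigr => i _; rewrite mxE.
have P1 : P *m one = 1%:M.
  apply/matrixP => i j; rewrite !ord1 !mxE -pi1.
  by apply: eq_bigr => k _; rewrite !mxE mulr1.
have PA : P *m A = P.
  by rewrite /A mulmxDr mulmxBr mulmx1 Pp subrr add0r mulmxA P1 mul1mx.
have Au : A \in unitmx.
  rewrite -unitmx_tr -row_free_unit -kermx_eq0; apply/eqP/row_matrixP => i.
  apply: trmx_inj; rewrite row0 trmx0; set v := (row i (kermx A^T))^T.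
  have Av : A *m v = 0.
    apply: trmx_inj; rewrite trmx_mul trmxK -row_mul mulmx_ker row0.
    by rewrite trmx0.
  have Pv : P *m v = 0 by rewrite -PA -mulmxA Av mulmx0.
  have pv : p *m v = v.
    move: Av; rewrite /A mulmxDl mulmxBl mul1mx -mulmxA Pv mulmx0 addr0.
    by move/eqP; rewrite subr_eq0 => /eqP.
  have vc := harmonic_const ps pirr pv.
  apply/colP => k; rewrite [RHS]mxE.
  have /matrixP/(_ 0 0) := Pv; rewrite [X in X = _]mxE [X in _ = X]mxE.
  under eq_bigr => j _ do rewrite mxE (vc j k).
  by rewrite -mulr_suml pi1 mul1r.
pose F : 'cV[R]_K := \col_i f i.
pose g := invmx A *m F.
have Ag : A *m g = F by rewrite mulKVmx.
have Pg : P *m g = 0.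
  rewrite -PA -mulmxA Ag; apply/matrixP => i j; rewrite !ord1 !mxE -[RHS]pif.
  by apply: eq_bigr => k _; rewrite !mxE.
exists (fun i => g i 0) => i.
have /colP/(_ i) := Ag; rewrite /A mulmxDl mulmxBl mul1mx -mulmxA Pg mulmx0 addr0.
by rewrite [X in _ = X -> _]mxE => <-; rewrite !mxE.
Qed.

Lemma transition_sumE (R : realType) (S : finType) (psi : S -> S -> R) z s :
  transition_sum psi z s = \sum_(q <- zip (z :: s) s) psi q.1 q.2.
Proof.
by elim: s z => [|y s IH] z; rewrite /= ?big_nil // big_cons IH.
Qed.

Definition cluster_dev (R : realType) K n (p : 'M[R]_K) (pi : 'I_K -> R)
    (sigma : 'I_n -> 'I_K) (s : seq 'I_n) (a b : 'I_K) : R :=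
  \sum_(q <- zip s (behead s))
    (((sigma q.1 == a) && (sigma q.2 == b))%:R - pi a * p a b).

(* The Poisson equation turns the fluctuations of the additive functional into a
   martingale plus a bounded boundary term. *)
Lemma cluster_dev_second_moment (R : realType) K (p : 'M[R]_K) (pi : 'I_K -> R) :
  stochastic_mx p -> irreducible_mx p -> stationary_distribution p pi ->
  exists2 C : R, 0 <= C & forall n (sigma : 'I_n -> 'I_K) l z a b,
    (forall k, exists x, sigma x = k) -> (0 < l)%N ->
    path_exp (bmc_kernel p sigma) l.+1 z
      (fun s => cluster_dev p pi sigma s a b ^+ 2) <= C * l%:R.
Proof.
move=> ps pirr pist; have [p0 p1] := ps; have [pi0 pi1 pip] := pist.
suff h (ab : 'I_K * 'I_K) : exists C : R, 0 <= C /\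
    forall n (sigma : 'I_n -> 'I_K) l z,
    (forall k, exists x, sigma x = k) -> (0 < l)%N ->
    path_exp (bmc_kernel p sigma) l.+1 z
      (fun s => cluster_dev p pi sigma s ab.1 ab.2 ^+ 2) <= C * l%:R.
  have [C hC] := fin_all_exists h.
  exists (\sum_ab C ab) => [|n sigma l z a b surj l0].
    by apply: sumr_ge0 => ab _; case: (hC ab).
  have [C0 hab] := hC (a, b).
  apply: le_trans (hab n sigma l z surj l0) _; rewrite ler_wpM2r //.
  rewrite (bigD1 (a, b)) //= lerDl; apply: sumr_ge0 => ab _.
  by case: (hC ab).
case: ab => a b /=.
have pab0 : 0 <= p a b by [].
have pab1 : p a b <= 1 by rewrite -(p1 a) (bigD1 b) //= lerDl sumr_ge0.
(* Given the current state, the indicator of [b] is centred by [p a b] and is already a martingale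
   difference. The equation is only solved for what remains, the indicator of [a] minus [pi a]. *)
have [|g gP] := @poisson_equation _ _ p pi ps pirr pist (fun i => (i == a)%:R - pi a).
  under eq_bigr => i _ do rewrite mulrBr.
  rewrite sumrB -mulr_suml pi1 mul1r (bigD1 a) //= eqxx mulr1 big1 ?addr0 ?subrr //.
  by move=> i /negPf->; rewrite mulr0.
pose B := \sum_i `|g i|.
have gB i : `|g i| <= B by rewrite /B (bigD1 i) //= lerDl sumr_ge0.
have B0 : 0 <= B by apply: sumr_ge0.
have pgB i : `|\sum_j p i j * g j| <= B.
  apply: le_trans (ler_norm_sum _ _ _) _; apply: ler_sum => j _.
  rewrite normrM ger0_norm // ler_piMl //.
  by rewrite -(p1 i) (bigD1 j) //= lerDl sumr_ge0.
(* [1 + 2 * B] bounds the martingale increments and [2 * B] the boundary term; each square is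
   doubled, and [1 <= l] absorbs the boundary. *)
exists (2 * (1 + 2 * B) ^+ 2 + 8 * B ^+ 2); split.
  by rewrite addr_ge0 // mulr_ge0 ?sqr_ge0.
move=> n sigma l z surj l0.
have Q0 := bmc_kernel_ge0 surj ps; have Q1 := bmc_kernel_sum surj ps.
pose psi x y : R := ((sigma x == a) && (sigma y == b))%:R - pi a * p a b.
pose phi x y : R := ((sigma x == a) && (sigma y == b))%:R
   - p a b * (sigma x == a)%:R + p a b * (g (sigma y) - \sum_j p (sigma x) j * g j).
have psiE x y : psi x y = phi x y + p a b * (g (sigma x) - g (sigma y)).
  rewrite /psi /phi; have -> : pi a = (sigma x == a)%:R -
      (g (sigma x) - \sum_j p (sigma x) j * g j) by rewrite gP; ring.
  by ring.
have tel x s : transition_sum psi x s = transition_sum phi x s +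
    p a b * (g (sigma x) - g (sigma (last x s))).
  elim: s x => [|y s IH] x /=; first by rewrite subrr mulr0 addr0.
  by rewrite IH psiE; ring.
have phi0 x : \sum_y bmc_kernel p sigma x y * phi x y = 0.
  pose F c : R := ((sigma x == a) && (c == b))%:R
   - p a b * (sigma x == a)%:R + p a b * (g c - \sum_j p (sigma x) j * g j).
  rewrite -[LHS]/(\sum_y bmc_kernel p sigma x y * F (sigma y)).
  rewrite (sum_bmc_kernel_weight p surj).
  transitivity (\sum_c (p (sigma x) c * ((sigma x == a) && (c == b))%:R)
    - \sum_c p (sigma x) c * (p a b * (sigma x == a)%:R)
    + (\sum_c p a b * (p (sigma x) c * g c) -
       \sum_c p (sigma x) c * (p a b * \sum_j p (sigma x) j * g j))).
    by rewrite -!sumrB -big_split /=; apply: eq_bigr => c _; rewrite /F; ring.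
  rewrite -!mulr_suml p1 -mulr_sumr !mul1r subrr addr0.
  case: eqP => [->|_] /=; last by rewrite mulr0 subr0 big1 // => c _; rewrite mulr0.
  rewrite (bigD1 b) //= eqxx big1 ?addr0 => [|c /negPf->]; last by rewrite mulr0.
  by rewrite !mulr1 subrr.
have phiB x y : phi x y ^+ 2 <= (1 + 2 * B) ^+ 2.
  rewrite -[leLHS]ger0_norm ?sqr_ge0 // normrX; apply: lerXn2r.
  - by rewrite nnegrE.
  - by rewrite nnegrE addr_ge0 // mulr_ge0.
  apply: le_trans (ler_normD _ _) _; apply: lerD.
    rewrite ler_norml; case: (sigma x == a) => /=; last by rewrite mulr0 subr0; lra.
    by case: (sigma y == b) => /=; lra.
  rewrite normrM (ger0_norm pab0).
  apply: (@le_trans _ _ (1 * (B + B))); last by lra.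
  apply: ler_pM => //; apply: le_trans (ler_normB _ _) _.
  exact: lerD.
rewrite /=.
apply: (@le_trans _ _ (\sum_y bmc_kernel p sigma z y *
   ((2 * (1 + 2 * B) ^+ 2 + 8 * B ^+ 2) * l%:R))); last first.
  by rewrite -mulr_suml Q1 mul1r.
apply: ler_sum => x _; rewrite ler_wpM2l //.
apply: (@le_trans _ _ (path_exp (bmc_kernel p sigma) l x
   (fun s => 2 * transition_sum phi x s ^+ 2 + 8 * B ^+ 2))).
  apply: path_exp_le => // s _.
  have -> : cluster_dev p pi sigma (x :: s) a b = transition_sum psi x s.
    by rewrite transition_sumE.
  rewrite tel; set t := transition_sum _ _ _; set c := p a b * _.
  have cB : c ^+ 2 <= 4 * B ^+ 2.
    have -> : 4 * B ^+ 2 = (B + B) ^+ 2 by ring.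
    rewrite -[leLHS]ger0_norm ?sqr_ge0 // normrX; apply: lerXn2r.
    - by rewrite nnegrE.
    - by rewrite nnegrE addr_ge0.
    rewrite /c normrM (ger0_norm pab0) -[leRHS]mul1r; apply: ler_pM => //.
    by apply: le_trans (ler_normB _ _) _; exact: lerD.
  have := sqr_ge0 (t - c); rewrite !expr2 in cB *; lra.
rewrite path_expD path_expZ path_exp_const //.
have := path_exp_sqr_martingale Q0 Q1 l x phi0 phiB.
set e := path_exp _ _ _ _ => he.
have l1 : 1 <= l%:R :> R by rewrite ler1n.
rewrite [leRHS]mulrDl; apply: lerD; first by lra.
by rewrite ler_peMr // mulr_ge0 ?sqr_ge0.
Qed.

(** * Separation of the centers *)

(** If nothing distinguished [i] from [j], summing the row identities over [k] would give
    [pi i / alpha i = pi j / alpha j]; then every logarithm with a nonzero coefficient in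
    [information_pair] is [ln 1], and the minimum is at most 0. *)
Lemma information_separates (R : realType) K (alpha : 'I_K -> R) (p : 'M[R]_K)
    (pi : 'I_K -> R) (i j : 'I_K) :
  (forall k, 0 < alpha k) -> stochastic_mx p -> (0 < information alpha p pi)%E ->
  i != j -> exists k, pi i * p i k / alpha i != pi j * p j k / alpha j \/
                      pi k * p k i / alpha i != pi k * p k j / alpha j.
Proof.
move=> a0 [p0 p1] I0 ij; apply: contrapT => none.
have row_eq k : pi i * p i k / alpha i = pi j * p j k / alpha j.
  by apply/eqP/negPn/negP => h; apply: none; exists k; left.
have col_eq k : pi k * p k i / alpha i = pi k * p k j / alpha j.
  by apply/eqP/negPn/negP => h; apply: none; exists k; right.
have pia : pi i / alpha i = pi j / alpha j.
  have : \sum_k pi i * p i k / alpha i = \sum_k pi j * p j k / alpha j.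
    by apply: eq_bigr => k _.
  by rewrite -!mulr_suml -!mulr_sumr !p1 !mulr1.
have a_neq0 k : alpha k != 0 by rewrite gt_eqF.
have info0 : information_pair alpha p pi i j = 0%E.
  rewrite /information_pair pia subrr adde0 big1 // => k _.
  have -> : xln (pi i * p i k) (p i k) (p j k) = 0%E.
    rewrite /xln; case: eqP => // /eqP; rewrite mulf_eq0 negb_or => /andP[pi_i pik].
    have pikj : p i k = p j k.
      have := row_eq k; rewrite mulrAC [RHS]mulrAC pia => /mulfI; apply.
      by rewrite -pia mulf_neq0 // invr_eq0.
    by rewrite -pikj (negPf pik) divff // ln1 mulr0.
  have -> : xln (pi k * p k i) (p k i * alpha j)%R (p k j * alpha i)%R = 0%E.
    rewrite /xln; case: eqP => // /eqP; rewrite mulf_eq0 negb_or => /andP[pi_k pki].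
    have -> : p k i * alpha j = p k j * alpha i.
      apply: (mulfI pi_k); apply: (mulIf (_ : (alpha i * alpha j)^-1 != 0)).
        by rewrite invr_eq0 mulf_neq0.
      have := col_eq k; set x := p k i; set y := p k j => xy.
      transitivity (pi k * x / alpha i); first by field; rewrite !a_neq0.
      by rewrite xy; field; rewrite !a_neq0.
    have h : p k j * alpha i != 0.
      apply/eqP => h0; have : pi k * p k j / alpha j = 0.
        by move/eqP: h0; rewrite mulf_eq0 (negPf (a_neq0 i)) orbF => /eqP ->; rewrite mulr0 mul0r.
      rewrite -col_eq => /eqP; rewrite !mulf_eq0 (negPf pi_k) (negPf pki) /=.
      by rewrite invr_eq0 (negPf (a_neq0 i)).
    by rewrite (negPf h) divff // ln1 mulr0.
  by rewrite adde0 mule0.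
move: I0; rewrite ltNge => /negP; apply; rewrite -info0 /information.
exact: (@bigmin_le_cond _ _ _ +oo%E (i, j) (fun ij => ij.1 != ij.2)
  (fun ij => information_pair alpha p pi ij.1 ij.2) ij).
Qed.

Lemma eventually_separated (R : realType) K (alpha : 'I_K -> R) (p : 'M[R]_K)
    (pi : 'I_K -> R) (a : nat -> 'I_K -> R) :
  (forall k, 0 < alpha k) -> stochastic_mx p -> (0 < information alpha p pi)%E ->
  (forall k, a m k @[m --> \oo] --> alpha k) ->
  exists2 eta : R, 0 < eta & \forall m \near \oo, forall i j : 'I_K, i != j ->
    exists k, eta <= `|pi i * p i k / (a m i * a m k) - pi j * p j k / (a m j * a m k)|
      \/ eta <= `|pi k * p k i / (a m k * a m i) - pi k * p k j / (a m k * a m j)|.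
Proof.
move=> alpha0 ps I0 cva.
have aa0 i k : alpha i * alpha k != 0 by rewrite mulf_neq0 // gt_eqF.
have cvw (c : R) i k : c / (a m i * a m k) @[m --> \oo] --> c / (alpha i * alpha k).
  by apply: cvgMr; apply: cvgV => //; apply: cvgM; exact: cva.
have cv i j k : pi i * p i k / (a m i * a m k) - pi j * p j k / (a m j * a m k)
    @[m --> \oo] --> pi i * p i k / (alpha i * alpha k) - pi j * p j k / (alpha j * alpha k).
  by apply: cvgB; exact: cvw.
have cv' i j k : pi k * p k i / (a m k * a m i) - pi k * p k j / (a m k * a m j)
    @[m --> \oo] --> pi k * p k i / (alpha k * alpha i) - pi k * p k j / (alpha k * alpha j).
  by apply: cvgB; exact: cvw.
have pair (ij : 'I_K * 'I_K) : exists e : R, 0 < e /\ (ij.1 != ij.2 ->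
    \forall m \near \oo, exists k,
    e <= `|pi ij.1 * p ij.1 k / (a m ij.1 * a m k) - pi ij.2 * p ij.2 k / (a m ij.2 * a m k)|
      \/ e <= `|pi k * p k ij.1 / (a m k * a m ij.1) - pi k * p k ij.2 / (a m k * a m ij.2)|).
  case: ij => i j /=; have [<-|ij] := eqVneq i j; first by exists 1; split.
  have [k [h|h]] := information_separates alpha0 ps I0 ij.
    set x := pi i * p i k / (alpha i * alpha k) - pi j * p j k / (alpha j * alpha k).
    have x0 : 0 < `|x|.
      rewrite normr_gt0 /x !invfM !mulrA -mulrBl mulf_neq0 ?subr_eq0 //.
      by rewrite invr_eq0 gt_eqF.
    exists (`|x| / 2); split => [|_]; first by rewrite divr_gt0.
    have xx : `|x| / 2 < `|x| by rewrite ltr_pdivrMr // ltr_pMr // ltr1n.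
    near=> m; exists k; left; near: m.
    exact: (cvgr_norm_ge _ (cv i j k) _ xx).
  set x := pi k * p k i / (alpha k * alpha i) - pi k * p k j / (alpha k * alpha j).
  have x0 : 0 < `|x|.
    rewrite normr_gt0 /x [alpha k * _]mulrC [alpha k * alpha j]mulrC !invfM !mulrA.
    by rewrite -mulrBl mulf_neq0 ?subr_eq0 // invr_eq0 gt_eqF.
  exists (`|x| / 2); split => [|_]; first by rewrite divr_gt0.
  have xx : `|x| / 2 < `|x| by rewrite ltr_pdivrMr // ltr_pMr // ltr1n.
  near=> m; exists k; right; near: m.
  exact: (cvgr_norm_ge _ (cv' i j k) _ xx).
have [e eP] := fin_all_exists pair.
(* [(1 + s)^-1] is a positive lower bound of the finitely many [e ij]. *)
pose s := \sum_ij (e ij)^-1.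
have e0 ij : 0 < e ij by case: (eP ij).
have es ij : (1 + s)^-1 <= e ij.
  rewrite -[leRHS]invrK lef_pV2 ?posrE ?invr_gt0 //.
    rewrite /s (bigD1 ij) //= addrCA lerDl addr_ge0 // sumr_ge0 // => ij' _.
    by rewrite invr_ge0 ltW.
  by rewrite ltr_pwDl // sumr_ge0 // => ij' _; rewrite invr_ge0 ltW.
exists (1 + s)^-1.
  by rewrite invr_gt0 ltr_pwDl // sumr_ge0 // => ij' _; rewrite invr_ge0 ltW.
have all_near : \forall m \near \oo, forall ij : 'I_K * 'I_K, ij.1 != ij.2 -> exists k,
    e ij <= `|pi ij.1 * p ij.1 k / (a m ij.1 * a m k) - pi ij.2 * p ij.2 k / (a m ij.2 * a m k)|
      \/ e ij <= `|pi k * p k ij.1 / (a m k * a m ij.1) - pi k * p k ij.2 / (a m k * a m ij.2)|.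
  apply: filter_forall => ij; have [_ h] := eP ij.
  have [ij'|/h] := eqVneq ij.1 ij.2; first by near=> m.
  by apply: filterS => m.
near=> m => i j ij.
have : forall ij : 'I_K * 'I_K, ij.1 != ij.2 -> exists k,
    e ij <= `|pi ij.1 * p ij.1 k / (a m ij.1 * a m k) - pi ij.2 * p ij.2 k / (a m ij.2 * a m k)|
      \/ e ij <= `|pi k * p k ij.1 / (a m k * a m ij.1) - pi k * p k ij.2 / (a m k * a m ij.2)|.
  by near: m.
move=> /(_ (i, j) ij) [k [h|h]]; exists k; [left|right]; exact: le_trans h.
Unshelve. all: by end_near.
Qed.

Definition block_center (R : realType) K n (sigma : 'I_n -> 'I_K)
    (nu : 'I_K -> 'I_K -> R) (i : 'I_K) : 'rV[R]_(n + n) :=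
  row_mx (\row_y nu i (sigma y)) (\row_y nu (sigma y) i).

Lemma row_block_matrix (R : realType) K n (sigma : 'I_n -> 'I_K)
    (nu : 'I_K -> 'I_K -> R) x :
  row x (row_mx (block_matrix sigma nu) (block_matrix sigma nu)^T) =
  block_center sigma nu (sigma x).
Proof.
by rewrite row_row_mx; congr row_mx; apply/rowP => y; rewrite !mxE.
Qed.

Lemma sqnorm_block_center (R : realType) K n (sigma : 'I_n -> 'I_K)
    (nu : 'I_K -> 'I_K -> R) i j :
  sqnorm (block_center sigma nu i - block_center sigma nu j) =
  \sum_k #|bmc_cluster sigma k|%:R *
    ((nu i k - nu j k) ^+ 2 + (nu k i - nu k j) ^+ 2).
Proof.
rewrite /block_center opp_row_mx add_row_mx sqnorm_row_mx /sqnorm.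
rewrite -(@sum_cluster R _ _ sigma (fun k => (nu i k - nu j k) ^+ 2 + (nu k i - nu k j) ^+ 2)).
by rewrite big_split /=; congr (_ + _); apply: eq_bigr => y _; rewrite !mxE.
Qed.

(** Entries of the centers are of order [l / n ^ 2], and a gap at one [k] is repeated over the whole
    cluster [k], which has at least [n / kappa] states. *)
Lemma block_center_separated (R : realType) K n l (sigma : 'I_n -> 'I_K)
    (p : 'M[R]_K) (pi : 'I_K -> R) (kappa eta : R) (nu : 'I_K -> 'I_K -> R) (i j : 'I_K) :
  (0 < n)%N -> 0 < kappa -> 0 < eta ->
  (forall k, n%:R <= kappa * #|bmc_cluster sigma k|%:R) ->
  let c k : R := #|bmc_cluster sigma k|%:R in
  let a k : R := c k / n%:R in
  (exists k, eta <= `|pi i * p i k / (a i * a k) - pi j * p j k / (a j * a k)|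
      \/ eta <= `|pi k * p k i / (a k * a i) - pi k * p k j / (a k * a j)|) ->
  (forall x y, nu x y = l%:R * (pi x * p x y) / (c x * c y)) ->
  eta * (l%:R / n%:R) / Num.sqrt (kappa * n%:R) <=
  l2norm (block_center sigma nu i - block_center sigma nu j).
Proof.
move=> n0 kap0 eta0 ckap c a [k hk] nuE0.
have nR : 0 < n%:R :> R by rewrite ltr0n.
have c0 x : 0 < c x.
  by rewrite -(pmulr_rgt0 _ kap0); apply: lt_le_trans (ckap x).
have nuE x y : nu x y = l%:R / n%:R ^+ 2 * (pi x * p x y / (a x * a y)).
  have := c0 x; have := c0 y; rewrite nuE0 /a; move: (c x) (c y) => cx cy cy0 cx0.
  by field; apply/and3P; split; rewrite gt_eqF.
have kn0 : 0 < Num.sqrt (kappa * n%:R) by rewrite sqrtr_gt0 mulr_gt0.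
have L0 : 0 <= l%:R / n%:R ^+ 2 :> R by rewrite divr_ge0 // exprn_ge0.
have big : (l%:R / n%:R ^+ 2 * eta) ^+ 2 <= (nu i k - nu j k) ^+ 2 + (nu k i - nu k j) ^+ 2.
  have sq (x : R) : eta <= `|x| ->
      (l%:R / n%:R ^+ 2 * eta) ^+ 2 <= (l%:R / n%:R ^+ 2 * x) ^+ 2.
    move=> ex; rewrite !exprMn ler_wpM2l ?sqr_ge0 //.
    rewrite -[leRHS]ger0_norm ?sqr_ge0 // normrX.
    by apply: lerXn2r => //; rewrite nnegrE ?ltW // (le_trans (ltW eta0)).
  rewrite !nuE -!mulrBr; case: hk => /sq h; apply: le_trans h _.
    by rewrite lerDl sqr_ge0.
  by rewrite lerDr sqr_ge0.
rewrite -(@ler_pXn2r _ 2) ?nnegrE ?l2norm_ge0 //; last first.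
  by rewrite divr_ge0 ?(ltW kn0) // mulr_ge0 ?(ltW eta0) // divr_ge0.
rewrite sqr_l2norm sqnorm_block_center (bigD1 k) //=.
apply: (@le_trans _ _ (c k * ((nu i k - nu j k) ^+ 2 + (nu k i - nu k j) ^+ 2))).
  apply: le_trans (ler_wpM2l (ltW (c0 k)) big).
  apply: (@le_trans _ _ (n%:R / kappa * (l%:R / n%:R ^+ 2 * eta) ^+ 2)).
    rewrite expr_div_n sqr_sqrtr ?mulr_ge0 ?(ltW kap0) // le_eqVlt.
    by apply/orP; left; apply/eqP; field; rewrite !gt_eqF.
  by rewrite ler_wpM2r ?sqr_ge0 // ler_pdivrMr // mulrC ckap.
rewrite lerDl; apply: sumr_ge0 => x _; rewrite mulr_ge0 ?(ltW (c0 x)) //.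
by rewrite addr_ge0 ?sqr_ge0.
Qed.

(** * The count matrix on typical paths *)

Lemma block_sumD (R : realType) K n (sigma : 'I_n -> 'I_K) (f g : 'I_n -> 'I_n -> R) a b :
  block_sum sigma (fun x y => f x y + g x y) a b = block_sum sigma f a b + block_sum sigma g a b.
Proof.
by rewrite /block_sum -big_split; apply: eq_bigr => x _; rewrite big_split.
Qed.

Lemma block_sum_count_mx (R : realType) K n l (x : nat -> 'I_n) (sigma : 'I_n -> 'I_K) a b :
  block_sum sigma (count_mx R l x) a b =
  \sum_(q <- zip (mkseq x l.+1) (behead (mkseq x l.+1)))
     ((sigma q.1 == a) && (sigma q.2 == b))%:R.
Proof.
rewrite /block_sum; under eq_bigr => i _ do under eq_bigr => j _ do rewrite count_mxE.
under eq_bigr => i _ do rewrite exchange_big.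
rewrite exchange_big; apply: eq_bigr => -[u v] _ /=.
rewrite (big_mkcond (fun i => sigma i == a)) (bigD1 u) //= [X in _ + X]big1 ?addr0; last first.
  move=> i iu; case: ifP => // _; rewrite big1 // => j _.
  by rewrite xpair_eqE (negPf (_ : u != i)) // eq_sym.
case: (sigma u == a) => //=.
rewrite big_mkcond (bigD1 v) //= [X in _ + X]big1 ?addr0; last first.
  move=> j jv; case: ifP => // _.
  by rewrite xpair_eqE (negPf (_ : v != j)) ?andbF // eq_sym.
by rewrite eqxx; case: (sigma v == b).
Qed.

Lemma cluster_dev_count_mx (R : realType) K n l (x : nat -> 'I_n) (sigma : 'I_n -> 'I_K)
    (p : 'M[R]_K) (pi : 'I_K -> R) a b :
  cluster_dev p pi sigma (mkseq x l.+1) a b =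
  block_sum sigma (count_mx R l x) a b - l%:R * (pi a * p a b).
Proof.
rewrite block_sum_count_mx /cluster_dev sumrB big_const_seq count_predT iter_addr_0.
by rewrite size_zip size_behead size_mkseq /= (minn_idPr (leqnSn l)) mulr_natl.
Qed.

Lemma block_sum_count_mx_le (R : realType) K n l (x : nat -> 'I_n) (sigma : 'I_n -> 'I_K) a b :
  block_sum sigma (count_mx R l x) a b <= l%:R.
Proof.
rewrite block_sum_count_mx.
have -> : l%:R = \sum_(q <- zip (mkseq x l.+1) (behead (mkseq x l.+1))) (1 : R).
  rewrite big_const_seq count_predT iter_addr_0 size_zip size_behead size_mkseq /=.
  by rewrite (minn_idPr (leqnSn l)).
by apply: ler_sum => q _; rewrite lern1 leq_b1.
Qed.

Lemma discrepancy_le (R : realType) n (c c' D : R) (N : 'I_n -> 'I_n -> R) :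
  0 <= D -> c <= c' -> discrepancy c D N -> discrepancy c' D N.
Proof.
move=> D0 cc' disc S T S0 T0 m mu w.
have m0 : 0 <= m by rewrite ler0n.
have mu0 : 0 <= mu by rewrite divr_ge0 // !mulr_ge0.
have w0 : 0 <= w by rewrite !sqrtr_ge0.
have := disc S T S0 T0; rewrite -/m -/mu -/w => -[h|[h1 h2]].
  by left; apply: le_trans h _; rewrite ler_wpM2r.
right; split; first by apply: le_trans h1 _; rewrite -!mulrA ler_wpM2r ?mulr_ge0.
case: h2 => h; [left|right]; apply: le_trans h _.
  by rewrite ler_wpM2r.
by rewrite -!mulrA ler_wpM2r ?mulr_ge0.
Qed.

(** The threshold [n * l] for the cluster deviations is [n] times the order of their second moments,
    and still small enough for a block error of order [sqrt (l / n)]. *)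
Definition good_path (R : realType) K n (p : 'M[R]_K) (pi : 'I_K -> R)
    (sigma : 'I_n -> 'I_K) (kappa : R) (l : nat) (s : seq 'I_n) : Prop :=
  let d := l%:R / n%:R in
  let regular ps := light_bound (26 + 2 * kappa ^+ 2) (Num.sqrt d)
      (fun x y => pair_count R ps x y - block_avg sigma (pair_count R ps) x y) /\
    discrepancy (40 * kappa ^+ 2) d (pair_count R ps) in
  [/\ #|[set y | (6 * kappa + 2) * d < visits R s y]%SET|%:R <= n%:R * expR (- d),
      regular (disjoint_pairs s), regular (disjoint_pairs (behead s))
    & \sum_a \sum_b cluster_dev p pi sigma s a b ^+ 2 <= n%:R * l%:R].

Lemma prob_not_good_path (R : realType) K (p : 'M[R]_K) (pi : 'I_K -> R) (kappa : R) :
  stochastic_mx p -> irreducible_mx p -> stationary_distribution p pi -> 1 <= kappa ->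
  exists2 C, 0 <= C & forall n l (sigma : 'I_n -> 'I_K),
    (forall k, exists x, sigma x = k) ->
    (forall k, n%:R <= kappa * #|bmc_cluster sigma k|%:R) -> (0 < l)%N ->
    path_prob (bmc_kernel p sigma) (bmc_stationary pi sigma) l
      (fun s => ~ good_path p pi sigma kappa l s) <= expR (- (l%:R / n%:R)) + C / n%:R.
Proof.
move=> ps irr pist kap1.
have [C C0 dev] := cluster_dev_second_moment ps irr pist.
(* Four light and discrepancy events of probability at most [1 / n] each, then Markov's inequality
   for the [K ^ 2] second moments. *)
exists (4 + K%:R ^+ 2 * C); first by rewrite addr_ge0 // mulr_ge0 ?sqr_ge0.
move=> n l sigma surj ckap l0.
have n0 : (0 < n)%N by exact: n_gt0 surj pist.
have nR : 0 < n%:R :> R by rewrite ltr0n.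
have lR : 0 < l%:R :> R by rewrite ltr0n.
have Q0 := bmc_kernel_ge0 surj ps.
have Q1 := bmc_kernel_sum surj ps.
have mu0 := bmc_stationary_ge0 sigma pist.
have mu1 := bmc_stationary_sum surj pist.
set Q := bmc_kernel p sigma in Q0 Q1 *.
set mu := bmc_stationary pi sigma in mu0 mu1 *.
set d := l%:R / n%:R.
have d0 : 0 < d by rewrite divr_gt0.
have r0 : 0 < Num.sqrt d by rewrite sqrtr_gt0.
have r2 : Num.sqrt d ^+ 2 = d by rewrite sqr_sqrtr ?ltW.
pose many (s : seq 'I_n) :=
  n%:R * expR (- d) < #|[set y | (6 * kappa + 2) * d < visits R s y]%SET|%:R.
pose light (ps : seq ('I_n * 'I_n)) := light_bound (26 + 2 * kappa ^+ 2) (Num.sqrt d)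
  (fun x y => pair_count R ps x y - block_avg sigma (pair_count R ps) x y).
pose disc (ps : seq ('I_n * 'I_n)) := discrepancy (40 * kappa ^+ 2) d (pair_count R ps).
pose off (s : seq 'I_n) := n%:R * l%:R < \sum_a \sum_b cluster_dev p pi sigma s a b ^+ 2.
have tame1 : exp_tame Q l.+1 (@disjoint_pairs 'I_n).
  by move=> g B z; exact: path_exp_expR_pairs.
have tame2 : exp_tame Q l.+1 (fun s => disjoint_pairs (behead s)).
  by move=> g B z; exact: path_exp_expR_pairs_behead.
have expn : expR (- n%:R) <= n%:R^-1 :> R.
  rewrite expRN lef_pV2 ?posrE ?expR_gt0 //.
  by apply: le_trans (expR_ge1Dx _); rewrite lerDr.
have P1 : path_prob Q mu l many <= expR (- d).
  exact: prob_many_visited.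
have Pl ps' : exp_tame Q l.+1 ps' ->
    path_prob Q mu l (fun s => ~ light (ps' s)) <= n%:R^-1.
  by move=> tame; apply: le_trans expn; exact: prob_not_light.
have Pd ps' : exp_tame Q l.+1 ps' ->
    path_prob Q mu l (fun s => ~ disc (ps' s)) <= n%:R^-1.
  by move=> tame; rewrite /disc -{1}r2; exact: prob_not_discrepancy.
have Po : path_prob Q mu l off <= K%:R ^+ 2 * C / n%:R.
  apply: (path_prob_le_exp Q0 (G := fun s => \sum_a \sum_b
    (n%:R * l%:R)^-1 * cluster_dev p pi sigma s a b ^+ 2)) => // [s _|s _|z].
  - by apply: sumr_ge0 => a _; apply: sumr_ge0 => b _; rewrite mulr_ge0 ?sqr_ge0.
  - rewrite /off => /ltW h.
    under eq_bigr do rewrite -mulr_sumr.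
    by rewrite -mulr_sumr mulrC ler_pdivlMr ?mulr_gt0 // mul1r.
  rewrite path_exp_sum.
  apply: (@le_trans _ _ (\sum_(a < K) \sum_(b < K) (C / n%:R))); last first.
    rewrite !sumr_const !card_ord -mulrnA -[leLHS]mulr_natl natrM.
    by apply: le_of_eq; ring.
  apply: ler_sum => a _; rewrite path_exp_sum; apply: ler_sum => b _.
  rewrite path_expZ; apply: (@le_trans _ _ ((n%:R * l%:R)^-1 * (C * l%:R))).
    by rewrite ler_wpM2l ?invr_ge0 ?mulr_ge0 // dev.
  apply: le_of_eq; field.
  by apply/andP; split; rewrite gt_eqF.
pose u2 (s : seq 'I_n) := ~ light (disjoint_pairs s) \/ ~ disc (disjoint_pairs s).
pose u3 (s : seq 'I_n) :=
  ~ light (disjoint_pairs (behead s)) \/ ~ disc (disjoint_pairs (behead s)).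
have P2 : path_prob Q mu l u2 <= n%:R^-1 + n%:R^-1.
  apply: le_trans (lerD (Pl _ tame1) (Pd _ tame1)).
  exact: path_prob_union.
have P3 : path_prob Q mu l u3 <= n%:R^-1 + n%:R^-1.
  apply: le_trans (lerD (Pl _ tame2) (Pd _ tame2)).
  exact: path_prob_union.
apply: (@le_trans _ _ ((expR (- d) + (n%:R^-1 + n%:R^-1)) +
    ((n%:R^-1 + n%:R^-1) + K%:R ^+ 2 * C / n%:R))); last first.
  by rewrite mulrDl; lra.
apply: le_trans (lerD (le_trans (path_prob_union Q0 (B := many) (C := u2)
   (A := fun s => many s \/ u2 s) _ _) (lerD P1 P2))
  (le_trans (path_prob_union Q0 (B := u3) (C := off)
   (A := fun s => u3 s \/ off s) _ _) (lerD P3 Po))) => //.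
apply: path_prob_union => // s _.
rewrite /good_path -/d => h.
apply: contrapT => /not_orP [/not_orP [h1 /not_orP [h2 h3]] /not_orP [/not_orP [h4 h5] h6]].
apply: h; split.
- by rewrite leNgt; apply/negP.
- by split; exact: contrapT.
- by split; exact: contrapT.
by rewrite leNgt; apply/negP.
Qed.

Lemma le_block_entry (R : realType) K n (l : nat) (sigma : 'I_n -> 'I_K) (kappa : R) a b :
  (0 < n)%N -> (forall k, n%:R <= kappa * #|bmc_cluster sigma k|%:R) ->
  l%:R <= kappa ^+ 2 * (l%:R / n%:R) / n%:R *
    (#|bmc_cluster sigma a|%:R * #|bmc_cluster sigma b|%:R).
Proof.
move=> n0 ckap; have nR : 0 < n%:R :> R by rewrite ltr0n.
set ca : R := #|bmc_cluster sigma a|%:R; set cb : R := #|bmc_cluster sigma b|%:R.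
rewrite [leRHS](_ : _ = l%:R / n%:R ^+ 2 * ((kappa * ca) * (kappa * cb))); last first.
  by field; rewrite gt_eqF.
rewrite mulrAC ler_pdivlMr ?exprn_gt0 // ler_wpM2l // expr2.
by apply: ler_pM; rewrite ?ckap.
Qed.

(** The common constant [49 * kappa ^+ 2] dominates [40 * kappa ^+ 2] from the discrepancy and
    [6 * kappa + 3] from the degrees. Degrees and block sums are bounded for the full counts [N],
    which dominate those of either half of the pairs. *)
Lemma opbound_trimmed_pairs (R : realType) K n (l : nat) (sigma : 'I_n -> 'I_K) (kappa : R)
    (G : {set 'I_n}) (N : 'M[R]_n) (ps : seq ('I_n * 'I_n)) :
  let d := l%:R / n%:R in
  (forall k, exists x, sigma x = k) -> 1 <= kappa ->
  (forall k, n%:R <= kappa * #|bmc_cluster sigma k|%:R) -> (0 < n <= l)%N ->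
  light_bound (26 + 2 * kappa ^+ 2) (Num.sqrt d)
    (fun x y => pair_count R ps x y - block_avg sigma (pair_count R ps) x y) ->
  discrepancy (40 * kappa ^+ 2) d (pair_count R ps) ->
  (forall x y, pair_count R ps x y <= N x y) ->
  (forall a b, block_sum sigma N a b <= l%:R) ->
  (forall y, y \notin G -> \sum_x N x y <= (6 * kappa + 2) * d /\
                           \sum_x N y x <= (6 * kappa + 2) * d + 1) ->
  opbound (\matrix_(x, y) trimmed G
      (fun x y => pair_count R ps x y - block_avg sigma (pair_count R ps) x y) x y)
    (4 * ((26 + 2 * kappa ^+ 2 + 547 * (49 * kappa ^+ 2)) * Num.sqrt d)).
Proof.
move=> d surj kap1 ckap /andP[n0 nl] light disc le_N N_sum deg.
have nR : 0 < n%:R :> R by rewrite ltr0n.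
have d1 : 1 <= d by rewrite ler_pdivlMr // mul1r ler_nat.
have kap2 : 1 <= kappa ^+ 2 by rewrite expr_ge1 // (le_trans ler01).
have kapkap : kappa <= kappa ^+ 2 by rewrite expr2 ler_peMr // (le_trans ler01).
have r2 : Num.sqrt d ^+ 2 = d by rewrite sqr_sqrtr ?(le_trans ler01).
have cd : (6 * kappa + 2) * d + 1 <= 49 * kappa ^+ 2 * d.
  apply: (@le_trans _ _ ((6 * kappa + 3) * d)); first by lra.
  by rewrite ler_wpM2r ?(le_trans ler01) //; lra.
apply: opbound_trimmed => //.
- by rewrite -sqrtr1 ler_sqrt ?(le_trans ler01).
- by lra.
- by move=> x y; exact: pair_count_ge0.
- move=> x y; rewrite block_avg_ge0 //=; last by move=> u v; exact: pair_count_ge0.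
  rewrite r2 /block_avg.
  set ca : R := #|bmc_cluster sigma (sigma x)|%:R.
  set cb : R := #|bmc_cluster sigma (sigma y)|%:R.
  have ca0 : 0 < ca by exact: cluster_gt0.
  have cb0 : 0 < cb by exact: cluster_gt0.
  rewrite ler_pdivrMr ?mulr_gt0 //.
  apply: le_trans (_ : _ <= l%:R) _.
    apply: le_trans (N_sum (sigma x) (sigma y)).
    by apply: ler_sum => u _; apply: ler_sum => v _.
  apply: le_trans (le_block_entry l (sigma x) (sigma y) n0 ckap) _; rewrite -/ca -/cb -/d.
  rewrite ler_wpM2r ?mulr_ge0 ?(ltW ca0) ?(ltW cb0) //.

  have dn0 : 0 <= d / n%:R by rewrite divr_ge0 // (le_trans ler01).
  by rewrite -[leLHS]mulrA -[leRHS]mulrA ler_wpM2r //; lra.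
- by rewrite r2; apply: discrepancy_le disc; lra.
- move=> x xG; rewrite r2; have [_ h] := deg x xG.
  by apply: le_trans (le_trans h cd); apply: ler_sum => y _.
move=> y yG; rewrite r2; have [h _] := deg y yG.
apply: (@le_trans _ _ ((6 * kappa + 2) * d)); last by lra.
by apply: le_trans h; apply: ler_sum => x _.
Qed.

(** The factor 8 is 4 for each of the two families of pairs; [kappa] comes from the cluster averages
    and [2 * kappa ^+ 2] from trimming the limit. *)
Definition spectral_const (R : realType) (kappa : R) : R :=
  8 * (26 + 2 * kappa ^+ 2 + 547 * (49 * kappa ^+ 2)) + (kappa + 2 * kappa ^+ 2).

Lemma opbound_block_error (R : realType) K n l (sigma : 'I_n -> 'I_K) (kappa : R)
    (G : {set 'I_n}) (D : 'I_K -> 'I_K -> R) :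
  (forall k, exists x, sigma x = k) -> 0 < kappa -> (0 < n)%N ->
  (forall k, n%:R <= kappa * #|bmc_cluster sigma k|%:R) ->
  \sum_a \sum_b D a b ^+ 2 <= n%:R * l%:R ->
  opbound (\matrix_(x, y) trimmed G (fun x y => D (sigma x) (sigma y) /
     (#|bmc_cluster sigma (sigma x)|%:R * #|bmc_cluster sigma (sigma y)|%:R)) x y)
    (kappa * Num.sqrt (l%:R / n%:R)).
Proof.
move=> surj kap0 n0 ckap sumD.
pose c k : R := #|bmc_cluster sigma k|%:R.
have nR : 0 < n%:R :> R by rewrite ltr0n.
have c0 k : 0 < c k by exact: cluster_gt0.
have d0 : 0 <= l%:R / n%:R :> R by rewrite divr_ge0.
apply: opbound_frob; first by rewrite mulr_ge0 ?sqrtr_ge0 ?(ltW kap0).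
rewrite exprMn sqr_sqrtr //.
apply: (@le_trans _ _ (\sum_x \sum_y (D (sigma x) (sigma y) / (c (sigma x) * c (sigma y))) ^+ 2)).
  apply: ler_sum => x _; apply: ler_sum => y _; rewrite mxE /trimmed.
  by case: ifP => // _; rewrite expr0n sqr_ge0.
rewrite (sum_cluster sigma (fun a => \sum_y (D a (sigma y) / (c a * c (sigma y))) ^+ 2)).
under eq_bigr => a _ do rewrite (sum_cluster sigma (fun b => (D a b / (c a * c b)) ^+ 2)).
apply: (@le_trans _ _ (\sum_a \sum_b (kappa / n%:R) ^+ 2 * D a b ^+ 2)); last first.
  under eq_bigr do rewrite -mulr_sumr.
  rewrite -mulr_sumr; apply: le_trans (ler_wpM2l (sqr_ge0 _) sumD) _.
  by apply: le_of_eq; field; rewrite gt_eqF.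
apply: ler_sum => a _; rewrite mulr_sumr; apply: ler_sum => b _; rewrite -/(c a) -/(c b).
rewrite (_ : c a * _ = (c a)^-1 * (c b)^-1 * D a b ^+ 2); last first.
  move: (c a) (c b) (c0 a) (c0 b) => ca cb ca0 cb0.
  by field; apply/andP; split; rewrite gt_eqF.
have ci k : (c k)^-1 <= kappa / n%:R.
  by rewrite ler_pdivlMr // mulrC ler_pdivrMr // ckap.
by rewrite ler_wpM2r ?sqr_ge0 // expr2 ler_pM ?invr_ge0 ?(ltW (c0 _)).
Qed.

(** At most [n * expR (- d)] rows and as many columns are lost, each with [n] entries of order
    [d / n]; [d * expR (- d) <= 1] brings the total square down to order [d]. *)
Lemma opbound_trim_loss (R : realType) n (G : {set 'I_n}) (d b : R) (N : 'M[R]_n) :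
  (0 < n)%N -> 1 <= d -> 0 <= b -> #|G|%:R <= n%:R * expR (- d) ->
  (forall x y, `|N x y| <= b * d / n%:R) ->
  opbound (\matrix_(x, y) (trimmed G N x y - N x y)) (2 * b * Num.sqrt d).
Proof.
move=> n0 d1 b0 cG Nb.
have nR : 0 < n%:R :> R by rewrite ltr0n.
have d0 : 0 < d by rewrite (lt_le_trans ltr01).
apply: opbound_frob; first by rewrite !mulr_ge0 ?sqrtr_ge0.
rewrite exprMn sqr_sqrtr ?(ltW d0) //.
pose B := (b * d / n%:R) ^+ 2.
have B0 : 0 <= B by rewrite sqr_ge0.
apply: (@le_trans _ _ (\sum_(x < n) \sum_(y < n) ((x \in G)%:R + (y \in G)%:R) * B)).
  apply: ler_sum => x _; apply: ler_sum => y _; rewrite mxE /trimmed.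
  have sqN : N x y ^+ 2 <= B.
    rewrite -[N x y ^+ 2]ger0_norm ?sqr_ge0 // normrX.
    by apply: lerXn2r (Nb x y); rewrite ?nnegrE // divr_ge0 ?mulr_ge0 ?(ltW d0).
  case: (x \in G); case: (y \in G); rewrite /= ?subrr ?sub0r ?sqrrN ?expr0n /=;
    rewrite ?mulrDl ?mul1r ?mul0r ?addr0 ?add0r //.
  by rewrite (le_trans sqN) // lerDl.
have -> : \sum_(x < n) \sum_(y < n) ((x \in G)%:R + (y \in G)%:R) * B =
    2 * (#|G|%:R * n%:R * B).
  have sG : \sum_(x < n) (x \in G)%:R = #|G|%:R :> R.
    by rewrite -sum1_card natr_sum [RHS]big_mkcond; apply: eq_bigr => x _; case: (x \in G).
  under eq_bigr => x _ do rewrite -mulr_suml big_split /= sG sumr_const card_ord.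
  rewrite -mulr_suml big_split /= sumr_const card_ord.
  by rewrite sumrMnl sG -[#|G|%:R *+ n]mulr_natl; ring.
apply: (@le_trans _ _ (2 * (n%:R * expR (- d) * n%:R * B))).
  by rewrite ler_wpM2l // ler_wpM2r // ler_wpM2r // ltW.
have -> : 2 * (n%:R * expR (- d) * n%:R * B) = 2 * b ^+ 2 * d * (d * expR (- d)).
  by rewrite /B; field; rewrite gt_eqF.
have ded : d * expR (- d) <= 1.
  rewrite expRN ler_pdivrMr ?expR_gt0 // mul1r.
  by apply: le_trans (expR_ge1Dx _); rewrite lerDr.
apply: (@le_trans _ _ (2 * b ^+ 2 * d * 1)).
  by rewrite ler_wpM2l // !mulr_ge0 ?sqr_ge0 // ltW.
rewrite mulr1 exprMn ler_wpM2r ?(ltW d0) // ler_wpM2r ?sqr_ge0 //; lra.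
Qed.

Lemma trimmed_count_close (R : realType) K n l (p : 'M[R]_K) (pi : 'I_K -> R)
    (sigma : 'I_n -> 'I_K) (kappa : R) (x : nat -> 'I_n) (G : {set 'I_n}) :
  (forall k, exists x, sigma x = k) -> (forall a b, 0 <= pi a * p a b <= 1) ->
  1 <= kappa -> (forall k, n%:R <= kappa * #|bmc_cluster sigma k|%:R) -> (0 < n <= l)%N ->
  good_path p pi sigma kappa l (mkseq x l.+1) -> most_visited l (count_mx R l x) G ->
  opbound (trim (count_mx R l x) G - block_matrix sigma (fun a b =>
      l%:R * (pi a * p a b) / (#|bmc_cluster sigma a|%:R * #|bmc_cluster sigma b|%:R)))
    (spectral_const kappa * Num.sqrt (l%:R / n%:R)).
Proof.
move=> surj pip kap1 ckap /[dup] nl /andP[n0 nl'] [visited [light1 disc1] [light2 disc2] dev] mv.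
set d := l%:R / n%:R in visited light1 disc1 light2 disc2 *.
have nR : 0 < n%:R :> R by rewrite ltr0n.
have kap0 : 0 < kappa by rewrite (lt_le_trans ltr01).
have d1 : 1 <= d by rewrite ler_pdivlMr // mul1r ler_nat.
have deg := most_visited_degrees mv visited.
set ps1 := disjoint_pairs (mkseq x l.+1) in light1 disc1.
set ps2 := disjoint_pairs (behead (mkseq x l.+1)) in light2 disc2.
have countE i j : count_mx R l x i j = pair_count R ps1 i j + pair_count R ps2 i j.
  exact: count_mx_pairs.
have le1 i j : pair_count R ps1 i j <= count_mx R l x i j by rewrite countE lerDl pair_count_ge0.
have le2 i j : pair_count R ps2 i j <= count_mx R l x i j by rewrite countE lerDr pair_count_ge0.
have sum_le := block_sum_count_mx_le R l x sigma.
have op1 := opbound_trimmed_pairs surj kap1 ckap nl light1 disc1 le1 sum_le deg.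
have op2 := opbound_trimmed_pairs surj kap1 ckap nl light2 disc2 le2 sum_le deg.
have op3 := opbound_block_error G surj kap0 n0 ckap dev.
set nu := fun a b : 'I_K => _.
have op4 : opbound (\matrix_(i, j) (trimmed G (block_matrix sigma nu) i j - block_matrix sigma nu i j))
    (2 * kappa ^+ 2 * Num.sqrt d).
  apply: opbound_trim_loss => //; first exact: sqr_ge0.
    have [-> _] := mv.
    by rewrite truncn_le mulr_ge0 ?expR_ge0.
  move=> i j; rewrite mxE /nu; have /andP[q0 q1] := pip (sigma i) (sigma j).
  set ca : R := #|bmc_cluster sigma (sigma i)|%:R.
  set cb : R := #|bmc_cluster sigma (sigma j)|%:R.
  have ca0 : 0 < ca by exact: cluster_gt0.
  have cb0 : 0 < cb by exact: cluster_gt0.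
  rewrite ger0_norm; last by apply: divr_ge0; [exact: mulr_ge0|rewrite mulr_ge0 ?ltW].
  rewrite ler_pdivrMr ?mulr_gt0 //.
  apply: (@le_trans _ _ (l%:R * 1)); first by rewrite ler_wpM2l.
  by rewrite mulr1; exact: le_block_entry.
have devE a b : cluster_dev p pi sigma (mkseq x l.+1) a b =
    block_sum sigma (pair_count R ps1) a b + block_sum sigma (pair_count R ps2) a b -
    l%:R * (pi a * p a b).
  rewrite cluster_dev_count_mx -block_sumD; congr (_ - _).
  by apply: eq_bigr => u _; apply: eq_bigr => v _; exact: countE.
(* Four errors add up to counts minus limit: the two centred families of pairs, the cluster averages
   minus their limit, and the entries of the limit lost by trimming. *)
have := opboundD (opboundD op1 op2) (opboundD op3 op4).
rewrite -!mulrDl (_ : _ + _ + (_ + _) =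
    trim (count_mx R l x) G - block_matrix sigma nu); last first.
  move: (count_mx R l x) countE => N countE.
  apply/matrixP => i j; rewrite !mxE /trimmed; case: ifP => _; last by ring.
  by rewrite devE countE !mxE /nu /block_avg !mulrBl !mulrDl; ring.
by apply: opbound_le; rewrite -/d /spectral_const; lra.
Qed.

(** * From the spectral error to the misclassified states *)

Lemma card_markov (R : realType) (I : finType) (A : {set I}) (f : I -> R) (t : R) :
  (forall x, 0 <= f x) -> (forall x, x \in A -> t <= f x) -> #|A|%:R * t <= \sum_x f x.
Proof.
move=> f0 ft; rewrite mulr_natl -sumr_const [leRHS](bigID (mem A)) /=.
by rewrite -[leLHS]addr0 lerD ?sumr_ge0 // ler_sum.
Qed.

(** The total squared error [err] is used at two scales: at [h / 4] to make the bad rows few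
    compared with [rho], so that the loop is under control, and at [sep / 4] to count the misplaced
    states. *)
Lemma few_misclassified (R : realType) K n l (p : 'M[R]_K) (pi : 'I_K -> R)
    (sigma : 'I_n -> 'I_K) (kappa gam h rho sep : R) (x : nat -> 'I_n) (E : {set 'I_n}) :
  let d := l%:R / n%:R in
  let e := spectral_const kappa * Num.sqrt d in
  let nu a b := l%:R * (pi a * p a b) / (#|bmc_cluster sigma a|%:R * #|bmc_cluster sigma b|%:R) in
  let err := 16 * K%:R * e ^+ 2 in
  (0 < K)%N -> (forall k, exists x, sigma x = k) -> (forall a b, 0 <= pi a * p a b <= 1) ->
  1 <= kappa -> (forall k, n%:R <= kappa * #|bmc_cluster sigma k|%:R) -> (0 < n <= l)%N ->
  e < gam -> gam + e < d / (Num.sqrt (frob (pinvmx (\matrix_(a, b) (pi a * p a b)))) + 1) ->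
  (forall i j, i != j -> sep <= l2norm (block_center sigma nu i - block_center sigma nu j)) ->
  0 < h -> 8 * h <= sep ->
  K.+1%:R * (err / (h / 4) ^+ 2) < rho ->
  rho + 3 * (err / (h / 4) ^+ 2) <= n%:R / kappa ->
  good_path p pi sigma kappa l (mkseq x l.+1) ->
  clustering_outcome l sigma gam h rho x E ->
  #|E|%:R <= err / (sep / 4) ^+ 2.
Proof.
move=> d e nu err K0 surj pip kap1 ckap nl egam gamd nu_sep h0 hsep rho_big rho_small good.
case=> G [U [s [V [mv [svd [q [z [C [run compl]]]]]]]]].
have /andP[n0 nl'] := nl.
have nR : 0 < n%:R :> R by rewrite ltr0n.
have kap0 : 0 < kappa by rewrite (lt_le_trans ltr01).
have sep0 : 0 < sep by apply: lt_le_trans hsep; rewrite mulr_gt0.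
have e0 : 0 <= e.
  by rewrite mulr_ge0 ?sqrtr_ge0 // /spectral_const; have := sqr_ge0 kappa; lra.
have close := trimmed_count_close surj pip kap1 ckap nl good mv.
pose Q := \matrix_(a, b) (pi a * p a b).
have nuQ : block_matrix sigma nu = block_matrix sigma (fun a b =>
    l%:R * Q a b / (#|bmc_cluster sigma a|%:R * #|bmc_cluster sigma b|%:R)).
  by apply/matrixP => i j; rewrite !mxE.
pose T := svd_trunc U s V (spectral_rank s gam).
pose Xm := row_mx T T^T.
have errsum : \sum_y center_error Xm sigma (block_center sigma nu) y ^+ 2 <= err.
  have := embedding_close (Q := Q) (g := gam) svd surj (_ : 0 < l%:R) e0.
  rewrite /= -nuQ => /(_ _ close egam gamd) => H.
  apply: le_trans (H _); last by rewrite ltr0n (leq_trans n0).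
  apply: ler_sum => y _; rewrite /center_error sqr_l2norm.
  by rewrite -row_block_matrix.
have dist y y' : row_dist (embedding (spectral_rank_le s gam) U s V) y y' = row_dist Xm y y'.
  exact: row_dist_embedding svd _ _ _ _.
have nbE : neighbourhood (embedding (spectral_rank_le s gam) U s V) h = neighbourhood Xm h.
  by apply/funext => y; apply/setP => y'; rewrite !inE dist.
have count t : 0 < t -> #|[set y | t <= center_error Xm sigma (block_center sigma nu) y]%SET|%:R
    <= err / t ^+ 2.
  move=> t0; rewrite ler_pdivlMr ?exprn_gt0 //; apply: le_trans errsum.
  apply: card_markov => y; first exact: sqr_ge0.
  by rewrite inE => ty; apply: lerXn2r => //; rewrite nnegrE ?l2norm_ge0 // ltW.
set bad := [set y | h / 4 < center_error Xm sigma (block_center sigma nu) y]%SET.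
have badc : #|bad|%:R <= err / (h / 4) ^+ 2.
  apply: le_trans (count _ _); last by rewrite divr_gt0.
  rewrite ler_nat subset_leq_card //; apply/fintype.subsetP => y; rewrite !inE; exact: ltW.
have bad_rho : (K.+1 * #|bad|)%:R < rho.
  by apply: le_lt_trans rho_big; rewrite natrM ler_wpM2l.
have bad_size k : rho + (3 * #|bad|)%:R <= #|bmc_cluster sigma k|%:R.
  apply: (@le_trans _ _ (n%:R / kappa)); last by rewrite ler_pdivrMr // mulrC.
  by apply: le_trans rho_small; rewrite lerD2l natrM ler_wpM2l.
rewrite nbE in run.
have qK := density_run_count K0 h0 nu_sep hsep bad_rho bad_size run.
have [c [cc mis]] := compl (congr1 predn qK).
apply: le_trans (count (sep / 4) _); last by rewrite divr_gt0.
rewrite ler_nat; apply: (misclassified_card K0 h0 nu_sep hsep bad_rho bad_size run _ mis).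
move=> y yA; have [c1 c2] := cc y yA; split=> // k k1.
by have := c2 k k1; rewrite !dist.
Qed.

(** * Asymptotics *)

Lemma omega_of_near (R : realType) (a b : nat -> R) (A : R) :
  omega_of a b -> \forall n \near \oo, A <= a n / b n.
Proof. by move=> ab; exact: (cvgryPge _).1 ab A. Qed.

Lemma o_of_near (R : realType) (a b : nat -> R) (A : R) :
  o_of a b -> 0 < A -> \forall n \near \oo, a n / b n <= A.
Proof.
move=> ab A0; have : \forall n \near \oo, `|a n / b n| <= A by exact: (cvgr0_norm_le _ ab _ A0).
apply: filterS => n.
exact: le_trans (ler_norm _).
Qed.

Lemma near_inftyS (Q : nat -> Prop) :
  (\forall n \near \oo, Q n) -> \forall m \near \oo, Q m.+1.
Proof.
by case=> N _ HN; exists N => // m /= Nm; apply: HN => /=; exact: leqW.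
Qed.

Lemma eventually_admissible (R : realType) (K : nat) (ell : nat -> nat)
    (gam h rho : nat -> R) (c kappa eta F : R) :
  0 <= c -> 1 <= kappa -> 0 < eta -> 1 <= F ->
  omega_of (fun n => (ell n)%:R : R) (fun n => n%:R) ->
  (forall n, 0 < h n) ->
  omega_of gam (fun n => Num.sqrt ((ell n)%:R / n%:R)) ->
  o_of gam (fun n => (ell n)%:R / n%:R) ->
  o_of (fun n => n%:R * h n ^+ 2) (fun n => ((ell n)%:R / n%:R) ^+ 2) ->
  omega_of rho (fun n => ((ell n)%:R / n%:R) / h n ^+ 2) ->
  o_of rho (fun n => n%:R) ->
  \forall n \near \oo,
    let d := (ell n)%:R / n%:R in
    let err := 16 * K%:R * (c * Num.sqrt d) ^+ 2 in
    [/\ (0 < n <= ell n)%N, c * Num.sqrt d < gam n,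
        gam n + c * Num.sqrt d < d / F,
        8 * h n <= eta * d / Num.sqrt (kappa * n%:R)
      & K.+1%:R * (err / (h n / 4) ^+ 2) < rho n /\
        rho n + 3 * (err / (h n / 4) ^+ 2) <= n%:R / kappa].
Proof.
move=> c0 kap1 eta0 F1 ell_omega h0 gam_omega gam_o h_o rho_omega rho_o.
have kap0 : 0 < kappa by rewrite (lt_le_trans ltr01).
have F0 : 0 < F by rewrite (lt_le_trans ltr01).
(* The ratio of [K.+1 * err / (h / 4) ^+ 2] to [d / h ^+ 2]; 256 is the 16 of [err] times the square
   of 4. *)
pose A : R := K.+1%:R * (256 * K%:R * c ^+ 2).
near=> n.
have d1 : 1 <= (ell n)%:R / n%:R :> R by near: n; exact: (omega_of_near _ ell_omega).
have gam_ge : c + 1 <= gam n / Num.sqrt ((ell n)%:R / n%:R).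
  by near: n; exact: (omega_of_near _ gam_omega).
have gam_le : gam n / ((ell n)%:R / n%:R) <= F^-1 / 2.
  by near: n; apply: (o_of_near gam_o); rewrite divr_gt0 ?invr_gt0.
have rho_ge : A + 1 <= rho n / ((ell n)%:R / n%:R / h n ^+ 2).
  by near: n; exact: (omega_of_near _ rho_omega).
(* This is the wanted bound on [8 * h n], squared and solved for the ratio in [h_o]. *)
have h_le : n%:R * h n ^+ 2 / ((ell n)%:R / n%:R) ^+ 2 <= (eta / 8) ^+ 2 / kappa.
  by near: n; apply: (o_of_near h_o); rewrite divr_gt0 // exprn_gt0 // divr_gt0.
have rho_le : rho n / n%:R <= (4 * kappa)^-1.
  by near: n; apply: (o_of_near rho_o); rewrite invr_gt0 mulr_gt0.
have n0 : (0 < n)%N by near: n; exact: nbhs_infty_gt.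
set d := _ / n%:R in d1 gam_ge gam_le rho_ge h_le *; set err := 16 * _ * _.
have nR : 0 < n%:R :> R by rewrite ltr0n.
have d0 : 0 < d by rewrite (lt_le_trans ltr01).
have r0 : 0 < Num.sqrt d by rewrite sqrtr_gt0.
have hn0 : 0 < h n by exact: h0.
have nl : (n <= ell n)%N by move: d1; rewrite ler_pdivlMr // mul1r ler_nat.
have gam1 : c * Num.sqrt d < gam n.
  by move: gam_ge; rewrite ler_pdivlMr //; apply: lt_le_trans; rewrite mulrDl mul1r ltrDl.
have gam2 : gam n <= d / F / 2.
  by move: gam_le; rewrite ler_pdivrMr // => /le_trans; apply; rewrite mulrC mulrA.
have errE : K.+1%:R * (err / (h n / 4) ^+ 2) = A * (d / h n ^+ 2).
  rewrite /err exprMn sqr_sqrtr ?(ltW d0) // /A; field; by rewrite gt_eqF.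
have rho1 : K.+1%:R * (err / (h n / 4) ^+ 2) < rho n.
  have dh : 0 < d / h n ^+ 2 by rewrite divr_gt0 ?exprn_gt0.
  by move: rho_ge; rewrite errE ler_pdivlMr //; apply: lt_le_trans; rewrite mulrDl mul1r ltrDl.
have err0 : 0 <= err / (h n / 4) ^+ 2.
  by rewrite divr_ge0 ?exprn_ge0 ?divr_ge0 ?(ltW hn0) // !mulr_ge0 ?sqr_ge0.
split => //; first by rewrite n0 nl.
- by lra.
- move: h_le; rewrite ler_pdivrMr ?exprn_gt0 // => hh.
  rewrite -(@ler_pXn2r _ 2) ?nnegrE ?mulr_ge0 ?divr_ge0 ?invr_ge0 ?sqrtr_ge0 ?(ltW hn0) ?(ltW eta0) ?(ltW d0) //.
  rewrite [leRHS]exprMn exprVn sqr_sqrtr ?mulr_ge0 ?(ltW kap0) // ler_pdivlMr ?mulr_gt0 //.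
  apply: (@le_trans _ _ (64 * kappa * (n%:R * h n ^+ 2))).
    by apply: le_of_eq; ring.
  apply: (@le_trans _ _ (64 * kappa * ((eta / 8) ^+ 2 / kappa * d ^+ 2))).
    by rewrite ler_wpM2l // mulr_ge0 // ltW.
  by apply: le_of_eq; field; rewrite gt_eqF.
split => //.
(* The left-hand side of the goal is then at most [4 * rho n], which explains the [4 * kappa] in
   [rho_le]. *)
have : err / (h n / 4) ^+ 2 <= rho n.
  apply: le_trans (ltW rho1); rewrite ler_peMl // ler1n //.
move: rho_le; rewrite ler_pdivrMr // invfM.
rewrite (_ : 4^-1 / kappa * n%:R = n%:R / kappa / 4); last by ring.
by lra.
Unshelve. all: by end_near.
Qed.

Lemma eventually_balanced (R : realType) (K : nat) (alpha : 'I_K -> R) (c : nat -> 'I_K -> R) :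
  (forall k, 0 < alpha k) -> (forall k, c m k / m.+1%:R @[m --> \oo] --> alpha k) ->
  exists2 kappa, 1 <= kappa & \forall m \near \oo, forall k, m.+1%:R <= kappa * c m k.
Proof.
move=> alpha0 ca; pose S := \sum_k 2 / alpha k.
have S0 : 0 <= S by apply: sumr_ge0 => k _; rewrite divr_ge0 // ltW.
exists (1 + S); first by rewrite lerDl.
apply: filter_forall => k.
have half : alpha k / 2 < alpha k by have := alpha0 k; lra.
have near_half : \forall m \near \oo, alpha k / 2 <= c m k / m.+1%:R.
  exact: (cvgr_ge _ (ca k) _ half).
apply: filterS near_half => m.
rewrite ler_pdivlMr ?ltr0n // => h.
have c0 : 0 <= c m k by apply: le_trans h; rewrite mulr_ge0 ?divr_ge0 // ltW.
apply: (@le_trans _ _ (2 / alpha k * c m k)).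
  apply: le_trans (ler_wpM2l _ h); last by rewrite divr_ge0 // ltW.
  by apply: le_of_eq; field; rewrite gt_eqF.
rewrite ler_wpM2r // /S (bigD1 k) //= addrCA lerDl addr_ge0 // sumr_ge0 // => j _.
by rewrite divr_ge0 // ltW.
Qed.

Lemma measurable_discrete_rv d (T : measurableType d) (S : finType) (X : T -> S) (A : S -> Prop) :
  discrete_rv X -> measurable [set w | A (X w)].
Proof.
move=> X_rv.
rewrite (_ : [set w | A (X w)] = \big[setU/set0]_(x | `[< A x >]) [set w | X w = x]).
  by apply: bigsetU_measurable => x _; exact: X_rv.
apply/seteqP; split => w /=.
  move=> Aw; rewrite -bigcup_seq_cond; exists (X w) => //=.
  by rewrite mem_index_enum; exact/asboolP.
by rewrite -bigcup_seq_cond => -[x /andP[_ /asboolP Ax]] /= ->.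
Qed.

Lemma stationary_mul_itv (R : realType) K (p : 'M[R]_K) (pi : 'I_K -> R) a b :
  stochastic_mx p -> stationary_distribution p pi -> 0 <= pi a * p a b <= 1.
Proof.
move=> [p0 p1] [pi0 pi1 _]; rewrite mulr_ge0 //=.
have pile : pi a <= 1.
  by rewrite -pi1 (bigD1 a) //= lerDl sumr_ge0.
have ple : p a b <= 1.
  by rewrite -(p1 a) (bigD1 b) //= lerDl sumr_ge0.
exact: mulr_ile1.
Qed.

Lemma eventually_few_misclassified (R : realType) (K : nat) (alpha : 'I_K -> R) (p : 'M[R]_K)
    (pi : 'I_K -> R) (sigma : forall m : nat, 'I_m.+1 -> 'I_K)
    (ell : nat -> nat) (gam h rho : nat -> R) (kappa : R) :
  (0 < K)%N -> (forall k, 0 < alpha k) -> stochastic_mx p -> stationary_distribution p pi ->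
  (0 < information alpha p pi)%E ->
  (\forall m \near \oo, forall k, exists x, sigma m x = k) ->
  (forall k, (#|bmc_cluster (sigma m) k|%:R / m.+1%:R : R) @[m --> \oo] --> alpha k) ->
  1 <= kappa ->
  (\forall m \near \oo, forall k, m.+1%:R <= kappa * #|bmc_cluster (sigma m) k|%:R) ->
  omega_of (fun n => (ell n)%:R : R) (fun n => n%:R) ->
  (forall n, 0 < h n) ->
  omega_of gam (fun n => Num.sqrt ((ell n)%:R / n%:R)) ->
  o_of gam (fun n => (ell n)%:R / n%:R) ->
  o_of (fun n => n%:R * h n ^+ 2) (fun n => ((ell n)%:R / n%:R) ^+ 2) ->
  omega_of rho (fun n => ((ell n)%:R / n%:R) / h n ^+ 2) ->
  o_of rho (fun n => n%:R) ->
  exists2 C : R, 0 <= C & \forall m \near \oo, forall (x : nat -> 'I_m.+1) (E : {set 'I_m.+1}),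
    good_path p pi (sigma m) kappa (ell m.+1) (mkseq x (ell m.+1).+1) ->
    clustering_outcome (ell m.+1) (sigma m) (gam m.+1) (h m.+1) (rho m.+1) x E ->
    #|E|%:R / m.+1%:R <= C * (m.+1%:R / (ell m.+1)%:R).
Proof.
move=> K0 alpha0 ps pist I0 surj sizes kap1 bal ell_omega h0 gam_omega gam_o h_o rho_omega rho_o.
have kap0 : 0 < kappa by rewrite (lt_le_trans ltr01).
have [eta eta0 sep] := eventually_separated
  (a := fun m k => #|bmc_cluster (sigma m) k|%:R / m.+1%:R) alpha0 ps I0 sizes.
have c0 : 0 <= spectral_const kappa.
  by rewrite /spectral_const; have := sqr_ge0 kappa; lra.
pose F := Num.sqrt (frob (pinvmx (\matrix_(a, b) (pi a * p a b)))) + 1.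
have F1 : 1 <= F by rewrite lerDr sqrtr_ge0.
have adm := near_inftyS (eventually_admissible K c0 kap1 eta0 F1 ell_omega h0 gam_omega
  gam_o h_o rho_omega rho_o).
(* The value of [err / (sep / 4) ^+ 2] for [sep = eta * d / sqrt (kappa * n)], divided by [n] and by
   [n / l]. *)
exists (256 * K%:R * spectral_const kappa ^+ 2 * kappa / eta ^+ 2).
  apply: divr_ge0 (sqr_ge0 _); apply: mulr_ge0 (ltW kap0).
  by apply: mulr_ge0 (sqr_ge0 _); apply: mulr_ge0; exact: ler0n.
near=> m => x E good out.
have [nl gam1 gam2 hsep [rho1 rho2]] : let n := m.+1 in
    let d := (ell n)%:R / n%:R in
    let err := 16 * K%:R * (spectral_const kappa * Num.sqrt d) ^+ 2 in
    [/\ (0 < n <= ell n)%N, spectral_const kappa * Num.sqrt d < gam n,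
        gam n + spectral_const kappa * Num.sqrt d < d / F,
        8 * h n <= eta * d / Num.sqrt (kappa * n%:R)
      & K.+1%:R * (err / (h n / 4) ^+ 2) < rho n /\
        rho n + 3 * (err / (h n / 4) ^+ 2) <= n%:R / kappa] by near: m; exact: adm.
have msurj : forall k, exists x, sigma m x = k by near: m; exact: surj.
have mbal : forall k, m.+1%:R <= kappa * #|bmc_cluster (sigma m) k|%:R by near: m; exact: bal.
pose nu a b : R := (ell m.+1)%:R * (pi a * p a b) /
  (#|bmc_cluster (sigma m) a|%:R * #|bmc_cluster (sigma m) b|%:R).
have msep : forall i j : 'I_K, i != j ->
    eta * ((ell m.+1)%:R / m.+1%:R) / Num.sqrt (kappa * m.+1%:R) <=
    l2norm (block_center (sigma m) nu i - block_center (sigma m) nu j).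
  move=> i j ij; apply: (block_center_separated _ kap0 eta0 mbal) => //.
  by move: i j ij; near: m; exact: sep.
have := few_misclassified K0 msurj (fun a b => stationary_mul_itv a b ps pist) kap1 mbal nl
  gam1 gam2 msep (h0 _) hsep rho1 rho2 good out.
have /andP[_ l0] := nl.
have nR : 0 < m.+1%:R :> R by rewrite ltr0n.
have lR : 0 < (ell m.+1)%:R :> R by rewrite ltr0n (leq_trans _ l0).
move=> /le_trans Ele; rewrite ler_pdivrMr //; apply: Ele.
rewrite !exprMn !exprVn !sqr_sqrtr ?divr_ge0 ?mulr_ge0 ?(ltW kap0) //.
apply: le_of_eq; field.
by rewrite !gt_eqF.
Unshelve. all: by end_near.
Qed.

(* The m-th chain of the sequence has n = m.+1 states, so that the state space
   is never empty; ell, gam, h and rho are indexed by the number of states. *)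
Theorem theorem3p4 (R : realType) (K : nat) (alpha : 'I_K -> R) (p : 'M[R]_K)
    (pi : 'I_K -> R) (sigma : forall m : nat, 'I_m.+1 -> 'I_K)
    (ell : nat -> nat) (gam h rho : nat -> R)
    (d : nat -> measure_display) (T : forall m, measurableType (d m))
    (P : forall m, probability (T m) R)
    (X : forall m : nat, nat -> T m -> 'I_m.+1)
    (E : forall m : nat, T m -> {set 'I_m.+1})
    (K_gt0 : (0 < K)%N)
    (alpha_sum : \sum_k alpha k = 1)
    (alpha_gt0 : forall k, 0 < alpha k)
    (p_stochastic : stochastic_mx p)
    (p_irreducible : irreducible_mx p)
    (pi_stationary : stationary_distribution p pi)
    (I_gt0 : (0 < information alpha p pi)%E)
    (sigma_surj : \forall m \near \oo, forall k, exists x, sigma m x = k)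
    (sigma_sizes : forall k,
       (#|bmc_cluster (sigma m) k|%:R / m.+1%:R : R) @[m --> \oo] --> alpha k)
    (X_markov : \forall m \near \oo,
       markov_chain (P m) (bmc_stationary pi (sigma m))
         (bmc_kernel p (sigma m)) (X m))
    (ell_gt0 : forall n, (0 < ell n)%N)
    (ell_omega : omega_of (fun n => (ell n)%:R : R) (fun n => n%:R))
    (gam_gt0 : forall n, 0 < gam n)
    (h_gt0 : forall n, 0 < h n)
    (rho_gt0 : forall n, 0 < rho n)
    (gam_omega : omega_of gam (fun n => Num.sqrt ((ell n)%:R / n%:R)))
    (gam_o : o_of gam (fun n => (ell n)%:R / n%:R))
    (h_omega : omega_of (fun n => n%:R * h n ^+ 2)
                        (fun n => (ell n)%:R / n%:R))
    (h_o : o_of (fun n => n%:R * h n ^+ 2)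
                (fun n => ((ell n)%:R / n%:R) ^+ 2))
    (rho_omega : omega_of rho (fun n => ((ell n)%:R / n%:R) / h n ^+ 2))
    (rho_o : o_of rho (fun n => n%:R))
    (E_rv : forall m, discrete_rv (E m))
    (E_outcome : forall m (w : T m),
       clustering_outcome (ell m.+1) (sigma m) (gam m.+1) (h m.+1) (rho m.+1)
         (fun t => X m t w) (E m w)) :
  OP P (fun m w => #|E m w|%:R / m.+1%:R) (fun m => m.+1%:R / (ell m.+1)%:R) /\
  oP P (fun m w => #|E m w|%:R / m.+1%:R) (fun=> 1).
Proof.
have [kappa kap1 bal] := eventually_balanced alpha_gt0 sigma_sizes.
have [C C0 few] := eventually_few_misclassified K_gt0 alpha_gt0 p_stochastic pi_stationary
  I_gt0 sigma_surj sigma_sizes kap1 bal ell_omega h_gt0 gam_omega gam_o h_o rho_omega rho_o.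
have [B B0 notgood] := prob_not_good_path p_stochastic p_irreducible pi_stationary kap1.
pose bad m (delta : R) :=
  [set w | delta <= `|#|E m w|%:R / m.+1%:R / (m.+1%:R / (ell m.+1)%:R)|].
have ell0 m : 0 < (ell m.+1)%:R :> R by rewrite ltr0n.
have ratio_ge0 m w : 0 <= #|E m w|%:R / m.+1%:R / (m.+1%:R / (ell m.+1)%:R) :> R.
  by rewrite !divr_ge0.
have meas m (A : {set 'I_m.+1} -> Prop) : measurable [set w | A (E m w)].
  exact: measurable_discrete_rv (E_rv m).
(* On good paths the ratio is at most [C], so one level [C + 1] serves every [eps] and only the
   probability of the other paths has to be made small. *)
have tail (eps : R) : 0 < eps -> \forall m \near \oo, (P m (bad m (C + 1)%R) <= eps%:E)%E.
  move=> eps0; near=> m.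
  have surj : forall k, exists x, sigma m x = k by near: m; exact: sigma_surj.
  have sizes : forall k, m.+1%:R <= kappa * #|bmc_cluster (sigma m) k|%:R.
    by near: m; exact: bal.
  have mc : markov_chain (P m) (bmc_stationary pi (sigma m)) (bmc_kernel p (sigma m)) (X m).
    by near: m; exact: X_markov.
  have fewm : forall (x : nat -> 'I_m.+1) (E' : {set 'I_m.+1}),
      good_path p pi (sigma m) kappa (ell m.+1) (mkseq x (ell m.+1).+1) ->
      clustering_outcome (ell m.+1) (sigma m) (gam m.+1) (h m.+1) (rho m.+1) x E' ->
      #|E'|%:R / m.+1%:R <= C * (m.+1%:R / (ell m.+1)%:R) by near: m; exact: few.
  (* Since [expR (- d) <= 1 / d], this bounds the exponential by [eps / 2]; [nbig] does the same for
     [B / n]. *)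
  have dbig : 2 / eps <= (ell m.+1)%:R / m.+1%:R.
    by near: m; exact: (near_inftyS (omega_of_near _ ell_omega)).
  have nbig : 2 * B / eps <= m.+1%:R.
    by near: m; exact: (near_inftyS (nbhs_infty_ger _)).
  have mbad : measurable (bad m (C + 1)%R).
    exact: (meas m (fun E' => C + 1 <= `|#|E'|%:R / m.+1%:R / (m.+1%:R / (ell m.+1)%:R)|)).
  pose not_good := [set w |
    ~ good_path p pi (sigma m) kappa (ell m.+1) (mkseq (X m ^~ w) (ell m.+1).+1)].
  have mnot : measurable not_good.
    exact: (measurable_trajectory mc 0 (ell m.+1).+1
      (fun s => ~ good_path p pi (sigma m) kappa (ell m.+1) s)).
  apply: (@le_trans _ _ (P m not_good)).
    apply: le_measure; rewrite ?inE // => w; rewrite /bad /= ger0_norm // => Cw good.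
    have := fewm _ _ good (E_outcome m w).
    rewrite -ler_pdivrMr ?divr_gt0 // => /(le_trans Cw).
    by rewrite gerDl ler10.
  rewrite /not_good (prob_trajectory mc (bmc_stationary_kernel surj pi_stationary) (ell m.+1)
    (fun s => ~ good_path p pi (sigma m) kappa (ell m.+1) s)).
  rewrite lee_fin; apply: le_trans (notgood _ _ _ surj sizes (ell_gt0 _)) _.
  have d0 : 0 < (ell m.+1)%:R / m.+1%:R :> R by rewrite divr_gt0.
  rewrite [leRHS]splitr lerD //.
    rewrite expRN -[leRHS]invrK lef_pV2 ?posrE ?expR_gt0 ?invr_gt0 ?divr_gt0 //.
    rewrite invf_div; apply: le_trans dbig _.
    by apply: le_trans (expR_ge1Dx _); rewrite lerDr.
  by move: nbig; rewrite !ler_pdivrMr //; lra.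
split=> [eps eps0|delta delta0].
  have [N _ HN] := tail _ eps0.
  exists (C + 1), N; split; first by rewrite ltr_wpDl.
  by move=> m Nm; exact: HN (ltnW Nm).
have meas_delta m : measurable [set w | delta <= `|#|E m w|%:R / m.+1%:R / 1|].
  exact: (meas m (fun E' => delta <= `|#|E'|%:R / m.+1%:R / 1|)).
apply/fine_cvgP; split; first by apply: nearW => m; exact: fin_num_measure.
apply/cvgr0Pnorm_le => eps eps0; near=> m.
(* For such [m] a proportion of at least [delta] misclassified states forces the rescaled ratio to
   reach [C + 1], so that [tail] applies. *)
have dbig : (C + 1) / delta <= (ell m.+1)%:R / m.+1%:R.
  by near: m; exact: (near_inftyS (omega_of_near _ ell_omega)).
have small : (P m (bad m (C + 1)%R) <= eps%:E)%E by near: m; exact: tail.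
rewrite /= ger0_norm ?fine_ge0 // -lee_fin fineK ?fin_num_measure //.
apply: le_trans small; apply: le_measure; rewrite ?inE //.
  exact: (meas m (fun E' => C + 1 <= `|#|E'|%:R / m.+1%:R / (m.+1%:R / (ell m.+1)%:R)|)).
move=> w; rewrite /bad /= divr1 !ger0_norm ?divr_ge0 // => Ew.
rewrite invf_div; apply: le_trans (ler_pM _ _ Ew dbig); rewrite ?divr_ge0 ?addr_ge0 ?(ltW delta0) //.
by rewrite mulrC divfK // gt_eqF.
Unshelve. all: by end_near.
Qed.
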